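(* Assume Hypotheses 1, 2* and 3 (stated in the context) for some integer $r\ge2$. Let $K:=\Pi_\perp(\Gamma)=\Pi_\perp(U)$. Then $\Gamma$ contains every subset of $U$ that is positively invariant under the flow, and there exists a $C^r$ function $h:K\to\mathbb{R}^n$ such that $\Gamma=\{(h(z),z):z\in K\}$. Moreover, $\|h(z_2)-h(z_1)\|<\|z_2-z_1\|$ for all $z_1\ne z_2$ in $K$, $\|Dh(z)\|<1$ for all $z\in K$, and all higher derivatives of $h$ (up to order $r$) are bounded on $K$.
   Context: System $\dot a=f(a,z)$, $\dot z=g(a,z)$, $(a,z)\in\mathbb{R}^n\times\mathbb{R}^m$, $x=(a,z)$, $X=\mathbb{R}^n\times\mathbb{R}^m$; Euclidean inner product, norm and induced operator norm. $\Phi$ is the flow; $\Gamma\subseteq U$ is positively invariant if $\Phi(t,x)$ exists for all $t\ge0$ for each $x\in\Gamma$ and $\Phi(t,\Gamma)\subseteq\Gamma$ for $t\ge0$. $\Pi(a,z)=a$, $\Pi_\perp(a,z)=z$. $\mathbb{B}_d(x)=\{(a',z'):\|a'-a\|\le d,\|z'-z\|\le d\}$; $\mathcal{L}(x_1,x_2)=\|a_2-a_1\|^2-\|z_2-z_1\|^2$; $\mathcal{C}(x)=\{x'\in X:\mathcal{L}(x',x)\ge0\}$. Hypothesis 1: $U$ is open and convex, and there is $d>0$ with $\mathcal{C}(x)\cap U\subset\mathbb{B}_d(x)$ for all $x\in U$. Hypothesis 2*: $f,g$ are $C^r$ ($r\ge2$) on $U$ with first through $r$-th derivatives bounded on $U$;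 there exist a continuous positive $\alpha:U\to\mathbb{R}$, a continuous nonnegative $\ell:U\to\mathbb{R}$ and constants $c_1,c_r>0$ such that for all $x\in U$: $\langle a',D_af(x)a'\rangle\ge\alpha(x)\|a'\|^2$ ($a'\in\mathbb{R}^n$); $\langle z',D_zg(x)z'\rangle\le\ell(x)\|z'\|^2$ ($z'\in\mathbb{R}^m$); $\alpha(x)\ge\ell(x)+\|D_zf(x)\|+\|D_ag(x)\|+c_1$; and $\alpha(x)\ge r\ell(x)+(r+1)\|D_ag(x)\|+c_r$. Hypothesis 3: $\Gamma\subset U$ is positively invariant and $\Pi_\perp(\Gamma)=\Pi_\perp(U)$. *)

(* Defs.v *)
From Stdlib Require Import Reals ClassicalEpsilon.
From mathcomp Require Import ssreflect ssrfun ssrbool eqtype ssrnat seq choice fintype bigop.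
Set Implicit Arguments. Unset Strict Implicit.

Open Scope R_scope.

Definition vec (I : finType) := I -> R.

Definition vsum {I : finType} (F : I -> R) : R := \big[Rplus/0]_(i : I) F i.
Definition inner {I : finType} (u v : vec I) : R := vsum (fun i => u i * v i).
Definition vnorm {I : finType} (u : vec I) : R := sqrt (inner u u).
Definition vsub {I : finType} (u v : vec I) : vec I := fun i => u i - v i.
Definition vshift {I : finType} (x : vec I) (i : I) (t : R) : vec I :=
  fun j => if j == i then x j + t else x j.

Definition opnorm {I J : finType} (L : vec I -> vec J) : R :=
  epsilon (inhabits 0)
    (is_lub (fun t => exists v : vec I, vnorm v <= 1 /\ t = vnorm (L v))).

Definition pderiv {I : finType} (F : vec I -> R) (i : I) (x : vec I) : R :=
  epsilon (inhabits 0) (fun l => derivable_pt_lim (fun t => F (vshift x i t)) 0 l).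

Definition iter_pderiv {I : finType} (F : vec I -> R) (l : seq I) : vec I -> R :=
  foldr (fun i G => pderiv G i) F l.

Definition cont_on {I : finType} (U : vec I -> Prop) (G : vec I -> R) : Prop :=
  forall x, U x -> forall eps, eps > 0 -> exists delta, delta > 0 /\
    forall y, U y -> vnorm (vsub y x) < delta -> Rabs (G y - G x) < eps.

(** C^r on U (U open) : all partial derivatives of order <= r exist and are
    continuous on U. *)
Definition Cr_on {I : finType} (r : nat) (U : vec I -> Prop) (F : vec I -> R) : Prop :=
  (forall (l : seq I), (size l < r)%N -> forall (i : I) x, U x ->
      exists d, derivable_pt_lim (fun t => iter_pderiv F l (vshift x i t)) 0 d)
  /\ (forall (l : seq I), (size l <= r)%N -> cont_on U (iter_pderiv F l)).

Definition CrV {I J : finType} (r : nat) (U : vec I -> Prop) (F : vec I -> vec J) : Prop :=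
  forall j, Cr_on r U (fun x => F x j).

Definition bounded_derivs {I J : finType} (k r : nat) (U : vec I -> Prop)
  (F : vec I -> vec J) : Prop :=
  forall (j : J) (l : seq I), (k <= size l)%N -> (size l <= r)%N ->
    exists M, forall x, U x -> Rabs (iter_pderiv (fun y => F y j) l x) <= M.

Definition jac {I J : finType} (F : vec I -> vec J) (x : vec I) : vec I -> vec J :=
  fun v j => vsum (fun i => pderiv (fun y => F y j) i x * v i).

Definition pairv {A B : finType} (a : vec A) (z : vec B) : vec (A + B)%type :=
  fun s => match s with inl i => a i | inr j => z j end.
Definition PiA {A B : finType} (x : vec (A + B)%type) : vec A := fun i => x (inl i).
Definition PiB {A B : finType} (x : vec (A + B)%type) : vec B := fun j => x (inr j).

Definition Da {A B C : finType} (F : vec (A + B)%type -> vec C) (x : vec (A + B)%type)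
  : vec A -> vec C :=
  fun a' k => vsum (fun i => pderiv (fun y => F y k) (inl i) x * a' i).
Definition Dz {A B C : finType} (F : vec (A + B)%type -> vec C) (x : vec (A + B)%type)
  : vec B -> vec C :=
  fun z' k => vsum (fun j => pderiv (fun y => F y k) (inr j) x * z' j).

Definition Lfun {A B : finType} (x1 x2 : vec (A + B)%type) : R :=
  vnorm (vsub (PiA x2) (PiA x1)) ^ 2 - vnorm (vsub (PiB x2) (PiB x1)) ^ 2.
Definition cone {A B : finType} (x x' : vec (A + B)%type) : Prop := Lfun x' x >= 0.
Definition boxB {A B : finType} (d : R) (x x' : vec (A + B)%type) : Prop :=
  vnorm (vsub (PiA x') (PiA x)) <= d /\ vnorm (vsub (PiB x') (PiB x)) <= d.

Definition open_vset {I : finType} (U : vec I -> Prop) : Prop :=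
  forall x, U x -> exists eps, eps > 0 /\ forall y, vnorm (vsub y x) < eps -> U y.
Definition convex_vset {I : finType} (U : vec I -> Prop) : Prop :=
  forall x y t, U x -> U y -> 0 <= t <= 1 -> U (fun s => (1 - t) * x s + t * y s).

Definition forward_solution {I : finType} (U : vec I -> Prop) (F : vec I -> vec I)
  (x0 : vec I) (phi : R -> vec I) : Prop :=
  phi 0 = x0 /\ forall t, 0 <= t -> U (phi t) /\
    forall s, derivable_pt_lim (fun u => phi u s) t (F (phi t) s).

Definition pos_inv {I : finType} (U : vec I -> Prop) (F : vec I -> vec I)
  (G : vec I -> Prop) : Prop :=
  (forall x, G x -> U x) /\
  forall x, G x -> exists phi, forward_solution U F x phi /\ forall t, 0 <= t -> G (phi t).

(* Main.v *)
Require Import Defs.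
From Stdlib Require Import Reals ClassicalEpsilon.
From HB Require Import structures.
From Stdlib Require Import Lra FunctionalExtensionality.
From Coquelicot Require Import Coquelicot.
From mathcomp Require Import ssreflect ssrfun ssrbool eqtype ssrnat seq choice fintype bigop.
Set Implicit Arguments.
Unset Strict Implicit.
Open Scope R_scope.

(** For two orbits in [U], the cone |a2 - a1| >= |z2 - z1| is forward invariant and
    |a2 - a1| grows exponentially in it, which Hypothesis 1 forbids.  Hence two
    points that stay in [U] forever satisfy |a2 - a1| < |z2 - z1|, so [Gamma] is a
    Lipschitz graph and contains every invariant set; a slightly wider cone, which
    is mapped into the first one in unit time, gives a Lipschitz constant below 1.

    Smoothness is obtained on orbits rather than on [h].  Let X(t, z) be the orbit of
    the point of [Gamma] above z.  Its z-derivatives of order q solve the linear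
    equation Y' = DF(X) Y + P, where P involves derivatives of lower order; their
    z-components at time 0 are known and they grow at most like exp (q M(t)), M being
    the integrated growth rate of the z-directions.  Since alpha dominates r times
    this rate, a solution with a small forcing and small initial z-component whose
    growth is that slow must be small.  Applied to differences of difference
    quotients this proves that they converge, and applied to differences of
    derivatives at nearby points it proves continuity.  At t = 0 the a-component of
    X is [h]. *)

(** * Euclidean vectors and operator norms *)

(** [Gamma] has no regularity to start from, and points of [U] near it may leave [U], so neither a
    flow map near [Gamma] nor an invariance equation for [h] can be differentiated. What remains is
    a two-point problem for linear equations: the z-component is known at time 0, and a growth bound
    holds at a late time T. Where |a| - |z| is positive for an unforced solution, it grows at rate
    at least alpha - |D_a g|. Since r ell + (r + 1) |D_a g| + cr = r (ell + |D_a g|) + |D_a g| + cr,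
    the last gap condition says that this rate exceeds r times the growth rate of the z-directions
    by cr. Half of cr provides the decay in T; the other half is the budget for the small
    exponential losses [e]. A difference quotient of a derivative of order q >= 1 has only an a
    priori bound of size 1 / |s|. This bound is used at the time when orbits that start at distance
    |s| have separated to a fixed small size, where 1 / |s| is worth just one more order of
    growth. *)

HB.instance Definition _ := Monoid.isComLaw.Build R 0 Rplus
  (fun x y z => esym (Rplus_assoc x y z)) Rplus_comm Rplus_0_l.

Section FiniteSums.
Context {I : finType}.
Implicit Types (u v w : vec I) (c : R).

Lemma eq_vsum u v : (forall i, u i = v i) -> vsum u = vsum v.
Proof. by move=> uv; apply: eq_bigr => i _. Qed.

Lemma vsumD u v : vsum (fun i => u i + v i) = vsum u + vsum v.
Proof. exact: big_split. Qed.

Lemma vsumZ c u : vsum (fun i => c * u i) = c * vsum u.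
Proof.
rewrite /vsum (big_morph (Rmult c) (id1 := 0) (op1 := Rplus)) //.
  by move=> x y; ring.
by ring.
Qed.

Lemma vsumZr c u : vsum (fun i => u i * c) = vsum u * c.
Proof. by rewrite Rmult_comm -vsumZ; apply: eq_vsum => i; ring. Qed.

Lemma vsumB u v : vsum (fun i => u i - v i) = vsum u - vsum v.
Proof.
have -> : vsum u - vsum v = vsum u + -1 * vsum v by ring.
by rewrite -vsumZ -vsumD; apply: eq_vsum => i; ring.
Qed.

Lemma vsum0 : vsum (fun _ : I => 0) = 0.
Proof. exact: big1_eq. Qed.

Lemma vsum_le u v : (forall i, u i <= v i) -> vsum u <= vsum v.
Proof.
move=> uv; rewrite /vsum; elim/big_ind2: _ => //; first exact: Rle_refl.
by move=> *; apply: Rplus_le_compat.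
Qed.

Lemma vsum_ge0 u : (forall i, 0 <= u i) -> 0 <= vsum u.
Proof. by move=> u0; rewrite -vsum0; apply: vsum_le. Qed.

Lemma vsum_Rabs u : Rabs (vsum u) <= vsum (fun i => Rabs (u i)).
Proof.
rewrite /vsum; elim/big_ind2: _ => //.
- by rewrite Rabs_R0; exact: Rle_refl.
- move=> a b c d ab cd; apply: Rle_trans (Rabs_triang _ _) _.
  exact: Rplus_le_compat.
- by move=> i _; exact: Rle_refl.
Qed.

Lemma vsum_ge1 u i : (forall j, 0 <= u j) -> u i <= vsum u.
Proof.
move=> u0; rewrite /vsum (bigD1 i) //=.
suff : 0 <= \big[Rplus/0]_(j | j != i) u j by lra.
by apply: big_ind => [||j _]; [lra | move=> *; lra | exact: u0].
Qed.

Lemma vsum_delta i u : vsum (fun j => u j * (if j == i then 1 else 0)) = u i.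
Proof.
rewrite /vsum (bigD1 i) //= eqxx big1 ?Rplus_0_r ?Rmult_1_r //.
by move=> j /negbTE ->; rewrite Rmult_0_r.
Qed.

End FiniteSums.

Lemma vsum_sumType {A B : finType} (u : vec (A + B)%type) :
  vsum u = vsum (fun i => u (inl i)) + vsum (fun j => u (inr j)).
Proof. exact: big_sumType. Qed.

Section Norm.
Context {I : finType}.
Implicit Types (u v w : vec I) (c : R).

Definition vzero : vec I := fun _ => 0.
Definition delta (i : I) : vec I := fun j => if j == i then 1 else 0.

Lemma innerC u v : inner u v = inner v u.
Proof. by apply: eq_vsum => i; ring. Qed.

Lemma innerDr u v w : inner u (fun i => v i + w i) = inner u v + inner u w.
Proof. by rewrite -vsumD; apply: eq_vsum => i; ring. Qed.

Lemma innerBr u v w : inner u (fun i => v i - w i) = inner u v - inner u w.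
Proof. by rewrite -vsumB; apply: eq_vsum => i; ring. Qed.

Lemma innerZr c u v : inner u (fun i => c * v i) = c * inner u v.
Proof. by rewrite -vsumZ; apply: eq_vsum => i; ring. Qed.

Lemma innerZl c u v : inner (fun i => c * u i) v = c * inner u v.
Proof. by rewrite innerC innerZr innerC. Qed.

Lemma inner_ge0 u : 0 <= inner u u.
Proof. by apply: vsum_ge0 => i; nra. Qed.

Lemma vnorm_ge0 u : 0 <= vnorm u.
Proof. exact: sqrt_pos. Qed.

Lemma vnorm2 u : vnorm u ^ 2 = inner u u.
Proof. by rewrite /= Rmult_1_r sqrt_sqrt //; exact: inner_ge0. Qed.

Lemma eq_vnorm u v : (forall i, u i = v i) -> vnorm u = vnorm v.
Proof. by move=> uv; congr sqrt; apply: eq_vsum => i; rewrite uv. Qed.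

Lemma vnormZ c u : vnorm (fun i => c * u i) = Rabs c * vnorm u.
Proof.
rewrite /vnorm innerZr innerZl -sqrt_Rsqr_abs -sqrt_mult.
- by congr sqrt; rewrite /Rsqr; ring.
- exact: Rle_0_sqr.
- exact: inner_ge0.
Qed.

Lemma cauchy_schwarz u v : Rabs (inner u v) <= vnorm u * vnorm v.
Proof.
have H : inner u v ^ 2 <= inner u u * inner v v.
  set a := inner u u; set b := inner u v; set c := inner v v.
  have a0 : 0 <= a := inner_ge0 u.
  have q t : 0 <= a * t ^ 2 + 2 * t * b + c.
    have := inner_ge0 (fun i => t * u i + v i).
    rewrite innerDr innerZr ![inner (fun _ => _ + _) _]innerC !innerDr !innerZr.
    by rewrite (innerC v u) -/a -/b -/c => ?; lra.
  case: (Req_dec a 0) => [a00|an0].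
    have c0 : 0 <= c := inner_ge0 v.
    case: (Req_dec b 0) => [b0|bn0]; first by rewrite b0; nra.
    (* For a = 0 the polynomial is affine in t, and this t gives it the value -1. *)
    exfalso; have := q (- (c + 1) / (2 * b)); rewrite a00.
    have -> : 2 * (- (c + 1) / (2 * b)) * b = - (c + 1) by field.
    by lra.
  have ap : 0 < a by lra.
  have := q (- b / a).
  have -> : a * (- b / a) ^ 2 + 2 * (- b / a) * b + c = (a * c - b ^ 2) / a.
    by field.
  move=> h; have := Rmult_le_compat_r a _ _ a0 h.
  have -> : (a * c - b ^ 2) / a * a = a * c - b ^ 2 by field.
  by lra.
rewrite -sqrt_Rsqr_abs -sqrt_mult; [|exact: inner_ge0..].
by apply: sqrt_le_1_alt; rewrite /Rsqr; lra.
Qed.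

Lemma inner_le u v : inner u v <= vnorm u * vnorm v.
Proof. exact: Rle_trans (Rle_abs _) (cauchy_schwarz u v). Qed.

Lemma inner_ge u v : - (vnorm u * vnorm v) <= inner u v.
Proof. by have := cauchy_schwarz u v; have := Rabs_maj2 (inner u v); lra. Qed.

Lemma vnorm_triang u v : vnorm (fun i => u i + v i) <= vnorm u + vnorm v.
Proof.
have := vnorm_ge0 u; have := vnorm_ge0 v; have := vnorm_ge0 (fun i => u i + v i).
have : vnorm (fun i => u i + v i) ^ 2 <= (vnorm u + vnorm v) ^ 2.
  rewrite vnorm2 innerDr ![inner (fun _ => _ + _) _]innerC !innerDr.
  by rewrite -!vnorm2 (innerC v u); have := inner_le u v; nra.
by move=> *; nra.
Qed.

Lemma vnormN u : vnorm (fun i => - u i) = vnorm u.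
Proof.
rewrite (eq_vnorm (v := fun i => -1 * u i)) => [|i]; last by ring.
by rewrite vnormZ Rabs_Ropp Rabs_R1 Rmult_1_l.
Qed.

Lemma vnorm_subC u v : vnorm (vsub u v) = vnorm (vsub v u).
Proof. by rewrite -vnormN; apply: eq_vnorm => i; rewrite /vsub; ring. Qed.

Lemma vnorm_triangB u v : vnorm (fun i => u i - v i) <= vnorm u + vnorm v.
Proof. by have := vnorm_triang u (fun i => - v i); rewrite vnormN. Qed.

Lemma vnorm_comp u i : Rabs (u i) <= vnorm u.
Proof.
rewrite -sqrt_Rsqr_abs; apply: sqrt_le_1_alt; rewrite /Rsqr.
by apply: (vsum_ge1 (u := fun i => u i * u i)) => j; nra.
Qed.

Lemma vnorm_le_sum u : vnorm u <= vsum (fun i => Rabs (u i)).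
Proof.
set S := vsum _.
have S0 : 0 <= S by apply: vsum_ge0 => i; exact: Rabs_pos.
rewrite -(sqrt_Rsqr S) //; apply: sqrt_le_1_alt; rewrite /Rsqr.
rewrite {1}/S -vsumZr; apply: vsum_le => i.
have le : Rabs (u i) <= S.
  by apply: (vsum_ge1 (u := fun i => Rabs (u i))) => j; exact: Rabs_pos.
have := Rabs_pos (u i); rewrite -(Rabs_pos_eq (u i * u i)) ?Rabs_mult; nra.
Qed.

Lemma vnorm0 : vnorm (I := I) vzero = 0.
Proof. by rewrite /vnorm /inner /vzero (eq_vsum (v := fun=> 0)) ?vsum0 ?sqrt_0 // => i; ring. Qed.

Lemma vnorm_eq0 u : vnorm u = 0 -> forall i, u i = 0.
Proof.
move=> u0 i; have := vnorm_comp u i; rewrite u0 => h.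
by apply: Rabs_eq_0; have := Rabs_pos (u i); lra.
Qed.

Lemma vnorm_delta i : vnorm (I := I) (delta i) = 1.
Proof.
rewrite /vnorm /inner (eq_vsum (v := fun j => 1 * (if j == i then 1 else 0))).
  by rewrite (vsum_delta i (fun=> 1)) sqrt_1.
by move=> j; rewrite /delta; case: (j == i); ring.
Qed.

Lemma vnorm_le_card u c : (forall i, Rabs (u i) <= c) ->
  vnorm u <= vsum (fun _ : I => 1) * c.
Proof.
move=> uc; apply: Rle_trans (vnorm_le_sum u) _.
by rewrite -vsumZr; apply: vsum_le => i; rewrite Rmult_1_l.
Qed.

Lemma vsub_vshift (z : vec I) i s : forall j, vsub (vshift z i s) z j = s * delta i j.
Proof. by move=> j; rewrite /vsub /vshift /delta; case: (j == i); ring. Qed.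

Lemma vnorm_vshift (z : vec I) i s : vnorm (vsub (vshift z i s) z) = Rabs s.
Proof.
rewrite (eq_vnorm (v := fun j => s * delta i j)); last exact: vsub_vshift.
by rewrite vnormZ vnorm_delta Rmult_1_r.
Qed.

Lemma vshift_vshift (z : vec I) i s t : vshift (vshift z i s) i t = vshift z i (s + t).
Proof.
apply: functional_extensionality => j; rewrite /vshift.
by case: (j == i) => //; ring.
Qed.

Lemma vshift0 (z : vec I) i : vshift z i 0 = z.
Proof.
apply: functional_extensionality => j; rewrite /vshift.
by case: (j == i) => //; ring.
Qed.

End Norm.

Section Product.
Context {A B : finType}.
Implicit Types (v : vec (A + B)%type).

Lemma vnorm_prod v : vnorm v ^ 2 = vnorm (PiA v) ^ 2 + vnorm (PiB v) ^ 2.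
Proof. by rewrite !vnorm2 /inner vsum_sumType. Qed.

Lemma vnorm_PiA v : vnorm (PiA v) <= vnorm v.
Proof.
have := vnorm_prod v; have := vnorm_ge0 v; have := vnorm_ge0 (PiA v).
by have := vnorm_ge0 (PiB v); nra.
Qed.

Lemma vnorm_PiB v : vnorm (PiB v) <= vnorm v.
Proof.
have := vnorm_prod v; have := vnorm_ge0 v; have := vnorm_ge0 (PiA v).
by have := vnorm_ge0 (PiB v); nra.
Qed.

Lemma vnorm_le_AB v : vnorm v <= vnorm (PiA v) + vnorm (PiB v).
Proof.
have := vnorm_prod v; have := vnorm_ge0 v; have := vnorm_ge0 (PiA v).
by have := vnorm_ge0 (PiB v); nra.
Qed.

Lemma pairv_Pi v : pairv (PiA v) (PiB v) = v.
Proof. by apply: functional_extensionality => -[]. Qed.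

End Product.

Section OperatorNorm.
Context {I J : finType} (L : vec I -> vec J).
Hypothesis Lhom : forall c v j, L (fun i => c * v i) j = c * L v j.

(** [opnorm] is a Hilbert choice, meaningful only once a supremum exists; any bound C supplies
    one. *)
Lemma opnorm_lub C : (forall v, vnorm (L v) <= C * vnorm v) ->
  is_lub (fun t => exists v : vec I, vnorm v <= 1 /\ t = vnorm (L v)) (opnorm L).
Proof.
move=> LC; apply: epsilon_spec.
have L0 : vnorm (L vzero) = 0.
  have := LC vzero; rewrite vnorm0 Rmult_0_r; have := vnorm_ge0 (L vzero); lra.
have [] := completeness (fun t => exists v : vec I, vnorm v <= 1 /\ t = vnorm (L v)).
- exists (Rabs C) => t [v [v1 ->]]; apply: Rle_trans (LC v) _.
  by have := Rle_abs C; have := Rabs_pos C; have := vnorm_ge0 v; nra.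
- by exists 0, vzero; rewrite L0 vnorm0; split => //; lra.
by move=> l; exists l.
Qed.

Lemma opnorm_ge0 C : (forall v, vnorm (L v) <= C * vnorm v) -> 0 <= opnorm L.
Proof.
move=> LC; have [ub _] := opnorm_lub LC.
apply: Rle_trans (vnorm_ge0 (L vzero)) _; apply: ub.
by exists vzero; split => //; rewrite vnorm0; lra.
Qed.

Lemma opnormP C : (forall v, vnorm (L v) <= C * vnorm v) ->
  forall v, vnorm (L v) <= opnorm L * vnorm v.
Proof.
move=> LC v; have [ub _] := opnorm_lub LC.
have := vnorm_ge0 v; case/Rle_lt_or_eq_dec => [v0|v0]; last first.
  by have := LC v; rewrite -v0 !Rmult_0_r.
have : vnorm (L (fun i => / vnorm v * v i)) <= opnorm L.
  apply: ub; exists (fun i => / vnorm v * v i); split => //.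
  rewrite vnormZ Rabs_pos_eq; last by left; exact: Rinv_0_lt_compat.
  by rewrite Rinv_l; lra.
rewrite (eq_vnorm (v := fun j => / vnorm v * L v j)) => [|j]; last exact: Lhom.
rewrite vnormZ Rabs_pos_eq; last by left; exact: Rinv_0_lt_compat.
move=> h; have := Rmult_le_compat_r _ _ _ (vnorm_ge0 v) h.
by rewrite (Rmult_comm (/ _)) Rmult_assoc Rinv_l ?Rmult_1_r //; lra.
Qed.

Lemma opnorm_le C : 0 <= C -> (forall v, vnorm (L v) <= C * vnorm v) -> opnorm L <= C.
Proof.
move=> C0 LC; have [_ lub] := opnorm_lub LC; apply: lub => t [v [v1 ->]].
by apply: Rle_trans (LC v) _; nra.
Qed.

End OperatorNorm.

(** * Partial derivatives and the mean value theorem *)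

Section FiniteChoice.
Context {I : finType}.

Lemma fin_min (P : I -> R -> Prop) :
  (forall i d d', P i d -> 0 < d' <= d -> P i d') ->
  (forall i, exists d, 0 < d /\ P i d) -> exists d, 0 < d /\ forall i, P i d.
Proof.
move=> mono ex.
have [d [d0 H]] : exists d, 0 < d /\ forall i, i \in enum I -> P i d.
  elim: (enum I) => [|i l [d [d0 IH]]]; first by exists 1; split=> //; lra.
  have [d' [d'0 Pd']] := ex i.
  have dd0 := Rmin_pos _ _ d0 d'0.
  exists (Rmin d d'); split=> // j; rewrite inE => /orP[/eqP->|jl].
    by apply: mono Pd' _; split=> //; exact: Rmin_r.
  by apply: mono (IH _ jl) _; split=> //; exact: Rmin_l.
by exists d; split=> // i; apply: H; rewrite mem_enum.
Qed.

Lemma fin_max (P : I -> R -> Prop) :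
  (forall i d d', P i d -> d <= d' -> P i d') ->
  (forall i, exists d, P i d) -> exists d, 0 < d /\ forall i, P i d.
Proof.
move=> mono ex.
have [d [d0 H]] : exists d, 0 < d /\ forall i, i \in enum I -> P i d.
  elim: (enum I) => [|i l [d [d0 IH]]]; first by exists 1; split=> //; lra.
  have [d' Pd'] := ex i.
  exists (Rmax d d'); split; first by have := Rmax_l d d'; lra.
  move=> j; rewrite inE => /orP[/eqP->|jl].
    by apply: mono Pd' _; exact: Rmax_r.
  by apply: mono (IH _ jl) _; exact: Rmax_l.
by exists d; split=> // i; apply: H; rewrite mem_enum.
Qed.

End FiniteChoice.

Lemma vnorm_mono {I : finType} (u v : vec I) :
  (forall i, Rabs (u i) <= Rabs (v i)) -> vnorm u <= vnorm v.
Proof.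
move=> uv; apply: sqrt_le_1_alt; apply: vsum_le => i.
have sq (a : R) : a * a = Rabs a * Rabs a by rewrite -Rabs_mult Rabs_pos_eq; nra.
by rewrite (sq (u i)) (sq (v i)); have := uv i; have := Rabs_pos (u i); nra.
Qed.

Lemma derivable_pt_lim_ext_loc (u v : R -> R) t l (e : posreal) :
  (forall s, Rabs (s - t) < e -> u s = v s) ->
  derivable_pt_lim u t l -> derivable_pt_lim v t l.
Proof.
move=> uv /is_derive_Reals du; apply/is_derive_Reals.
by apply: is_derive_ext_loc du; exists e => s; exact: uv.
Qed.

Lemma derivable_pt_lim_ext (u v : R -> R) t l :
  (forall s, u s = v s) -> derivable_pt_lim u t l -> derivable_pt_lim v t l.
Proof. by move=> uv; apply: (@derivable_pt_lim_ext_loc _ _ _ _ (mkposreal 1 Rlt_0_1)). Qed.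

Lemma derivable_pt_lim_vsum {I : finType} (u : R -> vec I) (v : vec I) t :
  (forall i, derivable_pt_lim (fun s => u s i) t (v i)) ->
  derivable_pt_lim (fun s => vsum (u s)) t (vsum v).
Proof.
move=> du; rewrite /vsum.
suff H (l : seq I) : derivable_pt_lim (fun s => \big[Rplus/0]_(i <- l) u s i) t
  (\big[Rplus/0]_(i <- l) v i) by exact: H.
elim: l => [|i l IH].
  rewrite big_nil; apply: derivable_pt_lim_ext (derivable_pt_lim_const 0 t) => s.
  by rewrite big_nil.
rewrite big_cons.
apply: derivable_pt_lim_ext (derivable_pt_lim_plus _ _ _ _ _ (du i) IH) => s.
by rewrite big_cons.
Qed.

Lemma derivable_pt_lim_inner {I : finType} (u v : R -> vec I) (u' v' : vec I) t :
  (forall i, derivable_pt_lim (fun s => u s i) t (u' i)) ->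
  (forall i, derivable_pt_lim (fun s => v s i) t (v' i)) ->
  derivable_pt_lim (fun s => inner (u s) (v s)) t (inner u' (v t) + inner (u t) v').
Proof.
move=> du dv; rewrite /inner -vsumD.
apply: (derivable_pt_lim_vsum (u := fun s i => u s i * v s i)) => i.
exact: derivable_pt_lim_mult.
Qed.

Section Frechet.
Context {I : finType}.
Implicit Types (F : vec I -> R) (x y : vec I) (U : vec I -> Prop).

Lemma pderivP F i x : (exists d, derivable_pt_lim (fun t => F (vshift x i t)) 0 d) ->
  derivable_pt_lim (fun t => F (vshift x i t)) 0 (pderiv F i x).
Proof. by move=> ex; apply: epsilon_spec. Qed.

Lemma pderiv_eq F i x d : derivable_pt_lim (fun t => F (vshift x i t)) 0 d ->
  pderiv F i x = d.
Proof.
move=> dF; apply: (uniqueness_limite _ 0 _ _ _ dF).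
by apply: pderivP; exists d.
Qed.

(** [pderiv] only speaks of the shift 0. Recentring gives the derivative at every point of a
    coordinate line, as mean value arguments require. *)
Lemma derivable_vshift F i x s d :
  derivable_pt_lim (fun t => F (vshift (vshift x i s) i t)) 0 d ->
  derivable_pt_lim (fun t => F (vshift x i t)) s d.
Proof.
move=> dF; have e : s = 0 + s by ring.
have := @derivable_pt_lim_comp (fun t => t - s)
  (fun t => F (vshift (vshift x i s) i t)) s 1 d.
have -> : s - s = 0 by ring.
move=> H.
have d1 : derivable_pt_lim (fun t => t - s) s 1.
  have -> : 1 = 1 - 0 by ring.
  apply: (derivable_pt_lim_minus id (fun=> s)); first exact: derivable_pt_lim_id.
  exact: derivable_pt_lim_const.
have {H} := H d1 dF; rewrite Rmult_1_r; apply: derivable_pt_lim_ext => t.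
rewrite /Ranalysis1.comp vshift_vshift; congr (F (vshift x i _)); ring.
Qed.

Definition frechet F x (D : vec I) := forall eps, 0 < eps -> exists d, 0 < d /\
  forall y, vnorm (vsub y x) < d ->
    Rabs (F y - F x - inner D (vsub y x)) <= eps * vnorm (vsub y x).

Lemma frechet_chain F (x : R -> vec I) (D v : vec I) t :
  frechet F (x t) D -> (forall i, derivable_pt_lim (fun s => x s i) t (v i)) ->
  derivable_pt_lim (fun s => F (x s)) t (inner D v).
Proof.
move=> FD dx e e0.
set N := vsum (fun _ : I => 1).
set S := vnorm D + N * (1 + vnorm v) + 1.
have N0 : 0 <= N by apply: vsum_ge0 => _; lra.
have S0 : 0 < S by rewrite /S; have := vnorm_ge0 D; have := vnorm_ge0 v; nra.
have [d [d0 Hd]] := FD (e / (4 * S)) ltac:(by apply: Rdiv_lt_0_compat; lra).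
(* The 1 bounds the difference quotients [q] of the curve by N (1 + |v|); the other term brings the
   inner product of D with q - v below e / 4. *)
set e1 := Rmin 1 (e / (4 * (N * vnorm D + 1))).
have P0 : 0 < N * vnorm D + 1 by have := vnorm_ge0 D; nra.
have e10 : 0 < e1 by apply: Rmin_pos; [lra | apply: Rdiv_lt_0_compat; lra].
have [d1 [d10 Hd1]] : exists d, 0 < d /\ forall i h, h <> 0 -> Rabs h < d ->
    Rabs ((x (t + h) i - x t i) / h - v i) < e1.
  apply: (fin_min (P := fun i d => forall h, h <> 0 -> Rabs h < d ->
    Rabs ((x (t + h) i - x t i) / h - v i) < e1)).
    by move=> i d2 d' H [_ d'd2] h h0 hd; apply: H => //; lra.
  move=> i; have [d2 H] := dx i e1 e10.
  by exists d2; split=> //; exact: cond_pos.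
have W0 : 0 < N * (1 + vnorm v) + 1 by have := vnorm_ge0 v; nra.
have d20 : 0 < Rmin d1 (d / (N * (1 + vnorm v) + 1)).
  by apply: Rmin_pos => //; apply: Rdiv_lt_0_compat.
exists (mkposreal _ d20) => h h0 /= hd.
have hd1 : Rabs h < d1 by apply: Rlt_le_trans hd (Rmin_l _ _).
have hd2 : Rabs h < d / (N * (1 + vnorm v) + 1) by apply: Rlt_le_trans hd (Rmin_r _ _).
have ah : 0 < Rabs h by exact: Rabs_pos_lt.
set q : vec I := fun i => (x (t + h) i - x t i) / h.
have qv i : Rabs (q i - v i) < e1 by exact: Hd1.
have dec i : vsub (x (t + h)) (x t) i = h * q i by rewrite /vsub /q; field.
have nq : vnorm q <= N * (1 + vnorm v).
  apply: vnorm_le_card => i; have := qv i; have := vnorm_comp v i.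
  have := Rabs_triang (q i - v i) (v i); have -> : q i - v i + v i = q i by ring.
  by have : e1 <= 1 := Rmin_l _ _; lra.
have nh : vnorm (vsub (x (t + h)) (x t)) = Rabs h * vnorm q.
  by rewrite (eq_vnorm dec) vnormZ.
have lt_d : vnorm (vsub (x (t + h)) (x t)) < d.
  rewrite nh; have := Rmult_lt_compat_r _ _ _ W0 hd2.
  have -> : d / (N * (1 + vnorm v) + 1) * (N * (1 + vnorm v) + 1) = d by field; lra.
  have := Rmult_le_compat_l _ _ _ (Rlt_le _ _ ah) nq; lra.
have := Hd _ lt_d.
have -> : inner D (vsub (x (t + h)) (x t)) = h * inner D q.
  by rewrite -innerZr; apply: eq_vsum => i; rewrite dec.
rewrite nh => H.
have -> : (F (x (t + h)) - F (x t)) / h - inner D v =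
  / h * (F (x (t + h)) - F (x t) - h * inner D q) + (inner D q - inner D v).
  by field.
apply: Rle_lt_trans (Rabs_triang _ _) _.
have t1 : Rabs (/ h * (F (x (t + h)) - F (x t) - h * inner D q)) <= e / 4.
  rewrite Rabs_mult Rabs_inv.
  have := Rmult_le_compat_l _ _ _ (Rlt_le _ _ (Rinv_0_lt_compat _ ah)) H.
  have -> : / Rabs h * (e / (4 * S) * (Rabs h * vnorm q)) = e / 4 * (vnorm q / S).
    by field; lra.
  have : vnorm q / S <= 1.
    apply/Rle_div_l => //; rewrite /S; have := vnorm_ge0 D; lra.
  by nra.
have t2 : Rabs (inner D q - inner D v) <= e / 4.
  rewrite -innerBr; apply: Rle_trans (cauchy_schwarz _ _) _.
  have : vnorm (fun i => q i - v i) <= N * e1.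
    by apply: vnorm_le_card => i; left; exact: qv.
  have : e1 <= e / (4 * (N * vnorm D + 1)) := Rmin_r _ _.
  move=> /(Rmult_le_compat_r _ _ _ (Rlt_le _ _ P0)).
  have -> : e / (4 * (N * vnorm D + 1)) * (N * vnorm D + 1) = e / 4 by field; lra.
  move=> h1 h2; have := Rmult_le_compat_l _ _ _ (vnorm_ge0 D) h2.
  by have := vnorm_ge0 D; nra.
by lra.
Qed.

Definition C1 U F := (forall i x, U x ->
    exists d, derivable_pt_lim (fun t => F (vshift x i t)) 0 d) /\
  (forall i, cont_on U (pderiv F i)).

(** Travel from x to y one coordinate at a time and use the mean value theorem on each leg; [mix l]
    is the point already moved in the coordinates of [l]. *)
Lemma frechet_C1 U F x : open_vset U -> C1 U F -> U x ->
  frechet F x (fun i => pderiv F i x).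
Proof.
move=> oU [dF cF] Ux e e0.
have [d1 [d10 Ud1]] := oU x Ux.
set N := vsum (fun _ : I => 1).
have N0 : 0 <= N by apply: vsum_ge0 => _; lra.
set e1 := e / (N + 1).
have e10 : 0 < e1 by apply: Rdiv_lt_0_compat; lra.
have [d2 [d20 cd2]] : exists d, 0 < d /\ forall i y, U y -> vnorm (vsub y x) < d ->
    Rabs (pderiv F i y - pderiv F i x) < e1.
  apply: (fin_min (P := fun i d => forall y, U y -> vnorm (vsub y x) < d ->
    Rabs (pderiv F i y - pderiv F i x) < e1)).
    by move=> i d d' H [_ d'd] y Uy yd; apply: H => //; lra.
  by move=> i; have [d [? H]] := cF i x Ux e1 e10; exists d.
exists (Rmin d1 d2); split; first exact: Rmin_pos.
move=> y yd; have y1 := Rlt_le_trans _ _ _ yd (Rmin_l _ _).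
have y2 := Rlt_le_trans _ _ _ yd (Rmin_r _ _).
pose mix (l : seq I) : vec I := fun j => if j \in l then y j else x j.
have step (l : seq I) : uniq l ->
    Rabs (F (mix l) - F x - \big[Rplus/0]_(i <- l) (pderiv F i x * (y i - x i)))
    <= \big[Rplus/0]_(i <- l) 1 * (e1 * vnorm (vsub y x)).
  elim: l => [|i l IH] /=.
    rewrite !big_nil => _; have -> : mix [::] = x by [].
    by rewrite Rminus_diag Rminus_0_r Rabs_R0 Rmult_0_l; exact: Rle_refl.
  move=> /andP[il ul]; rewrite !big_cons.
  have mixE : mix (i :: l) = vshift (mix l) i (y i - x i).
    apply: functional_extensionality => j; rewrite /mix /vshift inE.
    by case: eqP => //= ->; rewrite (negbTE il); ring.
  (* Points of a leg lie coordinatewise between x and y, hence in the ball around x where [U] and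
     the gradient are under control. *)
  have near c : Rmin 0 (y i - x i) <= c <= Rmax 0 (y i - x i) ->
      vnorm (vsub (vshift (mix l) i c) x) <= vnorm (vsub y x).
    move=> c01; apply: vnorm_mono => j; rewrite /vsub /vshift /mix.
    case: eqP => [->|_]; last first.
      by case: (j \in l); [lra | rewrite Rminus_diag Rabs_R0; exact: Rabs_pos].
    rewrite (negbTE il); move: c01; rewrite /Rmin /Rmax /Rabs.
    by repeat case: Rle_dec => ?; repeat case: Rcase_abs => ?; lra.
  have Unear c : Rmin 0 (y i - x i) <= c <= Rmax 0 (y i - x i) ->
      U (vshift (mix l) i c).
    by move=> /near nc; apply: Ud1; lra.
  have dc c : Rmin 0 (y i - x i) <= c <= Rmax 0 (y i - x i) ->
      derivable_pt_lim (fun s => F (vshift (mix l) i s)) c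
        (pderiv F i (vshift (mix l) i c)).
    by move=> /Unear Uc; apply: derivable_vshift; apply: pderivP; exact: dF.
  have [c [c01 mvt]] : exists c, Rmin 0 (y i - x i) <= c <= Rmax 0 (y i - x i) /\
      F (vshift (mix l) i (y i - x i)) - F (vshift (mix l) i 0) =
      pderiv F i (vshift (mix l) i c) * (y i - x i - 0).
    apply: (MVT_gen (fun s => F (vshift (mix l) i s)) 0 (y i - x i)
      (fun c => pderiv F i (vshift (mix l) i c))).
      by move=> c c01; apply/is_derive_Reals/dc; lra.
    move=> c c01; apply: derivable_continuous_pt.
    by exists (pderiv F i (vshift (mix l) i c)); exact: dc.
  have := IH ul; move: mvt; rewrite vshift0 -mixE Rminus_0_r => mvt.
  have : Rabs (pderiv F i (vshift (mix l) i c) - pderiv F i x) < e1.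
    by apply: cd2; [exact: Unear | have := near c c01; lra].
  set dc' := pderiv F i (vshift (mix l) i c) in mvt *.
  have yi : Rabs (y i - x i) <= vnorm (vsub y x) := vnorm_comp (vsub y x) i.
  move=> h1 h2.
  set S := \big[Rplus/0]_(j <- l) _ in h2 *.
  have -> : F (mix (i :: l)) - F x - (pderiv F i x * (y i - x i) + S) =
    (dc' - pderiv F i x) * (y i - x i) + (F (mix l) - F x - S) by lra.
  apply: Rle_trans (Rabs_triang _ _) _; rewrite Rabs_mult.
  by have := Rabs_pos (y i - x i); nra.
have := step (index_enum I) (index_enum_uniq I).
have -> : mix (index_enum I) = y.
  by apply: functional_extensionality => j; rewrite /mix mem_index_enum.
rewrite -/N -/(inner _ _) => H; apply: Rle_trans H _.
rewrite -/(vsum (fun=> 1)) -/N.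
have -> : e = (N + 1) * e1 by rewrite /e1; field; lra.
by have := vnorm_ge0 (vsub y x); nra.
Qed.

(** [G] is an arbitrary scalar function on the segment, so that several components combined in one
    [G] share their intermediate point. *)
Lemma segment_mvt U (G : R -> R) (x y : vec I) (dG : vec I -> R) :
  convex_vset U -> U x -> U y ->
  (forall t, 0 <= t <= 1 -> derivable_pt_lim G t (dG (fun s => (1 - t) * x s + t * y s))) ->
  exists w, U w /\ vnorm (vsub w x) <= vnorm (vsub y x) /\ G 1 - G 0 = dG w.
Proof.
move=> cU Ux Uy dGP.
have [c [mvt c01]] := MVT_cor2 G (fun t => dG (fun s => (1 - t) * x s + t * y s))
  0 1 Rlt_0_1 dGP.
exists (fun s => (1 - c) * x s + c * y s); split; first by apply: cU => //; lra.
split; last by rewrite mvt; lra.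
rewrite (eq_vnorm (v := fun s => c * vsub y x s)) => [|s]; last by rewrite /vsub; ring.
by rewrite vnormZ Rabs_pos_eq; [have := vnorm_ge0 (vsub y x); nra | lra].
Qed.

Lemma derivable_segment U F (x y : vec I) t : open_vset U -> convex_vset U -> C1 U F ->
  U x -> U y -> 0 <= t <= 1 ->
  derivable_pt_lim (fun t => F (fun s => (1 - t) * x s + t * y s)) t
    (inner (fun i => pderiv F i (fun s => (1 - t) * x s + t * y s)) (vsub y x)).
Proof.
move=> oU cU FC Ux Uy t01.
apply: (frechet_chain (x := fun t s => (1 - t) * x s + t * y s)).
  by apply: (frechet_C1 oU FC); exact: cU.
move=> i; apply/is_derive_Reals; rewrite /vsub.
by auto_derive => //; ring.
Qed.

Lemma mvt_C1 U F (x y : vec I) : open_vset U -> convex_vset U -> C1 U F ->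
  U x -> U y -> exists w, U w /\ vnorm (vsub w x) <= vnorm (vsub y x) /\
  F y - F x = inner (fun i => pderiv F i w) (vsub y x).
Proof.
move=> oU cU FC Ux Uy.
have [w [Uw [wn E]]] := segment_mvt (dG := fun w => inner (fun i => pderiv F i w) (vsub y x))
  cU Ux Uy (fun t => derivable_segment oU cU FC Ux Uy).
exists w; split=> //; split=> //; rewrite -E; congr (F _ - F _);
by apply: functional_extensionality => s; ring.
Qed.

Lemma lipschitz_C1 U F M (x y : vec I) : open_vset U -> convex_vset U -> C1 U F ->
  (forall i w, U w -> Rabs (pderiv F i w) <= M) -> U x -> U y ->
  Rabs (F y - F x) <= vsum (fun _ : I => 1) * M * vnorm (vsub y x).
Proof.
move=> oU cU FC FM Ux Uy; have [w [Uw [_ ->]]] := mvt_C1 oU cU FC Ux Uy.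
apply: Rle_trans (cauchy_schwarz _ _) _.
apply: Rmult_le_compat_r; first exact: vnorm_ge0.
by apply: vnorm_le_card => i; exact: FM.
Qed.

Lemma taylor_C1 U F M (x y : vec I) : open_vset U -> convex_vset U -> C1 U F ->
  (forall i w w', U w -> U w' ->
     Rabs (pderiv F i w' - pderiv F i w) <= M * vnorm (vsub w' w)) -> U x -> U y ->
  0 <= M ->
  Rabs (F y - F x - inner (fun i => pderiv F i x) (vsub y x)) <=
  vsum (fun _ : I => 1) * M * vnorm (vsub y x) ^ 2.
Proof.
move=> oU cU FC FM Ux Uy M0; have [w [Uw [wn ->]]] := mvt_C1 oU cU FC Ux Uy.
rewrite ![inner _ (vsub y x)]innerC -innerBr.
apply: Rle_trans (cauchy_schwarz _ _) _.
have -> : vsum (fun _ : I => 1) * M * vnorm (vsub y x) ^ 2 =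
  vnorm (vsub y x) * (vsum (fun _ : I => 1) * (M * vnorm (vsub y x))) by ring.
apply: Rmult_le_compat_l; first exact: vnorm_ge0.
apply: vnorm_le_card => i; apply: Rle_trans (FM i _ _ Ux Uw) _.
exact: Rmult_le_compat_l.
Qed.

End Frechet.

(** * Differential inequalities *)

(* Orbits are only known for nonnegative times; precomposing with [Rmax 0] turns
   continuity on [[0, +oo)] into continuity on the line, so that the closure
   lemmas of the standard library apply verbatim. *)
Definition ctn (u : R -> R) := forall t, continuity_pt (fun s => u (Rmax 0 s)) t.

Lemma ctnP u : ctn u <-> forall t, 0 <= t -> forall eps, 0 < eps -> exists d, 0 < d /\
  forall s, 0 <= s -> Rabs (s - t) < d -> Rabs (u s - u t) < eps.
Proof.
split=> [cu t t0 e e0|cu t e e0].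
  have [d [d0 H]] := cu t e e0; exists d; split=> // s s0 st.
  case: (Req_dec s t) => [->|ne]; first by rewrite Rminus_diag Rabs_R0.
  have := H s; rewrite /= /Rdist !Rmax_right //; apply; split=> //.
  by split=> //; move=> ts; apply: ne.
have [d [d0 H]] := cu _ (Rmax_l 0 t) e e0; exists d; split=> // s [_ st].
apply: H; first exact: Rmax_l.
move: st; rewrite /= /Rdist; apply: Rle_lt_trans.
by rewrite /Rmax /Rabs; repeat case: Rle_dec => ?; repeat case: Rcase_abs => ?; lra.
Qed.

Lemma continuity_vsum {I : finType} (u : R -> vec I) t :
  (forall i, continuity_pt (fun s => u s i) t) -> continuity_pt (fun s => vsum (u s)) t.
Proof.
move=> cu; rewrite /vsum; elim: (index_enum I) => [|i l IH].
  apply: (continuity_pt_ext (fun=> 0)) => [s|]; first by rewrite big_nil.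
  exact: continuity_pt_const.
apply: (continuity_pt_ext (fun s => u s i + \big[Rplus/0]_(j <- l) u s j)).
  by move=> s; rewrite big_cons.
exact: continuity_pt_plus.
Qed.

Section Ctn.
Implicit Types u v : R -> R.

Lemma ctn_const c : ctn (fun=> c).
Proof. by move=> t; exact: continuity_pt_const. Qed.

Lemma ctn_plus u v : ctn u -> ctn v -> ctn (fun t => u t + v t).
Proof. by move=> cu cv t; exact: continuity_pt_plus. Qed.

Lemma ctn_minus u v : ctn u -> ctn v -> ctn (fun t => u t - v t).
Proof. by move=> cu cv t; exact: continuity_pt_minus. Qed.

Lemma ctn_mult u v : ctn u -> ctn v -> ctn (fun t => u t * v t).
Proof. by move=> cu cv t; exact: continuity_pt_mult. Qed.

Lemma ctn_comp (f : R -> R) u : ctn u -> (forall t, continuity_pt f (u (Rmax 0 t))) ->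
  ctn (fun t => f (u t)).
Proof.
move=> cu cf t; exact: (continuity_pt_comp (fun s => u (Rmax 0 s)) f).
Qed.

Lemma ctn_exp u : ctn u -> ctn (fun t => exp (u t)).
Proof.
move=> cu; apply: ctn_comp => // t; apply: derivable_continuous_pt.
exact: derivable_pt_exp.
Qed.

Lemma ctn_id : ctn (fun t => t).
Proof.
apply/ctnP => t _ e e0; exists e; split=> // s _; exact.
Qed.

Lemma ctn_vsum {I : finType} (u : R -> vec I) : (forall i, ctn (fun t => u t i)) ->
  ctn (fun t => vsum (u t)).
Proof.
move=> cu t; apply: (continuity_vsum (u := fun s => u (Rmax 0 s))) => i.
exact: cu.
Qed.

Lemma ctn_inner {I : finType} (u v : R -> vec I) : (forall i, ctn (fun t => u t i)) ->
  (forall i, ctn (fun t => v t i)) -> ctn (fun t => inner (u t) (v t)).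
Proof.
move=> cu cv; apply: (ctn_vsum (u := fun t i => u t i * v t i)) => i.
exact: ctn_mult.
Qed.

Lemma ctn_vnorm {I : finType} (u : R -> vec I) : (forall i, ctn (fun t => u t i)) ->
  ctn (fun t => vnorm (u t)).
Proof.
move=> cu; apply: ctn_comp; first exact: ctn_inner.
by move=> t; apply: continuity_pt_sqrt; exact: inner_ge0.
Qed.

End Ctn.

Lemma derivable_clamp u t l : 0 < t -> derivable_pt_lim u t l ->
  derivable_pt_lim (fun s => u (Rmax 0 s)) t l.
Proof.
move=> t0; apply: (@derivable_pt_lim_ext_loc _ _ _ _ (mkposreal t t0)) => s /= st.
rewrite Rmax_right //; move: st; rewrite /Rabs; case: Rcase_abs => ?; lra.
Qed.

Lemma mvt_ctn u a b : ctn u -> 0 <= a < b ->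
  (forall t, a < t < b -> exists l, derivable_pt_lim u t l) ->
  exists c l, a < c < b /\ derivable_pt_lim u c l /\ u b - u a = l * (b - a).
Proof.
move=> cu [a0 ab] du.
have pu c : a < c < b -> derivable_pt (fun s => u (Rmax 0 s)) c.
  move=> ac; have [l dl] := constructive_indefinite_description _ (du c ac).
  by exists l; apply: derivable_clamp => //; lra.
have pid c : a < c < b -> derivable_pt id c by move=> _; exact: derivable_pt_id.
have [c [ac]] := MVT _ id a b pu pid ab (fun c _ => cu c)
  (fun c _ => derivable_continuous_pt _ _ (derivable_pt_id c)).
have [l dl] := du c ac.
rewrite (derive_pt_eq_0 _ _ 1 (pid c ac)); last exact: derivable_pt_lim_id.
rewrite (derive_pt_eq_0 _ _ l (pu c ac)); last by apply: derivable_clamp => //; lra.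
rewrite !Rmax_right /id; [|lra..] => E.
by exists c, l; split=> //; split=> //; lra.
Qed.

(** Let m be the last time with u <= 0. Just after m, 0 < u < nu, so u exp (- K s) cannot increase
    there and u cannot become positive. Asking for the inequality only at small positive values is
    what allows bootstrapping and norms that are not differentiable at 0. *)
Lemma barrier u a T nu K : ctn u -> 0 <= a -> u a <= 0 -> 0 < nu ->
  (forall t, a < t < T -> 0 < u t < nu -> exists l, derivable_pt_lim u t l /\ l <= K * u t) ->
  forall t, a <= t <= T -> u t <= 0.
Proof.
move=> cu a0 ua nu0 du b abT; case: (Rle_lt_dec (u b) 0) => // ub; exfalso.
pose P s := a <= s <= b /\ u s <= 0.
have [m [mub mlub]] : {m | is_lub P m}.
  apply: completeness; first by exists b => s [[_ ?] _].
  by exists a; split=> //; lra.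
have am : a <= m by apply: mub; split=> //; lra.
have mb : m <= b by apply: mlub => s [[_ ?] _].
have um : u m <= 0.
  case: (Rle_lt_dec (u m) 0) => // um0; exfalso.
  have [d [d0 Hd]] := proj1 (ctnP u) cu m ltac:(lra) (u m) um0.
  suff : m <= m - d by lra.
  apply: mlub => s [[sa sb] us]; case: (Rle_lt_dec s (m - d)) => // sd; exfalso.
  have sm : s <= m by apply: mub; split.
  have : Rabs (u s - u m) < u m by apply: Hd; [lra | rewrite Rabs_left1; lra].
  by move=> /Rabs_def2; lra.
have upos s : m < s <= b -> 0 < u s.
  move=> [ms sb]; case: (Rle_lt_dec (u s) 0) => // us; exfalso.
  by have : s <= m; [apply: mub; split=> //; lra | lra].
have mb' : m < b.
  by case: (Req_dec m b) => [mb'|]; [rewrite mb' in um; lra | lra].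
have [d [d0 Hd]] := proj1 (ctnP u) cu m ltac:(lra) nu nu0.
set c := Rmin b (m + d / 2).
have [cb cd] : c <= b /\ c <= m + d / 2 by split; [exact: Rmin_l | exact: Rmin_r].
have mc : m < c by apply: Rmin_glb_lt; lra.
have unu s : m < s <= c -> 0 < u s < nu.
  move=> ms; split; first by apply: upos; lra.
  have : Rabs (u s - u m) < nu by apply: Hd; [lra | rewrite Rabs_pos_eq; lra].
  by move=> /Rabs_def2; lra.
pose w s := u s * exp (- K * s).
have dexp s : derivable_pt_lim (fun s => exp (- K * s)) s (- K * exp (- K * s)).
  by apply/is_derive_Reals; auto_derive => //; ring.
have cw : ctn w.
  apply: ctn_mult => //; apply: ctn_exp; apply: ctn_mult; first exact: ctn_const.
  exact: ctn_id.
have dw s : m < s < c -> exists l, derivable_pt_lim w s l /\ l <= 0.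
  move=> ms; have [l [dl lK]] := du s ltac:(lra) (unu s ltac:(lra)).
  exists (l * exp (- K * s) + u s * (- K * exp (- K * s))); split.
    exact: derivable_pt_lim_mult.
  by have := exp_pos (- K * s); nra.
have [s [l [ms [dl E]]]] : exists s l, m < s < c /\ derivable_pt_lim w s l /\
    w c - w m = l * (c - m).
  apply: mvt_ctn => //; first by lra.
  by move=> s /dw[l [? _]]; exists l.
have [l' [dl' l'0]] := dw s ms.
have ll := uniqueness_limite _ _ _ _ dl dl'; rewrite ll in E.
have : 0 < w c by apply: Rmult_lt_0_compat; [apply: upos; lra | exact: exp_pos].
have : w m <= 0 by rewrite /w; have := exp_pos (- K * m); nra.
nra.
Qed.

Section SmoothNorm.
Context {J : finType}.
Implicit Types (v : R -> vec J).

(** A substitute for the norm that is differentiable at 0 as well; tau is made arbitrarily small at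
    the end. *)
Definition snorm (tau : R) (u : vec J) := sqrt (inner u u + tau ^ 2).

Lemma snorm_bounds tau u : 0 < tau ->
  vnorm u <= snorm tau u /\ tau <= snorm tau u /\ snorm tau u <= vnorm u + tau.
Proof.
move=> t0; have u0 := inner_ge0 u; split; [|split].
- by apply: sqrt_le_1_alt; nra.
- by rewrite -{1}(sqrt_pow2 tau); [apply: sqrt_le_1_alt; lra | lra].
rewrite -(sqrt_pow2 (vnorm u + tau)); last by have := vnorm_ge0 u; lra.
apply: sqrt_le_1_alt; rewrite -vnorm2; have := vnorm_ge0 u; nra.
Qed.

Lemma derivable_sqrt_inner v (v' : vec J) t c :
  (forall j, derivable_pt_lim (fun s => v s j) t (v' j)) -> 0 < inner (v t) (v t) + c ->
  derivable_pt_lim (fun s => sqrt (inner (v s) (v s) + c)) t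
    (inner (v t) v' / sqrt (inner (v t) (v t) + c)).
Proof.
move=> dv pos.
have d1 : derivable_pt_lim (fun s => inner (v s) (v s) + c) t (2 * inner (v t) v').
  have -> : 2 * inner (v t) v' = (inner v' (v t) + inner (v t) v') + 0.
    by rewrite (innerC v'); ring.
  apply: (derivable_pt_lim_plus _ (fun=> c)); last exact: derivable_pt_lim_const.
  exact: (derivable_pt_lim_inner dv dv).
have := derivable_pt_lim_comp _ _ _ _ _ d1 (derivable_pt_lim_sqrt _ pos).
set q := sqrt _; have q0 : 0 < q by exact: sqrt_lt_R0.
by have -> : / (2 * q) * (2 * inner (v t) v') = inner (v t) v' / q by field; lra.
Qed.

Lemma derivable_snorm v (v' : vec J) t tau :
  (forall j, derivable_pt_lim (fun s => v s j) t (v' j)) -> 0 < tau ->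
  derivable_pt_lim (fun s => snorm tau (v s)) t (inner (v t) v' / snorm tau (v t)).
Proof.
by move=> dv t0; apply: derivable_sqrt_inner => //; have := inner_ge0 (v t); nra.
Qed.

Lemma derivable_vnorm v (v' : vec J) t :
  (forall j, derivable_pt_lim (fun s => v s j) t (v' j)) -> 0 < vnorm (v t) ->
  derivable_pt_lim (fun s => vnorm (v s)) t (inner (v t) v' / vnorm (v t)).
Proof.
move=> dv v0; have i0 : 0 < inner (v t) (v t) by rewrite -vnorm2; nra.
have := derivable_sqrt_inner (c := 0) dv; rewrite !Rplus_0_r => /(_ i0).
by apply: derivable_pt_lim_ext => s; rewrite Rplus_0_r.
Qed.

Lemma ctn_snorm v tau : (forall j, ctn (fun t => v t j)) -> ctn (fun t => snorm tau (v t)).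
Proof.
move=> cv; apply: (ctn_comp (f := sqrt) (u := fun t => inner (v t) (v t) + tau ^ 2)).
  by apply: ctn_plus; [exact: ctn_inner | exact: ctn_const].
by move=> t; apply: continuity_pt_sqrt; have := inner_ge0 (v (Rmax 0 t)); nra.
Qed.

(* The differential inequality is only required as long as the claimed bound is
   not exceeded by a factor two, which allows bootstrapping. *)
Lemma gronwall v (v' : R -> vec J) (a psi kappa E : R -> R) B T K :
  (forall j, ctn (fun t => v t j)) -> ctn E -> 0 < B ->
  (forall t, 0 <= t <= T -> 1 <= E t) -> vnorm (v 0) <= B * E 0 ->
  (forall t, 0 < t < T -> vnorm (v t) <= 2 * B * E t ->
    (forall j, derivable_pt_lim (fun s => v s j) t (v' t j)) /\
    derivable_pt_lim E t (kappa t * E t) /\ 0 <= a t <= K /\ a t <= kappa t /\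
    0 <= psi t <= (kappa t - a t) * B * E t /\
    inner (v t) (v' t) <= a t * vnorm (v t) ^ 2 + psi t * vnorm (v t)) ->
  forall t, 0 <= t <= T -> vnorm (v t) <= B * E t.
Proof.
move=> cv cE B0 E1 v0 H t1 t1T; have T0 : 0 <= T by lra.
have key tau : 0 < tau <= B / 2 -> vnorm (v t1) <= (B + tau) * E t1.
  move=> tauB; have [le _] := snorm_bounds (v t1) (proj1 tauB).
  suff : snorm tau (v t1) - (B + tau) * E t1 <= 0 by lra.
  (* Since tau <= B / 2 and E >= 1, an excess below nu = B / 2 keeps |v| below 2 B E, the range in
     which the hypothesis applies. *)
  move: t1 t1T {le}; apply: (barrier (u := fun t => snorm tau (v t) - (B + tau) * E t)
    (nu := B / 2) (K := K)) => //; try lra.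
  - apply: ctn_minus; first exact: ctn_snorm.
    by apply: ctn_mult => //; exact: ctn_const.
  - have [_ [_ h]] := snorm_bounds (v 0) (proj1 tauB).
    by have := E1 0 ltac:(lra); nra.
  move=> t t0T [u0 uB]; have [le [ge_tau _]] := snorm_bounds (v t) (proj1 tauB).
  have Et := E1 t ltac:(lra).
  have v2 : vnorm (v t) <= 2 * B * E t by nra.
  have [dv [dE [aK [ak [psi0 dif]]]]] := H t t0T v2.
  exists (inner (v t) (v' t) / snorm tau (v t) - (B + tau) * (kappa t * E t)); split.
    apply: derivable_pt_lim_minus; first by apply: derivable_snorm => //; lra.
    exact: derivable_pt_lim_scal.
  set om := snorm tau (v t) in u0 uB le ge_tau *.
  have om0 : 0 < om by lra.
  have n0 := vnorm_ge0 (v t).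
  have : inner (v t) (v' t) / om <= a t * om + psi t.
    apply/Rle_div_l => //; apply: Rle_trans dif _.
    have : vnorm (v t) ^ 2 <= om * om by nra.
    by move=> ?; nra.
  move=> ?; suff : a t * om + psi t - (B + tau) * (kappa t * E t) <=
    a t * (om - (B + tau) * E t) by nra.
  by nra.
case: (Rle_lt_dec (vnorm (v t1)) (B * E t1)) => // gt; exfalso.
have Et := E1 t1 t1T.
set g := vnorm (v t1) - B * E t1.
have g0 : 0 < g by rewrite /g; lra.
have tau0 : 0 < Rmin (B / 2) (g / (2 * E t1)).
  by apply: Rmin_pos; [lra | apply: Rdiv_lt_0_compat; lra].
have := key _ (conj tau0 (Rmin_l _ _)).
have : Rmin (B / 2) (g / (2 * E t1)) * E t1 <= g / 2.
  have -> : g / 2 = g / (2 * E t1) * E t1 by field; lra.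
  by apply: Rmult_le_compat_r; [lra | exact: Rmin_r].
by rewrite /g; lra.
Qed.

End SmoothNorm.

(** * The dichotomy of the linearized flow *)

Section Jacobian.
Context {I J : finType} (F : vec I -> vec J).

Lemma jacZ x c v j : jac F x (fun i => c * v i) j = c * jac F x v j.
Proof. by rewrite /jac -vsumZ; apply: eq_vsum => i; ring. Qed.

Lemma jacD x u v j : jac F x (fun i => u i + v i) j = jac F x u j + jac F x v j.
Proof. by rewrite /jac -vsumD; apply: eq_vsum => i; ring. Qed.

Lemma jacB x u v j : jac F x (fun i => u i - v i) j = jac F x u j - jac F x v j.
Proof. by rewrite /jac -vsumB; apply: eq_vsum => i; ring. Qed.

Lemma eq_jac x u v j : (forall i, u i = v i) -> jac F x u j = jac F x v j.
Proof. by move=> uv; apply: eq_vsum => i; rewrite uv. Qed.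

End Jacobian.

(** The part of the hypotheses that the estimates use. [b] and [c] stand for the norms of D_z f and
    D_a g; one constant [Lip] bounds the Jacobian, its variation and the Taylor remainder. The
    fields [dm_A] and [dm_B] are the growth inequalities for a general tangent vector with its
    off-diagonal coupling included. *)
Record dominated {A B : finType} (r : nat) (U : vec (A + B)%type -> Prop)
    (F : vec (A + B)%type -> vec (A + B)%type) (al ell b c : vec (A + B)%type -> R)
    (c1 cr Lip : R) : Prop := Dominated {
  dm_open : open_vset U;
  dm_conv : convex_vset U;
  dm_c1 : 0 < c1;
  dm_cr : 0 < cr;
  dm_Lip : 0 < Lip;
  dm_A : forall x v, U x ->
    al x * vnorm (PiA v) ^ 2 - b x * vnorm (PiA v) * vnorm (PiB v) <=
    inner (PiA v) (PiA (jac F x v));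
  dm_B : forall x v, U x -> inner (PiB v) (PiB (jac F x v)) <=
    ell x * vnorm (PiB v) ^ 2 + c x * vnorm (PiA v) * vnorm (PiB v);
  dm_ell : forall x, U x -> 0 <= ell x;
  dm_b : forall x, U x -> 0 <= b x <= Lip;
  dm_c : forall x, U x -> 0 <= c x;
  dm_gap1 : forall x, U x -> ell x + b x + c x + c1 <= al x;
  dm_gapr : forall x, U x -> INR r * ell x + (INR r + 1) * c x + cr <= al x;
  dm_jac : forall x v, U x -> vnorm (jac F x v) <= Lip * vnorm v;
  dm_jacLip : forall x y v, U x -> U y ->
    vnorm (fun j => jac F y v j - jac F x v j) <= Lip * vnorm (vsub y x) * vnorm v;
  dm_taylor : forall x y, U x -> U y ->
    vnorm (fun j => F y j - F x j - jac F x (vsub y x) j) <= Lip * vnorm (vsub y x) ^ 2 }.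

Section Dichotomy.
Context {A B : finType} {r : nat} {U : vec (A + B)%type -> Prop}.
Context {F : vec (A + B)%type -> vec (A + B)%type}.
Context {al ell b c : vec (A + B)%type -> R} {c1 cr Lip : R}.
Hypothesis dom : dominated r U F al ell b c c1 cr Lip.
Let c10 := dm_c1 dom.
Let cr0 := dm_cr dom.
Let Lip0 := dm_Lip dom.
Let z0 : vec (A + B)%type := fun=> 0.
Let z0A : vnorm (PiA z0) = 0. Proof. exact: (vnorm0 (I := A)). Qed.
Let z0B : vnorm (PiB z0) = 0. Proof. exact: (vnorm0 (I := B)). Qed.

(* Growth rate of the [z]-component of tangent vectors in the cone |a| <= |z|.
   It replaces [ell + |D_a g|], which need not be Lipschitz. *)
Definition mu (x : vec (A + B)%type) : R := epsilon (inhabits 0)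
  (is_lub (fun t => exists v, vnorm (PiA v) <= 1 /\ vnorm (PiB v) <= 1 /\
    t = inner (PiB v) (PiB (jac F x v)))).

Lemma mu_lub x : U x ->
  is_lub (fun t => exists v, vnorm (PiA v) <= 1 /\ vnorm (PiB v) <= 1 /\
    t = inner (PiB v) (PiB (jac F x v))) (mu x).
Proof.
move=> Ux; apply: epsilon_spec.
have [] := completeness (fun t => exists v, vnorm (PiA v) <= 1 /\ vnorm (PiB v) <= 1 /\
    t = inner (PiB v) (PiB (jac F x v))).
- exists (2 * Lip) => t [v [p1 [w1 ->]]]; apply: Rle_trans (inner_le _ _) _.
  have := dm_jac dom v Ux; have := vnorm_PiB (jac F x v); have := vnorm_le_AB v.
  have := vnorm_ge0 (PiB v); have := vnorm_ge0 (PiB (jac F x v)); nra.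
- by exists (inner (PiB z0) (PiB (jac F x z0))), z0; rewrite z0A z0B; split; [lra | split => //; lra].
by move=> l; exists l.
Qed.

Lemma mu_ge0 x : U x -> 0 <= mu x.
Proof.
move=> Ux; have [ub _] := mu_lub Ux; apply: ub; exists z0; rewrite z0A z0B.
split; [lra | split; first by lra].
rewrite /inner (eq_vsum (v := fun=> 0)) ?vsum0 // => i.
by rewrite /PiB /z0 Rmult_0_l.
Qed.

(** With [dm_gapr] this gives r mu + cr <= al - c, the form in which the spectral gap is used. *)
Lemma mu_le x : U x -> mu x <= ell x + c x.
Proof.
move=> Ux; have [_] := mu_lub Ux; apply => t [v [p1 [w1 ->]]].
apply: Rle_trans (dm_B dom v Ux) _.
have e0 := dm_ell dom Ux; have c0 := dm_c dom Ux.
have ? := vnorm_ge0 (PiA v); have ? := vnorm_ge0 (PiB v).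
have : vnorm (PiB v) ^ 2 <= 1 by nra.
have : vnorm (PiA v) * vnorm (PiB v) <= 1 by nra.
by nra.
Qed.

Lemma mu_le_Lip x : U x -> mu x <= 2 * Lip.
Proof.
move=> Ux; have [_] := mu_lub Ux; apply => t [v [p1 [w1 ->]]].
apply: Rle_trans (inner_le _ _) _.
have := dm_jac dom v Ux; have := vnorm_PiB (jac F x v); have := vnorm_le_AB v.
have := vnorm_ge0 (PiB v); have := vnorm_ge0 (PiB (jac F x v)); nra.
Qed.

(** A supremum of functions of x with a common Lipschitz constant; the 2 bounds |v| when both
    components have norm at most 1. *)
Lemma mu_lip x y : U x -> U y -> mu y <= mu x + 2 * Lip * vnorm (vsub y x).
Proof.
move=> Ux Uy; have [_] := mu_lub Uy; apply => t [v [p1 [w1 ->]]].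
have [ub _] := mu_lub Ux.
have := ub _ (ex_intro _ v (conj p1 (conj w1 erefl))) => h.
have : inner (PiB v) (PiB (jac F y v)) - inner (PiB v) (PiB (jac F x v)) <=
    2 * Lip * vnorm (vsub y x).
  rewrite -innerBr; apply: Rle_trans (inner_le _ _) _.
  have h1 : vnorm (fun i => PiB (jac F y v) i - PiB (jac F x v) i) <=
    vnorm (fun j => jac F y v j - jac F x v j) := vnorm_PiB _.
  have h2 := dm_jacLip dom v Ux Uy; have h3 := vnorm_le_AB v.
  have n0 := vnorm_ge0 (vsub y x); have w0 := vnorm_ge0 (PiB v).
  have d0 := vnorm_ge0 (fun i => PiB (jac F y v) i - PiB (jac F x v) i).
  have : Lip * vnorm (vsub y x) * vnorm v <= Lip * vnorm (vsub y x) * 2.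
    by apply: Rmult_le_compat_l; nra.
  by nra.
by lra.
Qed.

(** Both sides are homogeneous of degree 2, so |z| may be scaled to 1. *)
Lemma mu_cone x v : U x -> vnorm (PiA v) <= vnorm (PiB v) ->
  inner (PiB v) (PiB (jac F x v)) <= mu x * vnorm (PiB v) ^ 2.
Proof.
move=> Ux pw; have [ub _] := mu_lub Ux; set n := vnorm (PiB v) in pw *.
case: (Rle_lt_or_eq_dec 0 n (vnorm_ge0 _)) => [n0|n0]; last first.
  have := inner_le (PiB v) (PiB (jac F x v)); rewrite -/n -n0; lra.
have i0 := Rinv_0_lt_compat _ n0.
have : / n * / n * inner (PiB v) (PiB (jac F x v)) <= mu x.
  apply: ub; exists (fun i => / n * v i); split; [|split].
  - have -> : vnorm (PiA (fun i => / n * v i)) = / n * vnorm (PiA v).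
      by rewrite -[in RHS](Rabs_pos_eq (/ n)) -?vnormZ //; lra.
    by apply: (Rmult_le_reg_l n) => //; rewrite -Rmult_assoc Rinv_r; lra.
  - have -> : vnorm (PiB (fun i => / n * v i)) = / n * n.
      by rewrite -[in RHS](Rabs_pos_eq (/ n)) -?vnormZ //; lra.
    by rewrite Rinv_l; lra.
  rewrite Rmult_assoc -innerZr -innerZl; apply: eq_vsum => i.
  by rewrite /PiB jacZ.
move=> /(Rmult_le_compat_l (n * n) _ _ ltac:(nra)).
have -> : n * n * (/ n * / n * inner (PiB v) (PiB (jac F x v))) =
  inner (PiB v) (PiB (jac F x v)) by field; lra.
by lra.
Qed.

(** Split v into [v1] on the boundary of the cone and a purely a-directed [v2] of norm at most G;
    [mu_cone] treats the first, the bound of the Jacobian the second. *)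
Lemma mu_near_cone x v G : U x -> 0 <= G -> vnorm (PiA v) <= vnorm (PiB v) + G ->
  inner (PiB v) (PiB (jac F x v)) <= mu x * vnorm (PiB v) ^ 2 + Lip * G * vnorm (PiB v).
Proof.
move=> Ux G0 pw; have w0 := vnorm_ge0 (PiB v).
case: (Rle_lt_dec (vnorm (PiA v)) (vnorm (PiB v))) => h.
  have := mu_cone Ux h; have : 0 <= Lip * G by nra.
  by nra.
have p0 : 0 < vnorm (PiA v) by lra.
set l := vnorm (PiB v) / vnorm (PiA v).
have l1 : 0 <= l <= 1.
  by split; [apply: Rdiv_le_0_compat | apply/Rle_div_l; lra].
pose v1 := pairv (fun i => l * PiA v i) (PiB v).
pose v2 := pairv (fun i => (1 - l) * PiA v i) (@vzero B).
have split_v i : v i = v1 i + v2 i.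
  by case: i => i; rewrite /v1 /v2 /= /PiA /PiB /vzero; ring.
have n1 : vnorm (PiA v1) = vnorm (PiB v).
  by rewrite vnormZ Rabs_pos_eq /l; [field; lra | case: l1].
have n2 : vnorm v2 <= G.
  apply: Rle_trans (vnorm_le_AB _) _.
  have -> : vnorm (PiB v2) = 0 by exact: vnorm0.
  rewrite vnormZ Rabs_pos_eq; last by lra.
  have -> : (1 - l) * vnorm (PiA v) = vnorm (PiA v) - vnorm (PiB v) by rewrite /l; field; lra.
  lra.
have -> : inner (PiB v) (PiB (jac F x v)) =
    inner (PiB v1) (PiB (jac F x v1)) + inner (PiB v) (PiB (jac F x v2)).
  by rewrite -innerDr; apply: eq_vsum => i; rewrite /PiB -jacD (eq_jac _ _ _ split_v).
have := mu_cone Ux (v := v1); rewrite n1 => /(_ (Rle_refl _)).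
have -> : vnorm (PiB v1) = vnorm (PiB v) by [].
have := inner_le (PiB v) (PiB (jac F x v2)).
have h2 : vnorm (PiB (jac F x v2)) <= Lip * G.
  have := vnorm_PiB (jac F x v2); have := dm_jac dom v2 Ux; nra.
by have := Rmult_le_compat_l _ _ _ w0 h2; lra.
Qed.

(* [(|p| - |w| - (2 C / c') E) / Lam] is nondecreasing wherever it is positive. *)
Lemma dichotomy (x eta Phi : R -> vec (A + B)%type) (E kappa Lam lam : R -> R) T C c' :
  0 < c' -> 0 <= C -> (forall j, ctn (fun t => eta t j)) -> ctn E -> ctn Lam ->
  (forall t, 0 <= t <= T -> 0 < E t) -> (forall t, 0 < Lam t) ->
  (forall t, 0 < t < T -> U (x t) /\
     (forall j, derivable_pt_lim (fun s => eta s j) t (jac F (x t) (eta t) j + Phi t j)) /\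
     vnorm (Phi t) <= C * E t /\
     derivable_pt_lim E t (kappa t * E t) /\ derivable_pt_lim Lam t (lam t * Lam t) /\
     kappa t + c' <= al (x t) - c (x t) /\ lam t <= al (x t) - c (x t)) ->
  forall t, 0 <= t <= T -> vnorm (PiA (eta t)) <= vnorm (PiB (eta t)) + 2 * C / c' * E t
    + Lam t * (vnorm (PiA (eta T)) / Lam T).
Proof.
move=> c'0 C0 ceta cE cLam E0 Lam0 H t tT.
set m := vnorm (PiA (eta T)) / Lam T.
have m0 : 0 <= m.
  by apply: Rdiv_le_0_compat; [exact: vnorm_ge0 | exact: Lam0].
set Q := 2 * C / c'.
have Q0 : 0 <= Q by apply: Rdiv_le_0_compat; lra.
apply: le_epsilon => tau tau0.
(* Only the z-norm is smoothed: the monotonicity is needed where N > 0, and there the a-norm is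
   nonzero. *)
pose N s := vnorm (PiA (eta s)) - snorm tau (PiB (eta s)) - Q * E s.
pose v s := N s / Lam s.
suff vm : v t <= m.
  have [_ [_ h]] := snorm_bounds (PiB (eta t)) tau0.
  have : N t <= Lam t * m.
    have -> : N t = Lam t * v t by rewrite /v; field; have := Lam0 t; lra.
    by apply: Rmult_le_compat_l vm; have := Lam0 t; lra.
  by rewrite /N; lra.
case: (Rle_lt_dec (v t) m) => // mv; exfalso.
have cN : ctn N.
  apply: ctn_minus; last by apply: ctn_mult => //; exact: ctn_const.
  apply: ctn_minus.
    by apply: (ctn_vnorm (u := fun s => PiA (eta s))) => j; exact: ceta.
  by apply: (ctn_snorm (v := fun s => PiB (eta s))) => j; exact: ceta.
have cv : ctn v.
  apply: ctn_mult => //; apply: (ctn_comp (f := Rinv)) => // s.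
  apply: derivable_continuous_pt; exists (- / Lam (Rmax 0 s) ^ 2).
  by apply/is_derive_Reals; auto_derive; have := Lam0 (Rmax 0 s); [lra | move=> ?; field; lra].
have vT : v T <= m.
  apply: Rmult_le_compat_r; first by left; exact/Rinv_0_lt_compat/Lam0.
  have [_ [h _]] := snorm_bounds (PiB (eta T)) tau0.
  by rewrite /N; have := E0 T ltac:(lra); nra.
suff : v t - v T <= 0 by lra.
(* The range 0 < v t - v s < v t keeps v s positive, hence N s > 0. *)
apply: (barrier (u := fun s => v t - v s) (a := t) (T := T) (nu := v t) (K := 0)); try lra.
  by apply: ctn_minus => //; exact: ctn_const.
move=> s sT [us1 us2].
have [Us [deta [PhiE [dE [dLam [gapE gapL]]]]]] := H s ltac:(lra).
have Ls := Lam0 s; have Es := E0 s ltac:(lra).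
have N0 : 0 < N s.
  have -> : N s = v s * Lam s by rewrite /v; field; lra.
  by apply: Rmult_lt_0_compat; lra.
have [le_om [tau_om _]] := snorm_bounds (PiB (eta s)) tau0.
set p := vnorm (PiA (eta s)); set w := vnorm (PiB (eta s)).
set om := snorm tau (PiB (eta s)) in le_om tau_om *; rewrite -/w in le_om.
have p0 : 0 < p by move: N0; rewrite /N -/p -/om; nra.
have w0 : 0 <= w := vnorm_ge0 _.
pose eta' : vec (A + B)%type := fun j => jac F (x s) (eta s) j + Phi s j.
have dp : derivable_pt_lim (fun s => vnorm (PiA (eta s))) s
    (inner (PiA (eta s)) (PiA eta') / p).
  by apply: (derivable_vnorm (v := fun s => PiA (eta s))) => // j; exact: deta.
have dw : derivable_pt_lim (fun s => snorm tau (PiB (eta s))) s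
    (inner (PiB (eta s)) (PiB eta') / om).
  by apply: (derivable_snorm (v := fun s => PiB (eta s))) => // j; exact: deta.
set N' := inner (PiA (eta s)) (PiA eta') / p - inner (PiB (eta s)) (PiB eta') / om
  - Q * (kappa s * E s).
have dN : derivable_pt_lim N s N'.
  apply: derivable_pt_lim_minus; last exact: derivable_pt_lim_scal.
  exact: derivable_pt_lim_minus.
have dv : derivable_pt_lim v s ((N' * Lam s - lam s * Lam s * N s) / Rsqr (Lam s)).
  by apply: derivable_pt_lim_div => //; lra.
exists (0 - (N' * Lam s - lam s * Lam s * N s) / Rsqr (Lam s)); split.
  apply: (derivable_pt_lim_minus (fun=> v t)) => //; exact: derivable_pt_lim_const.
have b0 := dm_b dom Us; have g1 := dm_gap1 dom Us.
have PA : vnorm (PiA (Phi s)) <= C * E s by have := vnorm_PiA (Phi s); lra.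
have PB : vnorm (PiB (Phi s)) <= C * E s by have := vnorm_PiB (Phi s); lra.
have i1 : al (x s) * p - b (x s) * w - C * E s <= inner (PiA (eta s)) (PiA eta') / p.
  apply/Rle_div_r => //.
  have -> : inner (PiA (eta s)) (PiA eta') = inner (PiA (eta s)) (PiA (jac F (x s) (eta s)))
      + inner (PiA (eta s)) (PiA (Phi s)) by rewrite -innerDr.
  have := dm_A dom (eta s) Us; have := inner_ge (PiA (eta s)) (PiA (Phi s)).
  rewrite -/p -/w; nra.
have i2 : inner (PiB (eta s)) (PiB eta') / om <= ell (x s) * om + c (x s) * p + C * E s.
  apply/Rle_div_l; first by lra.
  have -> : inner (PiB (eta s)) (PiB eta') = inner (PiB (eta s)) (PiB (jac F (x s) (eta s)))
      + inner (PiB (eta s)) (PiB (Phi s)) by rewrite -innerDr.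
  have := dm_B dom (eta s) Us; have := inner_le (PiB (eta s)) (PiB (Phi s)).
  rewrite -/p -/w => h1 h2.
  have e0 := dm_ell dom Us; have cc := dm_c dom Us.
  have CE : 0 <= C * E s by nra.
  have : c (x s) * p * w <= c (x s) * p * om by apply: Rmult_le_compat_l; nra.
  have : ell (x s) * w ^ 2 <= ell (x s) * (om * om) by apply: Rmult_le_compat_l; nra.
  have : w * vnorm (PiB (Phi s)) <= om * (C * E s).
    by apply: Rmult_le_compat => //; exact: vnorm_ge0.
  by lra.
(* The forcing costs C E once in each component; the correction Q E pays for both, because E grows
   more slowly than al - c by at least c'. *)
have QE : Q * c' = 2 * C by rewrite /Q; field; lra.
have bw : b (x s) * w <= b (x s) * om by apply: Rmult_le_compat_l; lra.
have N'N : (al (x s) - c (x s)) * N s <= N'.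
  have -> : N s = p - om - Q * E s by [].
  have h1 : Q * E s * (kappa s + c') <= Q * E s * (al (x s) - c (x s)).
    by apply: Rmult_le_compat_l => //; nra.
  have h2 : (ell (x s) + b (x s) + c (x s) + c1) * om <= al (x s) * om.
    by apply: Rmult_le_compat_r; lra.
  have h3 : Q * E s * c' = 2 * (C * E s) by rewrite -[LHS]/(Q * E s * c'); nra.
  by rewrite /N'; nra.
have : lam s * N s <= N' by nra.
move=> h; rewrite Rmult_0_l.
have : 0 <= (N' * Lam s - lam s * Lam s * N s) / Rsqr (Lam s).
  apply: Rdiv_le_0_compat; first by nra.
  by apply: Rlt_0_sqr; lra.
by lra.
Qed.

End Dichotomy.

Lemma derivable_weight (M : R -> R) q e t m : derivable_pt_lim M t m ->
  derivable_pt_lim (fun s => exp (q * M s + e * s)) t ((q * m + e) * exp (q * M t + e * t)).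
Proof.
move=> dM; have d1 : derivable_pt_lim (fun s => q * M s + e * s) t (q * m + e * 1).
  apply: derivable_pt_lim_plus; first exact: derivable_pt_lim_scal.
  by apply: (derivable_pt_lim_scal id); exact: derivable_pt_lim_id.
have := derivable_pt_lim_comp _ _ _ _ _ d1 (derivable_pt_lim_exp _).
by rewrite Rmult_1_r Rmult_comm.
Qed.

Lemma ctn_weight (M : R -> R) q e : ctn M -> ctn (fun s => exp (q * M s + e * s)).
Proof.
move=> cM; apply: ctn_exp; apply: ctn_plus; apply: ctn_mult => //; try exact: ctn_const.
exact: ctn_id.
Qed.

Lemma exp_le x y : x <= y -> exp x <= exp y.
Proof. by case=> [/exp_increasing|->]; lra. Qed.

Lemma exp_ge1 x : 0 <= x -> 1 <= exp x.
Proof. by move=> x0; rewrite -exp_0; exact: exp_le. Qed.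

(** * A priori estimates for slowly growing solutions *)

Section Growth.
Context {A B : finType} {r : nat} {U : vec (A + B)%type -> Prop}.
Context {F : vec (A + B)%type -> vec (A + B)%type}.
Context {al ell b c : vec (A + B)%type -> R} {c1 cr Lip : R}.
Hypothesis dom : dominated r U F al ell b c c1 cr Lip.
Let cr0 := dm_cr dom.
Let Lip0 := dm_Lip dom.
Local Notation mu := (mu (F := F)).

Definition rate (x : R -> vec (A + B)%type) (M : R -> R) :=
  [/\ ctn M, M 0 = 0, forall t, 0 <= t -> U (x t)
   & forall t, 0 < t -> derivable_pt_lim M t (mu (x t))].

Definition linsol (x eta Phi : R -> vec (A + B)%type) (T : R) :=
  (forall j, ctn (fun t => eta t j)) /\ forall t, 0 < t < T -> forall j,
    derivable_pt_lim (fun s => eta s j) t (jac F (x t) (eta t) j + Phi t j).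

Lemma rate_mono x M s t : rate x M -> 0 <= s <= t -> M s <= M t.
Proof.
move=> [cM _ Ux dM] [s0 st]; case: (Req_dec s t) => [->|ne]; first by lra.
have [u [l [us [dl E]]]] : exists u l, s < u < t /\ derivable_pt_lim M u l /\
    M t - M s = l * (t - s).
  apply: mvt_ctn => //; first lra.
  by move=> u us; exists (mu (x u)); apply: dM; lra.
have := uniqueness_limite _ _ _ _ dl (dM u ltac:(lra)) => El.
have := mu_ge0 dom (Ux u ltac:(lra)); nra.
Qed.

Lemma rate_ge0 x M t : rate x M -> 0 <= t -> 0 <= M t.
Proof. by move=> rM t0; case: (rM) => _ <- _ _; apply: rate_mono rM _; lra. Qed.

(** [dichotomy] carries the bound at T backwards and leaves |a| <= |z| + a C E; a forward Gronwall
    estimate from time 0 then controls the z-component. K is fixed before the orbit, T and C, so T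
    may later depend on the step of a difference quotient. *)
Lemma growth_bound e : 0 < e <= cr / 2 -> exists K, 0 < K /\
  forall (q : nat) x M eta Phi T C, (1 <= q <= r)%N -> rate x M -> 0 < C -> 0 <= T ->
  linsol x eta Phi T ->
  (forall t, 0 < t < T -> vnorm (Phi t) <= C * exp (INR q * M t + e * t)) ->
  vnorm (PiB (eta 0)) <= C ->
  vnorm (PiA (eta T)) <= C * exp (INR q * M T + e * T) ->
  forall t, 0 <= t <= T -> vnorm (eta t) <= K * C * exp (INR q * M t + e * t).
Proof.
move=> [e0 ecr].
(* 4 / cr is the factor 2 / c' of [dichotomy] at c' = cr / 2; the 1 carries the data at time T. *)
set a := 4 / cr + 1.
have a0 : 0 < a by have : 0 < 4 / cr by [apply: Rdiv_lt_0_compat; lra]; rewrite /a; lra.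
(* Then e k exceeds Lip a + 1, the effective forcing of the z-component: Lip a from the distance to
   the cone and 1 from [Phi]. *)
set k := (Lip * a + 1) / e + 1.
have k0 : 1 < k.
  have : 0 < (Lip * a + 1) / e by apply: Rdiv_lt_0_compat; nra.
  by rewrite /k; lra.
exists (2 * k + a); split; first lra.
move=> q x M eta Phi T C /andP[q1 qr] rM C0 T0 [ceta deta] PhiC w0 pT.
case: (rM) => cM M0 Ux dM.
have q1' : 1 <= INR q by have /leP/le_INR := q1.
have qr' : INR q <= INR r by have /leP/le_INR := qr.
pose E s := exp (INR q * M s + e * s).
have cE : ctn E by exact: ctn_weight.
have dE s : 0 < s -> derivable_pt_lim E s ((INR q * mu (x s) + e) * E s).
  by move=> s0; apply: derivable_weight; exact: dM.
have E1 s : 0 <= s -> 1 <= E s.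
  by move=> s0; apply: exp_ge1; have := rate_ge0 rM s0; nra.
have E00 : E 0 = 1 by rewrite /E M0 -[RHS]exp_0; congr exp; ring.
have pbound s : 0 <= s <= T -> vnorm (PiA (eta s)) <= vnorm (PiB (eta s)) + a * C * E s.
  move=> sT.
  pose Lam s := exp (INR r * M s + cr * s).
  have := @dichotomy _ _ _ _ _ _ _ _ _ _ _ _ dom x eta Phi E
    (fun s => INR q * mu (x s) + e) Lam (fun s => INR r * mu (x s) + cr) T C (cr / 2).
  move=> /(_ ltac:(lra) ltac:(lra) ceta cE (ctn_weight _ _ cM)).
  move=> /(_ ltac:(by move=> u uT; have := E1 u ltac:(lra); lra) ltac:(by move=> u; exact: exp_pos)).
  have H0 t : 0 < t < T -> U (x t) /\
      (forall j, derivable_pt_lim (fun s => eta s j) t (jac F (x t) (eta t) j + Phi t j)) /\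
      vnorm (Phi t) <= C * E t /\ derivable_pt_lim E t ((INR q * mu (x t) + e) * E t) /\
      derivable_pt_lim Lam t ((INR r * mu (x t) + cr) * Lam t) /\
      INR q * mu (x t) + e + cr / 2 <= al (x t) - c (x t) /\
      INR r * mu (x t) + cr <= al (x t) - c (x t).
    move=> tT; have Ut := Ux t ltac:(lra).
    have gr := dm_gapr dom Ut; have m0 := mu_ge0 dom Ut; have m1 := mu_le dom Ut.
    have rm : INR r * mu (x t) <= INR r * (ell (x t) + c (x t)).
      by apply: Rmult_le_compat_l; lra.
    have qm : INR q * mu (x t) <= INR r * mu (x t) by exact: Rmult_le_compat_r.
    do !split => //; try lra.
    - exact: deta.
    - exact: PhiC.
    - by apply: dE; lra.
    - by apply: derivable_weight; apply: dM; lra.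
  move=> /(_ H0 s sT) h; apply: Rle_trans h _.
  have -> : 2 * C / (cr / 2) = 4 / cr * C by field; lra.
  (* The quotient Lam / E is nondecreasing, as q <= r, e <= cr and M is nondecreasing; so the data
     at T weigh no more than C E at time s. *)
  have LT : Lam s * (vnorm (PiA (eta T)) / Lam T) <= C * E s.
    have ET : Lam s * (C * E T / Lam T) <= C * E s.
      have -> : Lam s * (C * E T / Lam T) = C * (Lam s * (E T * / Lam T)).
        by field; have := exp_pos (INR r * M T + cr * T); rewrite -/(Lam T); lra.
      apply: Rmult_le_compat_l; first lra.
      rewrite /Lam /E -exp_Ropp -!exp_plus; apply: exp_le.
      have MsT := rate_mono rM sT.
      have : (INR r - INR q) * M s <= (INR r - INR q) * M T.
        by apply: Rmult_le_compat_l; lra.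
      have : (cr - e) * s <= (cr - e) * T by apply: Rmult_le_compat_l; lra.
      by lra.
    apply: Rle_trans ET; apply: Rmult_le_compat_l; first by left; exact: exp_pos.
    apply: Rmult_le_compat_r; first by left; apply: Rinv_0_lt_compat; exact: exp_pos.
    exact: pT.
  by rewrite /a; nra.
have wbound s : 0 <= s <= T -> vnorm (PiB (eta s)) <= k * C * E s.
  apply: (gronwall (v := fun s => PiB (eta s))
    (v' := fun s j => jac F (x s) (eta s) (inr j) + Phi s (inr j))
    (a := fun s => mu (x s)) (psi := fun s => (Lip * a + 1) * C * E s)
    (kappa := fun s => INR q * mu (x s) + e) (K := 2 * Lip)) => //.
  - by move=> j; exact: ceta.
  - by nra.
  - by move=> u uT; apply: E1; lra.
  - by rewrite E00; nra.
  move=> u uT _; have Uu := Ux u ltac:(lra).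
  have m0 := mu_ge0 dom Uu; have m1 := mu_le_Lip dom Uu.
  have Eu := E1 u ltac:(lra).
  have mq : mu (x u) <= INR q * mu (x u) by nra.
  have CE : 0 < C * E u by nra.
  split; [by move=> j; exact: deta | split; first by apply: dE; lra].
  split; [by lra | split; [by lra | split]].
    split; first by rewrite Rmult_assoc; apply: Rmult_le_pos; nra.
    have -> : (INR q * mu (x u) + e - mu (x u)) * (k * C) * E u =
      ((INR q * mu (x u) - mu (x u)) + e) * k * (C * E u) by ring.
    rewrite Rmult_assoc; apply: Rmult_le_compat_r; first lra.
    have : e * k = Lip * a + 1 + e by rewrite /k; field; lra.
    have : 0 <= (INR q * mu (x u) - mu (x u)) * k by nra.
    by lra.
  have G0 : 0 <= a * C * E u by rewrite Rmult_assoc; apply: Rmult_le_pos; lra.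
  have h1 := mu_near_cone dom Uu G0 (pbound u ltac:(lra)).
  have -> : inner (PiB (eta u)) (fun j => jac F (x u) (eta u) (inr j) + Phi u (inr j)) =
    inner (PiB (eta u)) (PiB (jac F (x u) (eta u))) + inner (PiB (eta u)) (PiB (Phi u)).
    by rewrite -innerDr.
  have h2 := inner_le (PiB (eta u)) (PiB (Phi u)).
  have h3 : vnorm (PiB (Phi u)) <= C * E u by have := vnorm_PiB (Phi u); have := PhiC u uT; rewrite -/(E u); lra.
  have := Rmult_le_compat_l _ _ _ (vnorm_ge0 (PiB (eta u))) h3.
  by nra.
move=> s sT; have := vnorm_le_AB (eta s); have := pbound s sT; have := wbound s sT.
by rewrite -/(E s); nra.
Qed.

(** [Lam] outgrows the bound at T by exp (cr / 2 T). Hence [dichotomy], with the constant weight E =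
    1, leaves at time 0 an a-component of the size of the forcing plus an exponentially small term;
    a crude Gronwall bound with the rate [Lip] + 1 carries this to T0. *)
Lemma closeness x M eta Phi T T0 C sigma : rate x M -> 0 < C -> 0 < sigma -> 0 <= T0 <= T ->
  linsol x eta Phi T -> (forall t, 0 < t < T -> vnorm (Phi t) <= sigma) ->
  vnorm (PiB (eta 0)) <= sigma ->
  vnorm (PiA (eta T)) <= C * exp (INR r * M T + cr / 2 * T) ->
  forall t, 0 <= t <= T0 -> vnorm (eta t) <=
    (sigma * (2 + 2 / cr) + C * exp (- (cr / 2) * T)) * exp ((Lip + 1) * T0).
Proof.
move=> rM C0 s0 [T00 T0T] [ceta deta] Phis w0 pT t tT.
case: (rM) => cM M0 Ux dM.
have p0 : vnorm (PiA (eta 0)) <= sigma + 2 * sigma / cr + C * exp (- (cr / 2) * T).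
  pose Lam s := exp (INR r * M s + cr * s).
  have := @dichotomy _ _ _ _ _ _ _ _ _ _ _ _ dom x eta Phi (fun=> 1)
    (fun s => 0) Lam (fun s => INR r * mu (x s) + cr) T sigma cr.
  move=> /(_ cr0 ltac:(lra) ceta (ctn_const _) (ctn_weight _ _ cM)).
  move=> /(_ ltac:(by move=> *; lra) ltac:(by move=> u; exact: exp_pos)).
  have H0 u : 0 < u < T -> U (x u) /\
      (forall j, derivable_pt_lim (fun s => eta s j) u (jac F (x u) (eta u) j + Phi u j)) /\
      vnorm (Phi u) <= sigma * 1 /\ derivable_pt_lim (fun=> 1) u (0 * 1) /\
      derivable_pt_lim Lam u ((INR r * mu (x u) + cr) * Lam u) /\
      0 + cr <= al (x u) - c (x u) /\
      INR r * mu (x u) + cr <= al (x u) - c (x u).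
    move=> uT; have Ut := Ux u ltac:(lra).
    have gr := dm_gapr dom Ut; have m0 := mu_ge0 dom Ut; have m1 := mu_le dom Ut.
    have r0 := pos_INR r.
    have rm : INR r * mu (x u) <= INR r * (ell (x u) + c (x u)).
      by apply: Rmult_le_compat_l; lra.
    have : 0 <= INR r * mu (x u) by nra.
    move=> ?; do !split => //; try lra.
    - exact: deta.
    - by rewrite Rmult_1_r; exact: Phis.
    - by rewrite Rmult_0_l; exact: derivable_pt_lim_const.
    - by apply: derivable_weight; apply: dM; lra.
  move=> /(_ H0 0 ltac:(lra)); rewrite Rmult_1_r => h.
  have L0 : Lam 0 = 1 by rewrite /Lam M0 -[RHS]exp_0; congr exp; ring.
  have : vnorm (PiA (eta T)) / Lam T <= C * exp (- (cr / 2) * T).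
    apply/Rle_div_l; first exact: exp_pos.
    apply: Rle_trans pT _; rewrite Rmult_assoc -exp_plus; right; congr (_ * exp _).
    by field.
  by rewrite L0 in h; lra.
set D := sigma * (2 + 2 / cr) + C * exp (- (cr / 2) * T).
have D0 : sigma <= D.
  have : 0 < C * exp (- (cr / 2) * T) by apply: Rmult_lt_0_compat => //; exact: exp_pos.
  have : 0 < 2 / cr by apply: Rdiv_lt_0_compat; lra.
  by rewrite /D; nra.
have : vnorm (eta t) <= D * exp ((Lip + 1) * t).
  apply: (gronwall (v := eta) (v' := fun s j => jac F (x s) (eta s) j + Phi s j)
    (a := fun s => Lip) (psi := fun s => sigma) (kappa := fun s => Lip + 1) (T := T0)
    (K := Lip) (E := fun s => exp ((Lip + 1) * s))) => //.
  - by apply: ctn_exp; apply: ctn_mult; [exact: ctn_const | exact: ctn_id].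
  - by lra.
  - by move=> s sT; apply: exp_ge1; nra.
  - rewrite Rmult_0_r exp_0 Rmult_1_r; apply: Rle_trans (vnorm_le_AB _) _.
    have : sigma * (2 + 2 / cr) = 2 * sigma + 2 * sigma / cr by field; lra.
    by rewrite /D; lra.
  move=> s sT _; have E1 : 1 <= exp ((Lip + 1) * s) by apply: exp_ge1; nra.
  have Us := Ux s ltac:(lra).
  split; [by move=> j; apply: deta; lra | split].
    by apply/is_derive_Reals; auto_derive => //; ring.
  split; [by lra | split; [by lra | split]].
    by split; [lra | rewrite (_ : Lip + 1 - Lip = 1); [nra | ring]].
  rewrite innerDr; have := inner_le (eta s) (jac F (x s) (eta s)).
  have := inner_le (eta s) (Phi s); have := vnorm_ge0 (eta s).
  by have := dm_jac dom (eta s) Us; have := Phis s ltac:(lra); nra.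
have : exp ((Lip + 1) * t) <= exp ((Lip + 1) * T0) by apply: exp_le; nra.
by move=> h1 h2; nra.
Qed.

End Growth.

(** * Functions on orbits with controlled derivatives *)

Section SmoothClass.
Context {B : finType} (K : vec B -> Prop) (M : R -> vec B -> R).
Hypothesis openK : open_vset K.
Hypothesis M_mono : forall z s t, K z -> 0 <= s <= t -> M s z <= M t z.
Implicit Types p : R -> vec B -> R.

(* [q] is the order of differentiation in [z] already carried out; an arbitrarily
   small exponential loss is tolerated. *)
Definition grow (q : nat) p := forall e, 0 < e -> exists C, 0 < C /\
  forall z t, K z -> 0 <= t -> Rabs (p t z) <= C * exp (INR q * M t z + e * t).

Definition luc p := forall z, K z -> forall T e, 0 < e -> exists d, 0 < d /\
  forall z' t, K z' -> vnorm (vsub z' z) < d -> 0 <= t <= T -> Rabs (p t z' - p t z) < e.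

Definition tame q p := [/\ grow q p, luc p & forall z, K z -> ctn (fun t => p t z)].

Definition dz i p : R -> vec B -> R := fun t z => pderiv (p t) i z.

Definition has_dz i p := forall t z, 0 <= t -> K z ->
  exists d, derivable_pt_lim (fun s => p t (vshift z i s)) 0 d.

(** Orders of growth add under products, and each z-derivative raises the order by one. The product
    rule respects this count, so the class is stable under the operations of the linearized
    equations. *)
Fixpoint smooth (j q : nat) p : Prop := tame q p /\
  if j is j'.+1 then forall i, has_dz i p /\ smooth j' q.+1 (dz i p) else True.

Lemma K_vshift z i : K z -> exists d, 0 < d /\ forall s, Rabs s < d -> K (vshift z i s).
Proof.
move=> Kz; have [d [d0 H]] := openK Kz; exists d; split=> // s sd.
by apply: H; rewrite vnorm_vshift.
Qed.

Lemma derivable_ext_K (u v : vec B -> R) z i l : K z -> (forall z, K z -> u z = v z) ->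
  derivable_pt_lim (fun s => u (vshift z i s)) 0 l ->
  derivable_pt_lim (fun s => v (vshift z i s)) 0 l.
Proof.
move=> Kz uv; have [d [d0 H]] := K_vshift i Kz.
apply: (@derivable_pt_lim_ext_loc _ _ _ _ (mkposreal d d0)) => s /=.
by rewrite Rminus_0_r => /H/uv.
Qed.

Lemma eq_tame q p p' : (forall t z, 0 <= t -> K z -> p t z = p' t z) ->
  tame q p -> tame q p'.
Proof.
move=> pp' [gp lp tp]; split.
- move=> e e0; have [C [C0 H]] := gp e e0; exists C; split=> // z t Kz t0.
  by rewrite -pp' //; exact: H.
- move=> z Kz T e e0; have [d [d0 H]] := lp z Kz T e e0; exists d; split=> // z' t Kz' zd tT.
  by rewrite -!pp' //; [exact: H | lra | lra].
- move=> z Kz t; apply: continuity_pt_ext (tp z Kz t) => s.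
  by apply: pp' => //; exact: Rmax_l.
Qed.

Lemma eq_smooth j q p p' : (forall t z, 0 <= t -> K z -> p t z = p' t z) ->
  smooth j q p -> smooth j q p'.
Proof.
elim: j q p p' => [|j IH] q p p' pp' /= [tp sp]; split=> //; first exact: eq_tame tp.
  exact: eq_tame tp.
move=> i; have [dp sdp] := sp i; split.
  move=> t z t0 Kz; have [d dd] := dp t z t0 Kz; exists d.
  by apply: derivable_ext_K dd => // z' Kz'; exact: pp'.
apply: IH sdp => t z t0 Kz; symmetry; apply: pderiv_eq.
apply: (derivable_ext_K (u := p t)) => //; first by move=> z' Kz'; exact: pp'.
exact/pderivP/dp.
Qed.

Lemma smooth_tame j q p : smooth j q p -> tame q p.
Proof. by case: j => [|j] []. Qed.

Lemma smoothW j q p : smooth j.+1 q p -> smooth j q p.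
Proof.
elim: j q p => [|j IH] q p [tp sp]; split=> // i.
by have [dp sdp] := sp i; split=> //; exact: IH.
Qed.

Lemma smooth_le j j' q p : (j' <= j)%N -> smooth j q p -> smooth j' q p.
Proof.
move=> /subnK <-; elim: (j - j')%N => [|k IH] //= sp; apply: IH.
exact: smoothW.
Qed.

Lemma tame_bounded q p z T : tame q p -> K z -> exists C, 0 < C /\
  forall t, 0 <= t <= T -> Rabs (p t z) <= C.
Proof.
move=> [gp _ _] Kz; have [C [C0 H]] := gp 1 Rlt_0_1.
exists (C * exp (INR q * M T z + 1 * T)); split.
  by apply: Rmult_lt_0_compat => //; exact: exp_pos.
move=> t tT; apply: Rle_trans (H z t Kz _) _; first by lra.
apply: Rmult_le_compat_l; first lra.
apply: exp_le; have := M_mono Kz tT.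
have := pos_INR q; nra.
Qed.

Lemma tame_plus q p p' : tame q p -> tame q p' -> tame q (fun t z => p t z + p' t z).
Proof.
move=> [gp lp tp] [gp' lp' tp']; split.
- move=> e e0; have [C [C0 H]] := gp e e0; have [C' [C'0 H']] := gp' e e0.
  exists (C + C'); split; first lra; move=> z t Kz t0.
  have := H z t Kz t0; have := H' z t Kz t0; have := Rabs_triang (p t z) (p' t z); lra.
- move=> z Kz T e e0.
  have [d [d0 H]] := lp z Kz T (e / 2) ltac:(lra).
  have [d' [d'0 H']] := lp' z Kz T (e / 2) ltac:(lra).
  exists (Rmin d d'); split; first exact: Rmin_pos.
  move=> z' t Kz' zd tT.
  have h := H z' t Kz' (Rlt_le_trans _ _ _ zd (Rmin_l _ _)) tT.
  have h' := H' z' t Kz' (Rlt_le_trans _ _ _ zd (Rmin_r _ _)) tT.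
  have := Rabs_triang (p t z' - p t z) (p' t z' - p' t z).
  have -> : p t z' - p t z + (p' t z' - p' t z) = p t z' + p' t z' - (p t z + p' t z) by ring.
  by lra.
- by move=> z Kz; apply: ctn_plus; [exact: tp | exact: tp'].
Qed.

Lemma tame_mult q q' p p' : tame q p -> tame q' p' ->
  tame (q + q') (fun t z => p t z * p' t z).
Proof.
move=> hp hp'; case: (hp) => [gp lp tp]; case: (hp') => [gp' lp' tp']; split.
- move=> e e0; have [C [C0 H]] := gp (e / 2) ltac:(lra).
  have [C' [C'0 H']] := gp' (e / 2) ltac:(lra).
  exists (C * C'); split; first nra; move=> z t Kz t0.
  have -> : INR (q + q') * M t z + e * t =
      (INR q * M t z + e / 2 * t) + (INR q' * M t z + e / 2 * t).
    by rewrite plus_INR; field.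
  rewrite exp_plus Rabs_mult.
  have -> : forall a b, C * C' * (a * b) = (C * a) * (C' * b) by move=> *; ring.
  by apply: Rmult_le_compat; [exact: Rabs_pos.. | exact: H | exact: H'].
- move=> z Kz T e e0.
  have [Q [Q0 HQ]] := tame_bounded T hp Kz.
  have [Q' [Q'0 HQ']] := tame_bounded T hp' Kz.
  set W := Q + Q' + 1.
  have W0 : 0 < W by rewrite /W; lra.
  set e1 := Rmin 1 (e / (2 * W)).
  have e10 : 0 < e1 by apply: Rmin_pos; [lra | apply: Rdiv_lt_0_compat; lra].
  have e1W : 2 * W * e1 <= e.
    have := Rmult_le_compat_l (2 * W) _ _ ltac:(lra) (Rmin_r 1 (e / (2 * W))).
    by rewrite -/e1; have -> : 2 * W * (e / (2 * W)) = e by field; lra.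
  have e11 : e1 <= 1 := Rmin_l _ _.
  have [d [d0 H]] := lp z Kz T e1 e10.
  have [d' [d'0 H']] := lp' z Kz T e1 e10.
  exists (Rmin d d'); split; first exact: Rmin_pos.
  move=> z' t Kz' zd tT.
  have h := H z' t Kz' (Rlt_le_trans _ _ _ zd (Rmin_l _ _)) tT.
  have h' := H' z' t Kz' (Rlt_le_trans _ _ _ zd (Rmin_r _ _)) tT.
  have hq := HQ t tT; have hq' := HQ' t tT.
  have -> : p t z' * p' t z' - p t z * p' t z =
    (p t z' - p t z) * (p' t z' - p' t z) + (p t z' - p t z) * p' t z +
    p t z * (p' t z' - p' t z) by ring.
  have a1 := Rabs_triang ((p t z' - p t z) * (p' t z' - p' t z) + (p t z' - p t z) * p' t z)
    (p t z * (p' t z' - p' t z)).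
  have a2 := Rabs_triang ((p t z' - p t z) * (p' t z' - p' t z)) ((p t z' - p t z) * p' t z).
  rewrite !Rabs_mult in a1 a2 *.
  have n1 := Rabs_pos (p t z' - p t z); have n2 := Rabs_pos (p' t z' - p' t z).
  have n3 := Rabs_pos (p t z); have n4 := Rabs_pos (p' t z).
  set x1 := Rabs (p t z' - p t z) in h n1 a1 a2 *.
  set x2 := Rabs (p' t z' - p' t z) in h' n2 a1 a2 *.
  set y1 := Rabs (p t z) in hq n3 a1 a2 *; set y2 := Rabs (p' t z) in hq' n4 a1 a2 *.
  have m1 : x1 * x2 <= e1 * 1 by apply: Rmult_le_compat; lra.
  have m2 : x1 * y2 <= e1 * Q' by apply: Rmult_le_compat; lra.
  have m3 : y1 * x2 <= Q * e1 by apply: Rmult_le_compat; lra.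
  have : W * e1 = e1 * 1 + e1 * Q' + Q * e1 by rewrite /W; ring.
  by have : 0 < W * e1 by [exact: Rmult_lt_0_compat]; lra.
- by move=> z Kz; apply: ctn_mult; [exact: tp | exact: tp'].
Qed.

Lemma tame_const0 q : tame q (fun _ _ => 0).
Proof.
split.
- move=> e e0; exists 1; split=> [|z t Kz t0]; first lra.
  by rewrite Rabs_R0; have := exp_pos (INR q * M t z + e * t); lra.
- by move=> z Kz T e e0; exists 1; split=> [|*]; [lra | rewrite Rminus_diag Rabs_R0].
- by move=> z Kz; exact: ctn_const.
Qed.

Lemma smooth0 j q : smooth j q (fun _ _ => 0).
Proof.
elim: j q => [|j IH] q; split=> //; try exact: tame_const0.
move=> i; split.
  by move=> t z _ _; exists 0; exact: derivable_pt_lim_const.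
apply: eq_smooth (IH q.+1) => t z t0 Kz; symmetry; apply: pderiv_eq.
exact: derivable_pt_lim_const.
Qed.

Lemma has_dzP i p t z : has_dz i p -> 0 <= t -> K z ->
  derivable_pt_lim (fun s => p t (vshift z i s)) 0 (dz i p t z).
Proof. by move=> dp t0 Kz; exact/pderivP/dp. Qed.

Lemma smooth_plus j q p p' : smooth j q p -> smooth j q p' ->
  smooth j q (fun t z => p t z + p' t z).
Proof.
elim: j q p p' => [|j IH] q p p' [tp sp] [tp' sp']; split=> //; try exact: tame_plus.
move=> i; have [dp sdp] := sp i; have [dp' sdp'] := sp' i.
have dpp t z : 0 <= t -> K z ->
    derivable_pt_lim (fun s => p t (vshift z i s) + p' t (vshift z i s)) 0
      (dz i p t z + dz i p' t z).
  by move=> t0 Kz; apply: derivable_pt_lim_plus; exact: has_dzP.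
split; first by move=> t z t0 Kz; exists (dz i p t z + dz i p' t z); exact: dpp.
apply: eq_smooth (IH _ _ _ sdp sdp') => t z t0 Kz; symmetry; apply: pderiv_eq.
exact: dpp.
Qed.

Lemma smooth_mult j q q' p p' : smooth j q p -> smooth j q' p' ->
  smooth j (q + q') (fun t z => p t z * p' t z).
Proof.
elim: j q q' p p' => [|j IH] q q' p p' sjp sjp'; case: (sjp) => tp sp; case: (sjp') => tp' sp'.
  by split=> //; exact: tame_mult.
split; first exact: tame_mult.
move=> i; have [dp sdp] := sp i; have [dp' sdp'] := sp' i.
have dpp t z : 0 <= t -> K z ->
    derivable_pt_lim (fun s => p t (vshift z i s) * p' t (vshift z i s)) 0
      (dz i p t z * p' t z + p t z * dz i p' t z).
  move=> t0 Kz; have := derivable_pt_lim_mult _ _ _ _ _ (has_dzP dp t0 Kz) (has_dzP dp' t0 Kz).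
  by rewrite vshift0.
split.
  by move=> t z t0 Kz; exists (dz i p t z * p' t z + p t z * dz i p' t z); exact: dpp.
apply: (eq_smooth (p := fun t z => dz i p t z * p' t z + p t z * dz i p' t z)).
  by move=> t z t0 Kz; symmetry; apply: pderiv_eq; exact: dpp.
apply: smooth_plus; first exact: IH sdp (smoothW sjp').
by rewrite -addnS; exact: IH (smoothW sjp) sdp'.
Qed.

Lemma smooth_vsum {I : finType} j q (p : I -> R -> vec B -> R) :
  (forall i, smooth j q (p i)) -> smooth j q (fun t z => vsum (fun i => p i t z)).
Proof.
move=> sp; rewrite /vsum.
elim: (index_enum I) => [|i l IH].
  by apply: eq_smooth (smooth0 j q) => t z _ _; rewrite big_nil.
apply: (eq_smooth (p := fun t z => p i t z + \big[Rplus/0]_(k <- l) p k t z)).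
  by move=> t z _ _; rewrite big_cons.
exact: smooth_plus.
Qed.

Lemma smooth_iter j q p l : smooth j q p -> (size l <= j)%N ->
  smooth (j - size l) (q + size l) (fun t z => iter_pderiv (p t) l z).
Proof.
move=> sp; elim: l => [|i l IH] /= lj; first by rewrite subn0 addn0.
have := IH (ltnW lj); rewrite -(subnSK lj) => -[_ /(_ i)[_]].
by rewrite addnS.
Qed.

Lemma smooth_iter_dz j q p l i : smooth j q p -> (size l < j)%N ->
  has_dz i (fun t z => iter_pderiv (p t) l z).
Proof.
move=> sp lj; have := smooth_iter sp (ltnW lj).
by rewrite -(subnSK lj) => -[_ /(_ i)[]].
Qed.

Lemma mvt_dz i p z t s : has_dz i p -> 0 <= t ->
  (forall s', Rabs s' <= Rabs s -> K (vshift z i s')) ->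
  exists s', Rabs s' <= Rabs s /\ p t (vshift z i s) - p t z = s * dz i p t (vshift z i s').
Proof.
move=> dp t0 Ks.
have dP c : Rabs c <= Rabs s ->
    derivable_pt_lim (fun s => p t (vshift z i s)) c (dz i p t (vshift z i c)).
  by move=> cs; apply: derivable_vshift; apply: has_dzP => //; exact: Ks.
have cs c : Rmin 0 s <= c <= Rmax 0 s -> Rabs c <= Rabs s.
  rewrite /Rmin /Rmax /Rabs.
  by repeat case: Rle_dec => ?; repeat case: Rcase_abs => ?; lra.
have [c [c0s E]] : exists c, Rmin 0 s <= c <= Rmax 0 s /\
    p t (vshift z i s) - p t (vshift z i 0) = dz i p t (vshift z i c) * (s - 0).
  apply: (MVT_gen (fun s => p t (vshift z i s)) 0 s (fun c => dz i p t (vshift z i c))).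
    by move=> c c0s; apply/is_derive_Reals/dP/cs; lra.
  move=> c c0s; apply: derivable_continuous_pt; exists (dz i p t (vshift z i c)).
  exact/dP/cs.
exists c; split; first exact: cs.
by move: E; rewrite vshift0 => ->; ring.
Qed.

(** The mean value theorem replaces the quotient by a derivative at a nearby point; local uniform
    continuity of the derivative makes the convergence uniform in t. *)
Lemma quotient_cvg q i p z T e : smooth 1 q p -> K z -> 0 < e -> exists d, 0 < d /\
  forall s t, 0 < Rabs s < d -> 0 <= t <= T ->
    Rabs ((p t (vshift z i s) - p t z) / s - dz i p t z) < e.
Proof.
move=> [_ /(_ i)[dp [[_ lp _] _]]] Kz e0.
have [d1 [d10 H1]] := K_vshift i Kz.
have [d2 [d20 H2]] := lp z Kz T e e0.
exists (Rmin d1 d2); split; first exact: Rmin_pos.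
move=> s t [s0 sd] tT.
have s1 := Rlt_le_trans _ _ _ sd (Rmin_l _ _).
have s2 := Rlt_le_trans _ _ _ sd (Rmin_r _ _).
have [s' [s's ->]] := mvt_dz dp (proj1 tT)
  (fun s' ss' => H1 s' (Rle_lt_trans _ _ _ ss' s1)).
have sn : s <> 0 by move=> s0'; rewrite s0' Rabs_R0 in s0; lra.
have -> : s * dz i p t (vshift z i s') / s = dz i p t (vshift z i s') by field.
apply: H2 => //; first by apply: H1; lra.
by rewrite vnorm_vshift; lra.
Qed.

End SmoothClass.

(** * Limits of solutions *)

Lemma unif_cauchy_limit {J : finType} (eta : R -> R -> vec J) :
  (forall T nu, 0 < nu -> exists s1, 0 < s1 /\ forall s s' t, 0 < Rabs s < s1 ->
    0 < Rabs s' < s1 -> 0 <= t <= T -> vnorm (vsub (eta s t) (eta s' t)) <= nu) ->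
  exists Y, forall T nu, 0 < nu -> exists s1, 0 < s1 /\ forall s t, 0 < Rabs s < s1 ->
    0 <= t <= T -> vnorm (vsub (eta s t) (Y t)) <= nu.
Proof.
move=> cau.
(* The limit is taken along s = 1 / (n + 1); the Cauchy condition extends the convergence to all
   small s. *)
pose u n := / (INR n + 1).
have u0 n : 0 < u n by apply: Rinv_0_lt_compat; have := pos_INR n; lra.
have ucv s1 : 0 < s1 -> exists n0 : nat, forall n : nat, (n0 <= n)%coq_nat -> 0 < Rabs (u n) < s1.
  move=> s10; have [n0 Hn0] := INR_unbounded (/ s1); exists n0 => n n0n.
  have := le_INR _ _ n0n => h; rewrite Rabs_pos_eq; last by have := u0 n; lra.
  split; first exact: u0.
  rewrite /u -(Rinv_inv s1); apply: Rinv_lt_contravar; last by lra.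
  by apply: Rmult_lt_0_compat; [exact: Rinv_0_lt_compat | have := pos_INR n; lra].
pose Y t j := epsilon (inhabits 0) (Un_cv (fun n => eta (u n) t j)).
have Ycv t j : 0 <= t -> Un_cv (fun n => eta (u n) t j) (Y t j).
  move=> t0; apply: epsilon_spec.
  have [] := Rcomplete.R_complete (fun n => eta (u n) t j); last by move=> l; exists l.
  move=> e e0; have [s1 [s10 H]] := cau t (e / 2) ltac:(lra).
  have [n0 Hn0] := ucv s1 s10; exists n0 => n n' hn hn'.
  have := H _ _ t (Hn0 n hn) (Hn0 n' hn') ltac:(lra).
  have := vnorm_comp (vsub (eta (u n) t) (eta (u n') t)) j.
  by rewrite /vsub /Rdist; lra.
exists Y => T nu nu0.
set N := vsum (fun _ : J => 1).
have N0 : 0 <= N by apply: vsum_ge0 => _; lra.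
have e0 : 0 < nu / (2 * (N + 1)) by apply: Rdiv_lt_0_compat; lra.
have [s1 [s10 H]] := cau T _ e0; exists s1; split=> // s t ss tT.
have Hj j : Rabs (vsub (eta s t) (Y t) j) <= nu / (N + 1).
  have [n1 Hn1] := Ycv t j (proj1 tT) _ e0; have [n2 Hn2] := ucv s1 s10.
  set n := Nat.max n1 n2.
  have h1 := Hn1 n (Nat.le_max_l _ _); have h2 := H s (u n) t ss (Hn2 n (Nat.le_max_r _ _)) tT.
  have := vnorm_comp (vsub (eta s t) (eta (u n) t)) j.
  move: h1; rewrite /Rdist /vsub => h1 h3.
  have := Rabs_triang (eta s t j - eta (u n) t j) (eta (u n) t j - Y t j).
  have -> : eta s t j - eta (u n) t j + (eta (u n) t j - Y t j) = eta s t j - Y t j by ring.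
  have -> : nu / (N + 1) = nu / (2 * (N + 1)) + nu / (2 * (N + 1)) by field; lra.
  by rewrite /vsub in h2; lra.
apply: Rle_trans (vnorm_le_card Hj) _; rewrite -/N.
have -> : N * (nu / (N + 1)) = nu * (N / (N + 1)) by field; lra.
have : N / (N + 1) <= 1 by apply/Rle_div_l; lra.
by nra.
Qed.

Definition ucv (u : R -> R -> R) (v : R -> R) := forall T nu, 0 < nu -> exists s1, 0 < s1 /\
  forall s t, 0 < Rabs s < s1 -> 0 <= t <= T -> Rabs (u s t - v t) <= nu.

Lemma unif_limit_ctn (u : R -> R -> R) (v : R -> R) s0 :
  0 < s0 -> (forall s, 0 < Rabs s < s0 -> ctn (u s)) ->
  ucv u v -> ctn v.
Proof.
move=> s00 us uv.
apply/ctnP => t t0 e e0.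
have [s1 [s10 H]] := uv (t + 1) (e / 4) ltac:(lra).
have mp := Rmin_pos _ _ s00 s10; set s := Rmin s0 s1 / 2.
have sE : Rabs s = s by rewrite Rabs_pos_eq /s; lra.
have [ss ss1] : 0 < Rabs s < s0 /\ 0 < Rabs s < s1.
  by rewrite sE /s; have := Rmin_l s0 s1; have := Rmin_r s0 s1; lra.
have cu := us s ss; have [d [d0 Hd]] := proj1 (ctnP (u s)) cu t t0 (e / 4) ltac:(lra).
exists (Rmin d 1); split; first by apply: Rmin_pos; lra.
move=> t' t'0 tt'; have tt'1 := Rlt_le_trans _ _ _ tt' (Rmin_l _ _).
have tt'2 := Rlt_le_trans _ _ _ tt' (Rmin_r _ _).
have h1 := Hd t' t'0 tt'1; have h2 := H s t ss1 ltac:(lra).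
have h3 := H s t' ss1 ltac:(split; [lra | move: tt'2 => /Rabs_def2; lra]).
have -> : v t' - v t = - (u s t' - v t') + (u s t' - u s t) + (u s t - v t) by ring.
have := Rabs_triang (- (u s t' - v t') + (u s t' - u s t)) (u s t - v t).
have := Rabs_triang (- (u s t' - v t')) (u s t' - u s t).
by rewrite Rabs_Ropp; lra.
Qed.

(** The mean value theorem compares the increment of u s with h g t; s is chosen after h, so that
    the error of u s against v is small relative to |h|. *)
Lemma unif_limit_derivable (u du : R -> R -> R) (v g : R -> R) s0 :
  0 < s0 -> (forall s, 0 < Rabs s < s0 -> ctn (u s) /\
    forall t, 0 < t -> derivable_pt_lim (u s) t (du s t)) ->
  ucv u v ->
  ucv du g ->
  ctn g -> forall t, 0 < t -> derivable_pt_lim v t (g t).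
Proof.
move=> s00 us uv dug cg.
have pick s1 s2 : 0 < s1 -> 0 < s2 ->
    exists s, 0 < Rabs s < s0 /\ 0 < Rabs s < s1 /\ 0 < Rabs s < s2.
  move=> s10 s20; have h := Rmin_pos _ _ s00 (Rmin_pos _ _ s10 s20).
  exists (Rmin s0 (Rmin s1 s2) / 2); rewrite Rabs_pos_eq; last lra.
  have := Rmin_l s0 (Rmin s1 s2); have := Rmin_r s0 (Rmin s1 s2).
  by have := Rmin_l s1 s2; have := Rmin_r s1 s2; lra.
move=> t t0 e e0.
have [d [d0 Hd]] := proj1 (ctnP g) cg t ltac:(lra) (e / 4) ltac:(lra).
have d'0 : 0 < Rmin (Rmin d t) 1 by apply: Rmin_pos; [exact: Rmin_pos | lra].
exists (mkposreal _ d'0) => h hn /= hd.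
have hd1 : Rabs h < d by apply: Rlt_le_trans hd _; apply: Rle_trans (Rmin_l _ _) (Rmin_l _ _).
have hd2 : Rabs h < t by apply: Rlt_le_trans hd _; apply: Rle_trans (Rmin_l _ _) (Rmin_r _ _).
have hd3 : Rabs h < 1 by apply: Rlt_le_trans hd (Rmin_r _ _).
have hp : 0 < Rabs h by exact: Rabs_pos_lt.
have [th1 th2] : 0 < t + h /\ t + h < t + 1 by move/Rabs_def2: hd2; move/Rabs_def2: hd3; lra.
suff : Rabs (v (t + h) - v t - h * g t) <= e / 2 * Rabs h + e / 4 * Rabs h.
  move=> hh; have -> : (v (t + h) - v t) / h - g t = (v (t + h) - v t - h * g t) / h by field.
  rewrite Rabs_div //.
  by apply: (Rle_lt_trans _ (3 / 4 * e)); [apply/Rle_div_l; lra | lra].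
have [s1 [s10 H1]] := dug (t + 1) (e / 4) ltac:(lra).
have [s2 [s20 H2]] := uv (t + 1) (e / 8 * Rabs h) ltac:(nra).
have [s [ss [ss1 ss2]]] := pick s1 s2 s10 s20.
have [cu dus] := us s ss.
have a1 := H2 s t ss2 ltac:(lra); have a2 := H2 s (t + h) ss2 ltac:(lra).
have cmp c : 0 < c -> Rabs (c - t) <= Rabs h -> Rabs (du s c - g t) <= e / 2.
  move=> c0 ct; have hc : c <= t + 1.
    have : Rabs (c - t) < 1 by lra.
    by move=> /Rabs_def2; lra.
  have b1 := H1 s c ss1 ltac:(lra); have b2 := Hd c ltac:(lra) ltac:(lra).
  have -> : du s c - g t = (du s c - g c) + (g c - g t) by ring.
  by have := Rabs_triang (du s c - g c) (g c - g t); lra.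
have mv : Rabs (u s (t + h) - u s t - h * g t) <= e / 2 * Rabs h.
  case: (Rlt_le_dec 0 h) => h0.
    have [c [l [tc [dl E]]]] : exists c l, t < c < t + h /\ derivable_pt_lim (u s) c l /\
        u s (t + h) - u s t = l * (t + h - t).
      by apply: mvt_ctn => //; [lra | move=> c tc; exists (du s c); apply: dus; lra].
    have -> : u s (t + h) - u s t - h * g t = (l - g t) * h by rewrite E; ring.
    rewrite Rabs_mult; apply: Rmult_le_compat_r; first lra.
    have -> := uniqueness_limite _ _ _ _ dl (dus c ltac:(lra)).
    by apply: cmp; [lra | rewrite !Rabs_pos_eq; lra].
  have h0' : h < 0 by lra.
  have [c [l [tc [dl E]]]] : exists c l, t + h < c < t /\ derivable_pt_lim (u s) c l /\
      u s t - u s (t + h) = l * (t - (t + h)).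
    by apply: mvt_ctn => //; [lra | move=> c tc; exists (du s c); apply: dus; lra].
  have -> : u s (t + h) - u s t - h * g t = (l - g t) * h by lra.
  rewrite Rabs_mult; apply: Rmult_le_compat_r; first lra.
  have -> := uniqueness_limite _ _ _ _ dl (dus c ltac:(lra)).
  by apply: cmp; [lra | rewrite (Rabs_left h) // Rabs_left1; lra].
have -> : v (t + h) - v t - h * g t = (u s (t + h) - u s t - h * g t)
  + (- (u s (t + h) - v (t + h)) + (u s t - v t)) by ring.
apply: Rle_trans (Rabs_triang _ _) _; apply: Rplus_le_compat => //.
by apply: Rle_trans (Rabs_triang _ _) _; rewrite Rabs_Ropp; lra.
Qed.

(** * Slow solutions under small forcing and the passage to the limit *)

Section Limit.
Context {A B : finType} {r : nat} {U : vec (A + B)%type -> Prop}.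
Context {F : vec (A + B)%type -> vec (A + B)%type}.
Context {al ell b c : vec (A + B)%type -> R} {c1 cr Lip : R}.
Hypothesis dom : dominated r U F al ell b c c1 cr Lip.
Let cr0 := dm_cr dom.
Let Lip0 := dm_Lip dom.

Lemma linsol_sub x eta eta' Phi Phi' T : linsol (F := F) x eta Phi T -> linsol (F := F) x eta' Phi' T ->
  linsol (F := F) x (fun t j => eta t j - eta' t j) (fun t j => Phi t j - Phi' t j) T.
Proof.
move=> [ce de] [ce' de']; split=> [j|t tT j]; first exact: ctn_minus.
have -> : jac F (x t) (fun j => eta t j - eta' t j) j + (Phi t j - Phi' t j) =
  jac F (x t) (eta t) j + Phi t j - (jac F (x t) (eta' t) j + Phi' t j).
  by rewrite jacB; ring.
by apply: derivable_pt_lim_minus; [exact: de | exact: de'].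
Qed.

(** T lets the exponentially small term of [closeness] beat the factor exp ((Lip + 1) T0), and sigma
    does the same for the forcing. Since C is given first, solutions that share one growth constant
    can be compared. *)
Lemma slow_small x M C T0 nu : rate (F := F) (U := U) x M -> 0 < C -> 0 < nu -> 0 <= T0 ->
  exists T sigma, T0 <= T /\ 0 < sigma /\ forall eta Phi, linsol (F := F) x eta Phi T ->
  (forall t, 0 < t < T -> vnorm (Phi t) <= sigma) -> vnorm (PiB (eta 0)) <= sigma ->
  vnorm (PiA (eta T)) <= C * exp (INR r * M T + cr / 2 * T) ->
  forall t, 0 <= t <= T0 -> vnorm (eta t) <= nu.
Proof.
move=> rM C0 nu0 T00; set Q := exp ((Lip + 1) * T0).
have Q0 : 0 < Q by exact: exp_pos.
set y := 4 * C * Q / nu.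
have y0 : 0 < y by apply: Rdiv_lt_0_compat => //; nra.
have k0 : 0 < 2 / cr by apply: Rdiv_lt_0_compat; lra.
set T := Rmax T0 (2 / cr * y).
set sigma := nu / (2 * (2 + 2 / cr) * Q).
have s0 : 0 < sigma by apply: Rdiv_lt_0_compat => //; nra.
have TT : T0 <= T := Rmax_l _ _.
exists T, sigma; split=> //; split=> // eta Phi le Phis w0 pT t tT.
apply: Rle_trans (closeness dom rM C0 s0 (conj T00 TT) le Phis w0 pT tT) _.
rewrite -/Q Rmult_plus_distr_r.
have -> : sigma * (2 + 2 / cr) * Q = nu / 2 by rewrite /sigma; field; split; [|split]; lra.
suff : C * exp (- (cr / 2) * T) * Q <= nu / 2 by lra.
have : exp (- (cr / 2) * T) <= / y.
  have -> : - (cr / 2) * T = - (cr / 2 * T) by ring.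
  rewrite exp_Ropp; apply: Rinv_le_contravar => //.
  have : y <= cr / 2 * T.
    have := Rmult_le_compat_l (cr / 2) _ _ ltac:(lra) (Rmax_r T0 (2 / cr * y)).
    by rewrite -/T; have -> : cr / 2 * (2 / cr * y) = y by field; lra.
  by have := exp_ineq1_le (cr / 2 * T); lra.
move=> h; have := Rmult_le_compat_l (C * Q) _ _ ltac:(nra) h.
have -> : C * Q * / y = nu / 4 by rewrite /y; field; lra.
by lra.
Qed.

(** The difference of two members has small forcing, zero initial z-component and growth constant 2
    C, so [slow_small] makes the family Cauchy; the right-hand sides converge with it. In the growth
    hypothesis the range of s may shrink as T increases, but C may not change. *)
Lemma limit_solution x M eta Phi Phi0 w0 s0 C : rate (F := F) (U := U) x M ->
  (forall j k, ctn (fun t => pderiv (fun y => F y j) k (x t))) ->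
  0 < s0 -> 0 < C ->
  (forall s T, 0 < Rabs s < s0 -> linsol (F := F) x (eta s) (Phi s) T) ->
  (forall s j, 0 < Rabs s < s0 -> eta s 0 (inr j) = w0 j) ->
  (forall T nu, 0 < nu -> exists s1, 0 < s1 /\ forall s t, 0 < Rabs s < s1 ->
    0 <= t <= T -> vnorm (vsub (Phi s t) (Phi0 t)) <= nu) ->
  (forall T, exists s1, 0 < s1 /\ forall s t, 0 < Rabs s < s1 -> 0 <= t <= T ->
    vnorm (eta s t) <= C * exp (INR r * M t + cr / 2 * t)) ->
  (forall j, ctn (fun t => Phi0 t j)) ->
  exists Y, (forall T nu, 0 < nu -> exists s1, 0 < s1 /\ forall s t, 0 < Rabs s < s1 ->
    0 <= t <= T -> vnorm (vsub (eta s t) (Y t)) <= nu) /\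
   (forall T, linsol (F := F) x Y Phi0 T) /\ forall j, Y 0 (inr j) = w0 j.
Proof.
move=> rM cA s00 C0 lin ini PhiL grw cPhi0.
case: (rM) => _ _ Ux _.
have [Y HY] : exists Y, forall T nu, 0 < nu -> exists s1, 0 < s1 /\
    forall s t, 0 < Rabs s < s1 -> 0 <= t <= T -> vnorm (vsub (eta s t) (Y t)) <= nu.
  apply: unif_cauchy_limit => T0' nu nu0; set T0 := Rmax 0 T0'.
  have T00 : 0 <= T0 := Rmax_l 0 T0'.
  have [T [sigma [TT [sg0 H]]]] := slow_small (C := 2 * C) rM ltac:(lra) nu0 T00.
  have [s1 [s10 H1]] := PhiL T (sigma / 2) ltac:(lra).
  have [s2 [s20 H2]] := grw T.
  have mp := Rmin_pos _ _ s00 (Rmin_pos _ _ s10 s20).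
  exists (Rmin s0 (Rmin s1 s2)); split=> //.
  have mm s : 0 < Rabs s < Rmin s0 (Rmin s1 s2) ->
      0 < Rabs s < s0 /\ 0 < Rabs s < s1 /\ 0 < Rabs s < s2.
    move=> [sp sm]; have := Rmin_l s0 (Rmin s1 s2); have := Rmin_r s0 (Rmin s1 s2).
    by have := Rmin_l s1 s2; have := Rmin_r s1 s2; lra.
  move=> s s' t /mm[sa [sb sc]] /mm[sa' [sb' sc']] tT.
  apply: (H (fun t j => eta s t j - eta s' t j) (fun t j => Phi s t j - Phi s' t j)).
  - exact: linsol_sub (lin s T sa) (lin s' T sa').
  - move=> u uT; have := H1 s u sb ltac:(lra); have := H1 s' u sb' ltac:(lra).
    have := vnorm_triangB (vsub (Phi s u) (Phi0 u)) (vsub (Phi s' u) (Phi0 u)).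
    rewrite (eq_vnorm (v := fun j => Phi s u j - Phi s' u j)) => [|j]; first lra.
    by rewrite /vsub; ring.
  - rewrite (eq_vnorm (v := vzero)) ?vnorm0; first lra.
    by move=> j; rewrite /PiB !ini // /vzero; ring.
  - have TT' : 0 <= T <= T by lra.
    have := H2 s T sc TT'; have := H2 s' T sc' TT'.
    have := vnorm_PiA (fun j => eta s T j - eta s' T j).
    by have := vnorm_triangB (eta s T) (eta s' T); lra.
  by split; [lra | apply: Rle_trans (proj2 tT) (Rmax_r _ _)].
exists Y; split=> //.
have Yj j T nu : 0 < nu -> exists s1, 0 < s1 /\ forall s t, 0 < Rabs s < s1 -> 0 <= t <= T ->
    Rabs (eta s t j - Y t j) <= nu.
  move=> nu0; have [s1 [s10 H]] := HY T nu nu0; exists s1; split=> // s t ss tT.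
  exact: Rle_trans (vnorm_comp (vsub (eta s t) (Y t)) j) (H s t ss tT).
have ctnY j : ctn (fun t => Y t j).
  by apply: (unif_limit_ctn s00 _ (Yj j)) => s ss; case: (lin s 1 ss).
have dY j : forall t, 0 < t ->
    derivable_pt_lim (fun s => Y s j) t (jac F (x t) (Y t) j + Phi0 t j).
  apply: (@unif_limit_derivable (fun s t => eta s t j)
    (fun s t => jac F (x t) (eta s t) j + Phi s t j) (fun t => Y t j)
    (fun t => jac F (x t) (Y t) j + Phi0 t j) s0 s00 _ (Yj j) _ _).
  - move=> s ss; split; first by case: (lin s 1 ss).
    by move=> t t0; case: (lin s (t + 1) ss) => _; apply; lra.
  - move=> T nu nu0.
    have [s1 [s10 H1]] := HY T (nu / (2 * Lip)) ltac:(apply: Rdiv_lt_0_compat; lra).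
    have [s2 [s20 H2]] := PhiL T (nu / 2) ltac:(lra).
    exists (Rmin s1 s2); split; first exact: Rmin_pos.
    move=> s t [sp sm] tT.
    have h1 := H1 s t (conj sp (Rlt_le_trans _ _ _ sm (Rmin_l _ _))) tT.
    have h2 := H2 s t (conj sp (Rlt_le_trans _ _ _ sm (Rmin_r _ _))) tT.
    have -> : jac F (x t) (eta s t) j + Phi s t j - (jac F (x t) (Y t) j + Phi0 t j) =
      jac F (x t) (vsub (eta s t) (Y t)) j + vsub (Phi s t) (Phi0 t) j.
      by rewrite jacB /vsub; ring.
    apply: Rle_trans (Rabs_triang _ _) _.
    have := vnorm_comp (jac F (x t) (vsub (eta s t) (Y t))) j.
    have := dm_jac dom (vsub (eta s t) (Y t)) (Ux t (proj1 tT)).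
    have := vnorm_comp (vsub (Phi s t) (Phi0 t)) j.
    have := Rmult_le_compat_l _ _ _ (Rlt_le _ _ Lip0) h1.
    have -> : Lip * (nu / (2 * Lip)) = nu / 2 by field; lra.
    by lra.
  - apply: ctn_plus => //; apply: (ctn_vsum (u := fun t k => _ * Y t k)) => k.
    exact: ctn_mult.
split; first by move=> T; split=> // t tT j; apply: dY; lra.
move=> j; apply: cond_eq => e e0.
have [s1 [s10 H]] := Yj (inr j) 0 (e / 2) ltac:(lra).
have mp := Rmin_pos _ _ s00 s10; set s := Rmin s0 s1 / 2.
have sE : Rabs s = s by rewrite Rabs_pos_eq /s; lra.
have [sa sb] : 0 < Rabs s < s0 /\ 0 < Rabs s < s1.
  by rewrite sE /s; have := Rmin_l s0 s1; have := Rmin_r s0 s1; lra.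
have := H s 0 sb ltac:(lra); rewrite ini // Rabs_minus_sym; lra.
Qed.

End Limit.

(** * Smooth dependence of the orbits *)

Definition loc_bounded (v : R -> R) := forall T, exists C, 0 < C /\
  forall t, 0 <= t <= T -> Rabs (v t) <= C.

Lemma ucv_plus u u' v v' : ucv u v -> ucv u' v' ->
  ucv (fun s t => u s t + u' s t) (fun t => v t + v' t).
Proof.
move=> uv uv' T nu nu0.
have [s1 [s10 H1]] := uv T (nu / 2) ltac:(lra).
have [s2 [s20 H2]] := uv' T (nu / 2) ltac:(lra).
exists (Rmin s1 s2); split; first exact: Rmin_pos.
move=> s t [sp sm] tT.
have := H1 s t (conj sp (Rlt_le_trans _ _ _ sm (Rmin_l _ _))) tT.
have := H2 s t (conj sp (Rlt_le_trans _ _ _ sm (Rmin_r _ _))) tT.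
have := Rabs_triang (u s t - v t) (u' s t - v' t).
have -> : u s t - v t + (u' s t - v' t) = u s t + u' s t - (v t + v' t) by ring.
by lra.
Qed.

Lemma ucv_mult u u' v v' : ucv u v -> ucv u' v' -> loc_bounded v -> loc_bounded v' ->
  ucv (fun s t => u s t * u' s t) (fun t => v t * v' t).
Proof.
move=> uv uv' bv bv' T nu nu0.
have [Q [Q0 HQ]] := bv T; have [Q' [Q'0 HQ']] := bv' T.
set W := Q + Q' + 1; have W0 : 0 < W by rewrite /W; lra.
set e := Rmin 1 (nu / W).
have e0 : 0 < e by apply: Rmin_pos; [lra | exact: Rdiv_lt_0_compat].
have e1 : e <= 1 := Rmin_l _ _.
have eW : W * e <= nu.
  have := Rmult_le_compat_l W _ _ ltac:(lra) (Rmin_r 1 (nu / W)).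
  by rewrite -/e; have -> : W * (nu / W) = nu by field; lra.
have [s1 [s10 H1]] := uv T e e0; have [s2 [s20 H2]] := uv' T e e0.
exists (Rmin s1 s2); split; first exact: Rmin_pos.
move=> s t [sp sm] tT.
have h := H1 s t (conj sp (Rlt_le_trans _ _ _ sm (Rmin_l _ _))) tT.
have h' := H2 s t (conj sp (Rlt_le_trans _ _ _ sm (Rmin_r _ _))) tT.
have q := HQ t tT; have q' := HQ' t tT.
have -> : u s t * u' s t - v t * v' t = (u s t - v t) * (u' s t - v' t)
  + (u s t - v t) * v' t + v t * (u' s t - v' t) by ring.
have a1 := Rabs_triang ((u s t - v t) * (u' s t - v' t) + (u s t - v t) * v' t)
  (v t * (u' s t - v' t)).
have a2 := Rabs_triang ((u s t - v t) * (u' s t - v' t)) ((u s t - v t) * v' t).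
rewrite !Rabs_mult in a1 a2 *.
have n1 := Rabs_pos (u s t - v t); have n2 := Rabs_pos (u' s t - v' t).
have n3 := Rabs_pos (v t); have n4 := Rabs_pos (v' t).
have m1 := Rmult_le_compat _ _ _ _ n1 n2 h h'.
have m2 := Rmult_le_compat _ _ _ _ n1 n4 h q'.
have m3 := Rmult_le_compat _ _ _ _ n3 n2 q h'.
have : W * e = e * 1 + e * Q' + Q * e by rewrite /W; ring.
have : e * e <= e * 1 by apply: Rmult_le_compat_l; lra.
by lra.
Qed.

Lemma ucv_vsum {I : finType} (u : I -> R -> R -> R) (v : I -> R -> R) :
  (forall i, ucv (u i) (v i)) ->
  ucv (fun s t => vsum (fun i => u i s t)) (fun t => vsum (fun i => v i t)).
Proof.
move=> uv; rewrite /vsum; elim: (index_enum I) => [|i l IH].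
  move=> T nu nu0; exists 1; split=> [|s t _ _]; first lra.
  by rewrite !big_nil Rminus_diag Rabs_R0; lra.
have H := ucv_plus (uv i) IH; move=> T nu nu0; have [s1 [s10 H1]] := H T nu nu0.
by exists s1; split=> // s t; rewrite !big_cons; exact: H1.
Qed.

Lemma ucv_vnorm {I : finType} (u : R -> R -> vec I) (v : R -> vec I) :
  (forall i, ucv (fun s t => u s t i) (fun t => v t i)) ->
  forall T nu, 0 < nu -> exists s1, 0 < s1 /\ forall s t, 0 < Rabs s < s1 ->
    0 <= t <= T -> vnorm (vsub (u s t) (v t)) <= nu.
Proof.
move=> uv T nu nu0; set N := vsum (fun _ : I => 1).
have N0 : 0 <= N by apply: vsum_ge0 => _; lra.
have e0 : 0 < nu / (N + 1) by apply: Rdiv_lt_0_compat; lra.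
have [d [d0 H]] := fin_min (P := fun i d => forall s t, 0 < Rabs s < d -> 0 <= t <= T ->
  Rabs (u s t i - v t i) <= nu / (N + 1)) (fun i d d' H dd' s t sd => H s t ltac:(lra))
  (fun i => uv i T _ e0).
exists d; split=> // s t sd tT.
apply: Rle_trans (vnorm_le_card (fun i => H i s t sd tT)) _; rewrite -/N.
have -> : N * (nu / (N + 1)) = nu * (N / (N + 1)) by field; lra.
have : N / (N + 1) <= 1 by apply/Rle_div_l; lra.
by nra.
Qed.

Lemma eq_linsol {A B : finType} (F : vec (A + B)%type -> vec (A + B)%type) x
    (eta eta' Phi : R -> vec (A + B)%type) T :
  (forall t j, 0 <= t -> eta t j = eta' t j) ->
  linsol (F := F) x eta Phi T -> linsol (F := F) x eta' Phi T.
Proof.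
move=> ee [ce de]; split=> [j t|t tT j].
  apply: continuity_pt_ext (ce j t) => s; apply: ee; exact: Rmax_l.
have t0 : 0 < t by lra.
have -> : jac F (x t) (eta' t) j = jac F (x t) (eta t) j by apply: eq_jac => k; rewrite ee //; lra.
apply: (@derivable_pt_lim_ext_loc _ _ _ _ (mkposreal t t0)) (de t tT j) => s /= st.
by apply: ee; move/Rabs_def2: st; lra.
Qed.

Lemma vnorm_near {I : finType} (x : R -> vec I) t e : (forall j, ctn (fun t => x t j)) ->
  0 <= t -> 0 < e -> exists d, 0 < d /\ forall s, 0 <= s -> Rabs (s - t) < d ->
    vnorm (vsub (x s) (x t)) < e.
Proof.
move=> cx t0 e0.
have cn : ctn (fun s => vnorm (vsub (x s) (x t))).
  apply: (ctn_vnorm (u := fun s => vsub (x s) (x t))) => j.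
  by apply: ctn_minus => //; exact: ctn_const.
have [d [d0 H]] := proj1 (ctnP _) cn t t0 e e0; exists d; split=> // s s0 st.
have := H s s0 st; have -> : vnorm (vsub (x t) (x t)) = 0.
  by rewrite (eq_vnorm (v := vzero)) ?vnorm0 // => j; rewrite /vsub /vzero; ring.
by rewrite Rminus_0_r Rabs_pos_eq //; exact: vnorm_ge0.
Qed.

Lemma ctn_cont_on {I : finType} (U : vec I -> Prop) (G : vec I -> R) (x : R -> vec I) :
  cont_on U G -> (forall t, 0 <= t -> U (x t)) -> (forall j, ctn (fun t => x t j)) ->
  ctn (fun t => G (x t)).
Proof.
move=> cG Ux cx; apply/ctnP => t t0 e e0.
have [d [d0 H]] := cG _ (Ux t t0) e e0; have [d' [d'0 H']] := vnorm_near cx t0 d0.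
by exists d'; split=> // s s0 st; apply: H; [exact: Ux | exact: H'].
Qed.

(** Compactness of an orbit segment, by the supremum of the times up to which one radius works. The
    derivatives of top order are merely continuous on [U], so no Lipschitz bound can replace
    this. *)
Lemma unif_cont_along {I : finType} (U : vec I -> Prop) (G : vec I -> R) (x : R -> vec I) T e :
  cont_on U G -> (forall t, 0 <= t -> U (x t)) -> (forall j, ctn (fun t => x t j)) -> 0 < e ->
  exists d, 0 < d /\ forall t y, 0 <= t <= T -> U y -> vnorm (vsub y (x t)) < d ->
    Rabs (G y - G (x t)) < e.
Proof.
move=> cG Ux cx e0.
case: (Rle_lt_dec 0 T) => T0; last by exists 1; split=> [|t y tT]; lra.
pose good d t := forall y, U y -> vnorm (vsub y (x t)) < d -> Rabs (G y - G (x t)) < e.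
have loc t : 0 <= t -> exists rho d, 0 < rho /\ 0 < d /\
    forall s, 0 <= s -> Rabs (s - t) < rho -> good d s.
  move=> t0; have [d [d0 H]] := cG _ (Ux t t0) (e / 2) ltac:(lra).
  have [rho [rho0 H']] := vnorm_near cx t0 (e := d / 2) ltac:(lra).
  exists rho, (d / 2); split=> //; split; first lra.
  move=> s s0 st y Uy yd; have sd := H' s s0 st.
  have h1 : Rabs (G y - G (x t)) < e / 2.
    apply: H => //; have := vnorm_triang (vsub y (x s)) (vsub (x s) (x t)).
    rewrite (eq_vnorm (v := vsub y (x t))) => [|j]; first lra.
    by rewrite /vsub; ring.
  have h2 : Rabs (G (x s) - G (x t)) < e / 2 by apply: H; [exact: Ux | lra].
  have := Rabs_triang (G y - G (x t)) (- (G (x s) - G (x t))); rewrite Rabs_Ropp.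
  by have -> : G y - G (x t) + - (G (x s) - G (x t)) = G y - G (x s) by [ring]; lra.
pose P tau := 0 <= tau <= T /\ exists d, 0 < d /\ forall t, 0 <= t <= tau -> good d t.
have P0 : P 0.
  split; first lra; have [rho [d [rho0 [d0 H]]]] := loc 0 ltac:(lra).
  by exists d; split=> // t t0; apply: H; [lra | rewrite Rabs_pos_eq; lra].
have [m [mub mlub]] : {m | is_lub P m}.
  apply: completeness; first by exists T => tau [[_ ?] _].
  by exists 0.
have m0 : 0 <= m by exact: mub.
have mT : m <= T by apply: mlub => tau [[_ ?] _].
have [rho [d [rho0 [d0 H]]]] := loc m m0.
have [tau [[tauT [d' [d'0 H']]] taum]] : exists tau, P tau /\ m - rho < tau.
  apply: NNPP => nex; suff : m <= m - rho by lra.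
  apply: mlub => tau Ptau; case: (Rle_lt_dec tau (m - rho)) => // lt.
  by exfalso; apply: nex; exists tau.
have Pm : P (Rmin T (m + rho / 2)).
  have l1 := Rmin_l T (m + rho / 2); have l2 := Rmin_r T (m + rho / 2).
  have l3 : 0 <= Rmin T (m + rho / 2) by apply: Rmin_glb; lra.
  split; first lra.
  exists (Rmin d d'); split; first exact: Rmin_pos.
  move=> t tm y Uy yd; case: (Rle_lt_dec t tau) => ttau.
    by apply: (H' t) => //; [lra | apply: Rlt_le_trans yd (Rmin_r _ _)].
  apply: (H t) => //; [lra | by apply: Rabs_def1; lra |].
  by apply: Rlt_le_trans yd (Rmin_l _ _).
have := mub _ Pm => Pm'.
have [_ [d1 [d10 H1]]] := Pm.
exists d1; split=> // t y tT Uy; apply: H1 => //; split; first lra.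
apply: Rle_trans (proj2 tT) _; move: Pm'; rewrite /Rmin; case: Rle_dec => ?; lra.
Qed.

(** * Orbits over [K] and their derivatives in z *)

Section Orbits.
Context {A B : finType} {r : nat} {U : vec (A + B)%type -> Prop}.
Context {F : vec (A + B)%type -> vec (A + B)%type}.
Context {al ell b c : vec (A + B)%type -> R} {c1 cr Lip : R}.
Hypothesis dom : dominated r U F al ell b c c1 cr Lip.
Let cr0 := dm_cr dom.
Let Lip0 := dm_Lip dom.
Variables (K : vec B -> Prop) (X : R -> vec B -> vec (A + B)%type) (M : R -> vec B -> R).
Hypothesis openK : open_vset K.
Hypothesis rateX : forall z, K z -> rate (F := F) (U := U) (fun t => X t z) (fun t => M t z).
Hypothesis ctnX : forall z j, K z -> ctn (fun t => X t z j).
Hypothesis dX : forall z t j, K z -> 0 < t ->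
  derivable_pt_lim (fun s => X s z j) t (F (X t z) j).
Hypothesis X0 : forall z j, K z -> X 0 z (inr j) = z j.
Hypothesis coneX : forall z z' t, K z -> K z' -> 0 <= t ->
  vnorm (PiA (vsub (X t z') (X t z))) <= vnorm (PiB (vsub (X t z') (X t z))).
Local Notation mu := (mu (F := F)).
Local Notation smooth := (smooth K M).
Local Notation tame := (tame K M).

Let M_mono z s t : K z -> 0 <= s <= t -> M s z <= M t z.
Proof. by move=> Kz; exact: (rate_mono dom (rateX Kz)). Qed.

Let UX z t : K z -> 0 <= t -> U (X t z).
Proof. by move=> Kz; case: (rateX Kz) => _ _ H _; exact: H. Qed.

Let M_ge0 z t : K z -> 0 <= t -> 0 <= M t z.
Proof. by move=> Kz; exact: (rate_ge0 dom (rateX Kz)). Qed.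

(** The difference D of two orbits satisfies |a| <= |z|, so its z-part grows at rate [mu] up to the
    Taylor remainder Lip |D|^2, which is at most e |z| as long as |D| <= e / (2 Lip). The factor 4
    keeps D in that range: a 2 for the a-part and a 2 for the bootstrap in [gronwall]. *)
Lemma near_orbit e z z' rho T : 0 < e -> K z -> K z' -> 0 < rho ->
  vnorm (vsub z' z) <= rho -> 4 * rho * exp (M T z + e * T) <= e / (2 * Lip) ->
  forall t, 0 <= t <= T ->
    vnorm (vsub (X t z') (X t z)) <= 2 * rho * exp (M t z + e * t).
Proof.
move=> e0 Kz Kz' rho0 zrho small.
pose E t := exp (1 * M t z + e * t).
case: (rateX Kz) => cM M0 Ux dM.
have two t : 0 <= t -> vnorm (vsub (X t z') (X t z)) <=
    2 * vnorm (PiB (vsub (X t z') (X t z))).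
  by move=> t0; have := vnorm_le_AB (vsub (X t z') (X t z)); have := coneX Kz Kz' t0; lra.
suff H t : 0 <= t <= T -> vnorm (PiB (vsub (X t z') (X t z))) <= rho * E t.
  move=> t tT; have := H t tT; have := two t ltac:(lra).
  by rewrite /E Rmult_1_l; lra.
apply: (gronwall (v := fun t => PiB (vsub (X t z') (X t z)))
  (v' := fun t j => F (X t z') (inr j) - F (X t z) (inr j)) (a := fun t => mu (X t z) + e)
  (psi := fun=> 0) (kappa := fun t => 1 * mu (X t z) + e) (K := 2 * Lip + e)) => //.
- by move=> j; apply: ctn_minus; exact: ctnX.
- exact: ctn_weight.
- move=> s sT; apply: exp_ge1; have := M_ge0 Kz (proj1 sT); nra.
- rewrite /E M0 Rmult_0_r Rmult_0_r Rplus_0_r exp_0 Rmult_1_r.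
  by rewrite (eq_vnorm (v := vsub z' z)) // => j; rewrite /PiB /vsub !X0.
move=> s sT near; have Us := Ux s ltac:(lra); have Us' := UX Kz' (t := s) ltac:(lra).
have m0 := mu_ge0 dom Us; have m1 := mu_le_Lip dom Us.
set D := vsub (X s z') (X s z) in near *.
have DE : vnorm D <= e / (2 * Lip).
  apply: Rle_trans (two s ltac:(lra)) _; apply: Rle_trans small.
  have : E s <= exp (M T z + e * T).
    by apply: exp_le; have := M_mono Kz (s := s) (t := T) ltac:(lra); nra.
  by rewrite -/D; nra.
have w0 := vnorm_ge0 (PiB D).
do 4 (split; first by [move=> j; apply: derivable_pt_lim_minus; apply: dX => //; lra
  | apply: derivable_weight; apply: dM; lra | lra]).
split; first by lra.
rewrite Rmult_0_l Rplus_0_r.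
pose Rm j := F (X s z') j - F (X s z) j - jac F (X s z) D j.
have -> : inner (PiB D) (fun j => F (X s z') (inr j) - F (X s z) (inr j)) =
    inner (PiB D) (PiB (jac F (X s z) D)) + inner (PiB D) (PiB Rm).
  by rewrite -innerDr; apply: eq_vsum => j; rewrite {4}/PiB /Rm /PiB; ring.
have h1 := mu_cone dom Us (coneX Kz Kz' (t := s) ltac:(lra)).
have h2 := inner_le (PiB D) (PiB Rm).
have h3 : vnorm (PiB Rm) <= e * vnorm (PiB D).
  apply: Rle_trans (vnorm_PiB _) _; apply: Rle_trans (dm_taylor dom Us Us') _.
  rewrite -/D; have := two s ltac:(lra); rewrite -/D => Dw.
  have : Lip * vnorm D <= e / 2.
    have := Rmult_le_compat_l _ _ _ (Rlt_le _ _ Lip0) DE.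
    by have -> : Lip * (e / (2 * Lip)) = e / 2 by field; lra.
  by have := vnorm_ge0 D; nra.
by rewrite -/D in h1; nra.
Qed.

Lemma small_rho e z T : 0 < e -> K z -> exists s1, 0 < s1 /\ forall s, Rabs s < s1 ->
  4 * Rabs s * exp (M T z + e * T) <= e / (2 * Lip).
Proof.
move=> e0 Kz; have E0 := exp_pos (M T z + e * T).
have d0 : 0 < e / (2 * Lip) by apply: Rdiv_lt_0_compat; lra.
exists (e / (2 * Lip) / (4 * exp (M T z + e * T))); split.
  by apply: Rdiv_lt_0_compat => //; lra.
move=> s ss.
have := Rmult_lt_compat_r (4 * exp (M T z + e * T)) _ _ ltac:(lra) ss.
have -> : e / (2 * Lip) / (4 * exp (M T z + e * T)) * (4 * exp (M T z + e * T)) =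
  e / (2 * Lip) by field; lra.
by lra.
Qed.

Lemma luc_X_vec e z T : K z -> 0 < e -> exists d, 0 < d /\
  forall z' t, K z' -> vnorm (vsub z' z) < d -> 0 <= t <= T ->
    vnorm (vsub (X t z') (X t z)) <= e.
Proof.
move=> Kz e0.
have [s1 [s10 H]] := small_rho T Rlt_0_1 Kz.
have E0 := exp_pos (M T z + 1 * T).
set d := e / (2 * exp (M T z + 1 * T)).
have d0 : 0 < d by apply: Rdiv_lt_0_compat; lra.
set rho := Rmin s1 d / 2.
have mp := Rmin_pos _ _ s10 d0.
have rho0 : 0 < rho by rewrite /rho; lra.
have r1 : rho < s1 by rewrite /rho; have := Rmin_l s1 d; lra.
have r2 : rho < d by rewrite /rho; have := Rmin_r s1 d; lra.
exists rho; split=> // z' t Kz' zz' tT.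
have sm : 4 * rho * exp (M T z + 1 * T) <= 1 / (2 * Lip).
  by have := H rho; rewrite Rabs_pos_eq; [exact | lra].
have := near_orbit Rlt_0_1 Kz Kz' rho0 (Rlt_le _ _ zz') sm tT.
have : exp (M t z + 1 * t) <= exp (M T z + 1 * T).
  by apply: exp_le; have := M_mono Kz tT; lra.
have : d * (2 * exp (M T z + 1 * T)) = e by rewrite /d; field; lra.
have := exp_pos (M t z + 1 * t); nra.
Qed.

Lemma luc_X j : luc K (fun t z => X t z j).
Proof.
move=> z Kz T e e0; have [d [d0 H]] := luc_X_vec T Kz (e := e / 2) ltac:(lra).
exists d; split=> // z' t Kz' zd tT.
have := vnorm_comp (vsub (X t z') (X t z)) j; have := H z' t Kz' zd tT.
by rewrite {2}/vsub; lra.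
Qed.

(** Since [mu] has Lipschitz constant 2 Lip, the distance e / (2 Lip) changes the growth rate by at
    most e; growth weights of neighbouring orbits become comparable. *)
Lemma M_near e z z' T : K z -> K z' ->
  (forall t, 0 <= t <= T -> vnorm (vsub (X t z') (X t z)) <= e / (2 * Lip)) ->
  forall t, 0 <= t <= T -> M t z' <= M t z + e * t.
Proof.
move=> Kz Kz' near t tT.
case: (rateX Kz) => cM M0 Ux dM; case: (rateX Kz') => cM' M0' Ux' dM'.
case: (Req_dec t 0) => [->|t0]; first by rewrite M0 M0'; lra.
have [s [l [st [dl E]]]] : exists s l, 0 < s < t /\
    derivable_pt_lim (fun t => M t z' - M t z) s l /\
    (M t z' - M t z) - (M 0 z' - M 0 z) = l * (t - 0).
  apply: (mvt_ctn (u := fun t => M t z' - M t z)); [exact: ctn_minus | lra | move=> s st].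
  exists (mu (X s z') - mu (X s z)).
  by apply: derivable_pt_lim_minus; [apply: dM'; lra | apply: dM; lra].
have dMs := derivable_pt_lim_minus _ _ _ _ _ (dM' s ltac:(lra)) (dM s ltac:(lra)).
have El := uniqueness_limite _ _ _ _ dl dMs.
have := mu_lip dom (Ux s ltac:(lra)) (Ux' s ltac:(lra)).
have := Rmult_le_compat_l (2 * Lip) _ _ ltac:(lra) (near s ltac:(lra)).
have -> : 2 * Lip * (e / (2 * Lip)) = e by field; lra.
by move: E; rewrite M0 M0' El; nra.
Qed.

Lemma grow_near q p e : 0 < e -> grow K M q p -> exists C, 0 < C /\ forall z z' T,
  K z -> K z' ->
  (forall t, 0 <= t <= T -> vnorm (vsub (X t z') (X t z)) <= e / (2 * Lip)) ->
  forall t, 0 <= t <= T -> Rabs (p t z') <= C * exp (INR q * M t z + (INR q + 1) * e * t).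
Proof.
move=> e0 gp; have [C [C0 H]] := gp e e0; exists C; split=> // z z' T Kz Kz' near t tT.
apply: Rle_trans (H z' t Kz' (proj1 tT)) _; apply: Rmult_le_compat_l; first lra.
apply: exp_le; have := M_near Kz Kz' near tT; have := pos_INR q; nra.
Qed.

Lemma tame_vec q (Y : R -> vec B -> vec (A + B)%type) e z T :
  (forall j, tame q (fun t z => Y t z j)) -> K z -> 0 < e -> exists d, 0 < d /\
  forall z' t, K z' -> vnorm (vsub z' z) < d -> 0 <= t <= T ->
    vnorm (vsub (Y t z') (Y t z)) <= e.
Proof.
move=> tY Kz e0; set N := vsum (fun _ : (A + B)%type => 1).
have N0 : 0 <= N by apply: vsum_ge0 => _; lra.
have e10 : 0 < e / (N + 1) by apply: Rdiv_lt_0_compat; lra.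
have [d [d0 H]] := fin_min (P := fun j d => forall z' t, K z' -> vnorm (vsub z' z) < d ->
    0 <= t <= T -> Rabs (Y t z' j - Y t z j) < e / (N + 1))
  (fun i d d' H dd' z' t Kz' zd => H z' t Kz' ltac:(lra))
  (fun j => let: And3 _ l _ := tY j in l z Kz T _ e10).
exists d; split=> // z' t Kz' zd tT.
apply: Rle_trans (vnorm_le_card (fun j => Rlt_le _ _ (H j z' t Kz' zd tT))) _; rewrite -/N.
have -> : N * (e / (N + 1)) = e * (N / (N + 1)) by field; lra.
have : N / (N + 1) <= 1 by apply/Rle_div_l; lra.
by nra.
Qed.

(** The common core of first and higher derivatives. The quotients converge by [limit_solution], and
    their limit is the derivative. Its continuity in z is a second use of [slow_small], now for the
    difference of the derivatives at z' and z. *)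
Lemma dz_of_limit i q (Y P0 : R -> vec B -> vec (A + B)%type)
    (Phi : vec B -> R -> R -> vec (A + B)%type) (w0 : vec B) q' :
  let eta z s t j := (Y t (vshift z i s) j - Y t z j) / s in
  (1 <= q <= r)%N ->
  (forall z j k, K z -> ctn (fun t => pderiv (fun y => F y j) k (X t z))) ->
  (forall z, K z -> exists s0, 0 < s0 /\ forall s T, 0 < Rabs s < s0 ->
    linsol (F := F) (fun t => X t z) (eta z s) (Phi z s) T /\
    forall j, eta z s 0 (inr j) = w0 j) ->
  (forall z j, K z -> ucv (fun s t => Phi z s t j) (fun t => P0 t z j)) ->
  (forall e, 0 < e -> exists C, 0 < C /\ forall z T, K z -> exists s1, 0 < s1 /\
    forall s t, 0 < Rabs s < s1 -> 0 <= t <= T ->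
    vnorm (eta z s t) <= C * exp (INR q * M t z + e * t)) ->
  (forall j, tame q' (fun t z => P0 t z j)) ->
  let Y' t z j := dz i (fun t z => Y t z j) t z in
  [/\ forall j, has_dz K i (fun t z => Y t z j),
      forall j, tame q (fun t z => Y' t z j),
      forall z T, K z -> linsol (F := F) (fun t => X t z) (fun t => Y' t z) (fun t => P0 t z) T
    & forall z j, K z -> Y' 0 z (inr j) = w0 j].
Proof.
move=> eta /andP[q1 qr] cA lin PhiL grw tP0 Y'.
have q1' : 1 <= INR q by have /leP/le_INR := q1.
have qr' : INR q <= INR r by have /leP/le_INR := qr.
have lim z : K z -> exists L : R -> vec (A + B)%type,
    (forall T nu, 0 < nu -> exists s1, 0 < s1 /\ forall s t, 0 < Rabs s < s1 ->
      0 <= t <= T -> vnorm (vsub (eta z s t) (L t)) <= nu) /\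
    (forall T, linsol (F := F) (fun t => X t z) L (fun t => P0 t z) T) /\
    forall j, L 0 (inr j) = w0 j.
  move=> Kz; have [s0 [s00 Hs0]] := lin z Kz.
  have [C [C0 HC]] := grw (cr / 2) ltac:(lra).
  apply: (limit_solution dom (rateX Kz) (s0 := s0) (C := C) (Phi := Phi z)) => //.
  - by move=> j k; exact: cA.
  - by move=> s T ss; case: (Hs0 s T ss).
  - by move=> s j ss; case: (Hs0 s 0 ss).
  - exact: (ucv_vnorm (u := Phi z) (v := fun t => P0 t z) (fun j => PhiL z j Kz)).
  - move=> T; have [s1 [s10 H1]] := HC z T Kz; exists s1; split=> // s t ss tT.
    apply: Rle_trans (H1 s t ss tT) _; apply: Rmult_le_compat_l; first lra.
    by apply: exp_le; have := M_ge0 Kz (proj1 tT); nra.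
  - by move=> j; case: (tP0 j) => _ _; exact.
have dY z t j (L : R -> vec (A + B)%type) : K z -> 0 <= t ->
    (forall T nu, 0 < nu -> exists s1, 0 < s1 /\ forall s t, 0 < Rabs s < s1 ->
      0 <= t <= T -> vnorm (vsub (eta z s t) (L t)) <= nu) ->
    derivable_pt_lim (fun s => Y t (vshift z i s) j) 0 (L t j).
  move=> Kz t0 HL e e0; have [s1 [s10 H1]] := HL t (e / 2) ltac:(lra).
  exists (mkposreal s1 s10) => h h0 /= hs.
  have := H1 h t (conj (Rabs_pos_lt _ h0) hs) ltac:(lra).
  have := vnorm_comp (vsub (eta z h t) (L t)) j.
  by rewrite Rplus_0_l vshift0 {1}/vsub /eta; lra.
have Y'L z : K z -> exists L : R -> vec (A + B)%type,
    [/\ forall t j, 0 <= t -> L t j = Y' t z j,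
      forall T nu, 0 < nu -> exists s1, 0 < s1 /\ forall s t, 0 < Rabs s < s1 ->
        0 <= t <= T -> vnorm (vsub (eta z s t) (L t)) <= nu,
      forall T, linsol (F := F) (fun t => X t z) L (fun t => P0 t z) T &
      forall j, L 0 (inr j) = w0 j].
  move=> Kz; have [L [HL [linL L0]]] := lim z Kz; exists L; split=> // t j t0.
  by symmetry; apply: pderiv_eq; exact: dY.
have linY' z T : K z ->
    linsol (F := F) (fun t => X t z) (fun t => Y' t z) (fun t => P0 t z) T.
  by move=> Kz; have [L [LY' _ linL _]] := Y'L z Kz; exact: eq_linsol LY' (linL T).
have Y'0 z j : K z -> Y' 0 z (inr j) = w0 j.
  by move=> Kz; have [L [LY' _ _ L0]] := Y'L z Kz; rewrite -LY'; [exact: L0 | lra].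
have growY' e : 0 < e -> exists C, 0 < C /\ forall z t, K z -> 0 <= t ->
    vnorm (Y' t z) <= C * exp (INR q * M t z + e * t).
  move=> e0; have [C [C0 HC]] := grw e e0; exists C; split=> // z t Kz t0.
  have [L [LY' HL _ _]] := Y'L z Kz.
  rewrite -(eq_vnorm (u := L t)) => [|j]; last exact: LY'.
  apply: le_epsilon => nu nu0.
  have [s1 [s10 H1]] := HC z t Kz; have [s2 [s20 H2]] := HL t nu nu0.
  have mp := Rmin_pos _ _ s10 s20; set s := Rmin s1 s2 / 2.
  have sE : Rabs s = s by rewrite Rabs_pos_eq /s; lra.
  have sa : 0 < Rabs s < s1 by rewrite sE /s; have := Rmin_l s1 s2; lra.
  have sb : 0 < Rabs s < s2 by rewrite sE /s; have := Rmin_r s1 s2; lra.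
  have h1 := H1 s t sa ltac:(lra); have h2 := H2 s t sb ltac:(lra).
  have := vnorm_triangB (eta z s t) (vsub (eta z s t) (L t)).
  rewrite (eq_vnorm (v := L t)) => [|j]; last by rewrite /vsub; ring.
  by lra.
have lucY' z T nu : K z -> 0 < nu -> exists d, 0 < d /\ forall z' t, K z' ->
    vnorm (vsub z' z) < d -> 0 <= t <= T -> vnorm (vsub (Y' t z') (Y' t z)) <= nu.
  move=> Kz nu0; set T0 := Rmax 0 T; have T00 : 0 <= T0 := Rmax_l 0 T.
  (* Moving the growth bound from the orbit of z' to that of z turns e into (q + 1) e, which must
     fit into cr / 2. *)
  set e := cr / 2 / (INR q + 1).
  have e0 : 0 < e by apply: Rdiv_lt_0_compat; lra.
  have eE : (INR q + 1) * e = cr / 2 by rewrite /e; field; lra.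
  have [C [C0 HC]] := growY' e e0.
  have [Tb [sg [TT [sg0 HS]]]] := slow_small dom (C := 2 * C) (rateX Kz) ltac:(lra) nu0 T00.
  set W := C * exp (INR r * M Tb z + cr / 2 * Tb).
  have W0 : 0 < W by apply: Rmult_lt_0_compat => //; exact: exp_pos.
  have [d1 [d10 H1]] := tame_vec Tb tP0 Kz (e := sg / 2) ltac:(lra).
  have m0 : 0 < Rmin (e / (2 * Lip)) (sg / (2 * Lip * W)).
    by apply: Rmin_pos; apply: Rdiv_lt_0_compat; nra.
  have [d2 [d20 H2]] := luc_X_vec Tb Kz m0.
  exists (Rmin d1 d2); split; first exact: Rmin_pos.
  move=> z' t Kz' zd tT.
  have zd1 := Rlt_le_trans _ _ _ zd (Rmin_l _ _).
  have zd2 := Rlt_le_trans _ _ _ zd (Rmin_r _ _).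
  have near u : 0 <= u <= Tb -> vnorm (vsub (X u z') (X u z)) <= e / (2 * Lip).
    by move=> uT; apply: Rle_trans (H2 z' u Kz' zd2 uT) (Rmin_l _ _).
  have bY u : 0 <= u <= Tb -> vnorm (Y' u z') <= C * exp (INR r * M u z + cr / 2 * u).
    move=> uT; apply: Rle_trans (HC z' u Kz' (proj1 uT)) _.
    apply: Rmult_le_compat_l; first lra; apply: exp_le.
    have := M_near Kz Kz' near uT; have := M_ge0 Kz (proj1 uT).
    have -> : cr / 2 * u = INR q * (e * u) + e * u by rewrite -eE; ring.
    by nra.
  (* The comparison runs along the orbit of z; the change of the Jacobian, applied to the derivative
     at z', joins the forcing. *)
  pose Ph t j := P0 t z' j - P0 t z j + (jac F (X t z') (Y' t z') j - jac F (X t z) (Y' t z') j).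
  apply: (HS (fun t => vsub (Y' t z') (Y' t z)) Ph).
  - have [ce' de'] := linY' z' Tb Kz'; have [ce de] := linY' z Tb Kz.
    split=> [j|u uT j]; first exact: ctn_minus.
    have -> : jac F (X u z) (vsub (Y' u z') (Y' u z)) j + Ph u j =
      jac F (X u z') (Y' u z') j + P0 u z' j - (jac F (X u z) (Y' u z) j + P0 u z j).
      by rewrite /vsub jacB /Ph; ring.
    by apply: derivable_pt_lim_minus; [exact: de' | exact: de].
  - move=> u uT; apply: Rle_trans (vnorm_triang _ _) _.
    have h1 := H1 z' u Kz' zd1 ltac:(lra).
    have h2 := dm_jacLip dom (Y' u z') (UX Kz (t := u) ltac:(lra)) (UX Kz' (t := u) ltac:(lra)).
    have h3 := Rle_trans _ _ _ (H2 z' u Kz' zd2 ltac:(lra)) (Rmin_r _ _).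
    have h4 : vnorm (Y' u z') <= W.
      apply: Rle_trans (bY u ltac:(lra)) _; apply: Rmult_le_compat_l; first lra.
      apply: exp_le; have := M_mono Kz (s := u) (t := Tb) ltac:(lra).
      by have := pos_INR r; nra.
    have h5 : Lip * vnorm (vsub (X u z') (X u z)) * vnorm (Y' u z') <= sg / 2.
      have -> : sg / 2 = Lip * (sg / (2 * Lip * W)) * W by field; lra.
      apply: Rmult_le_compat => //; try exact: vnorm_ge0.
        by have := vnorm_ge0 (vsub (X u z') (X u z)); nra.
      by apply: Rmult_le_compat_l; lra.
    by rewrite /vsub in h1; lra.
  - rewrite (eq_vnorm (v := vzero)) ?vnorm0; first lra.
    by move=> j; rewrite /PiB /vsub !Y'0 // /vzero; ring.
  - have TbT : 0 <= Tb <= Tb by lra.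
    apply: Rle_trans (vnorm_PiA _) _; apply: Rle_trans (vnorm_triangB _ _) _.
    have := bY Tb TbT; have := HC z Tb Kz (proj1 TbT).
    have : exp (INR q * M Tb z + e * Tb) <= exp (INR r * M Tb z + cr / 2 * Tb).
      apply: exp_le; have := M_ge0 Kz (proj1 TbT).
      have -> : cr / 2 * Tb = INR q * (e * Tb) + e * Tb by rewrite -eE; ring.
      by have : 0 <= e * Tb by [nra]; nra.
    by nra.
  by split; [lra | apply: Rle_trans (proj2 tT) (Rmax_r _ _)].
split=> // j.
- move=> t z t0 Kz; have [L [HL _]] := lim z Kz; exists (L t j); exact: dY.
split.
- move=> e e0; have [C [C0 HC]] := growY' e e0; exists C; split=> // z t Kz t0.
  exact: Rle_trans (vnorm_comp (Y' t z) j) (HC z t Kz t0).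
- move=> z Kz T e e0; have [d [d0 H]] := lucY' z T (e / 2) Kz ltac:(lra).
  exists d; split=> // z' t Kz' zd tT.
  have := vnorm_comp (vsub (Y' t z') (Y' t z)) j; have := H z' t Kz' zd tT.
  by rewrite {2}/vsub; lra.
- by move=> z Kz; case: (linY' z 1 Kz).
Qed.

Hypothesis FC : CrV r U F.
Hypothesis FB : bounded_derivs 1 r U F.
Hypothesis r1 : (1 <= r)%N.

Let ctn_deriv z j l : K z -> (size l <= r)%N ->
  ctn (fun t => iter_pderiv (fun y => F y j) l (X t z)).
Proof.
move=> Kz lr; apply: (ctn_cont_on (x := fun t => X t z) (proj2 (FC j) l lr)).
  by move=> t; exact: UX.
by move=> k; exact: ctnX.
Qed.

Let ctnA z j k : K z -> ctn (fun t => pderiv (fun y => F y j) k (X t z)).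
Proof. by move=> Kz; exact: (ctn_deriv j (l := [:: k]) Kz). Qed.

(** At first order [near_orbit], divided by |s|, bounds the quotient directly. The forcing is the
    Taylor remainder over s, which is O(|s|) on every [0, T]. *)
Lemma orbit_dz i :
  let Y t z j := dz i (fun t z => X t z j) t z in
  [/\ forall j, has_dz K i (fun t z => X t z j),
      forall j, tame 1 (fun t z => Y t z j),
      forall z T, K z -> linsol (F := F) (fun t => X t z) (fun t => Y t z) (fun _ _ => 0) T
    & forall z j, K z -> Y 0 z (inr j) = delta i j].
Proof.
pose Rm z s t j := F (X t (vshift z i s)) j - F (X t z) j
  - jac F (X t z) (vsub (X t (vshift z i s)) (X t z)) j.
apply: (dz_of_limit (P0 := fun _ _ _ => 0) (q' := 0)
  (Phi := fun z s t j => Rm z s t j / s) (w0 := delta i)) => //.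
- move=> z Kz; have [s0 [s00 Ks]] := K_vshift openK i Kz.
  exists s0; split=> // s T [sp ss]; have Kzs := Ks s ss.
  have sn : s <> 0 by move=> s0'; rewrite s0' Rabs_R0 in sp; lra.
  split; last first.
    by move=> j; rewrite !X0 // /vshift /delta; case: (j == i); field.
  split=> [j|t tT j].
    apply: ctn_mult; last exact: ctn_const.
    by apply: ctn_minus; exact: ctnX.
  have -> : jac F (X t z) (fun j => (X t (vshift z i s) j - X t z j) / s) j + Rm z s t j / s =
    / s * (F (X t (vshift z i s)) j - F (X t z) j).
    rewrite (@eq_jac _ _ F _ _ (fun j => / s * vsub (X t (vshift z i s)) (X t z) j)); last first.
      by move=> k; rewrite /vsub; field.
    by rewrite jacZ /Rm; field.
  apply: (derivable_pt_lim_ext (u := fun t => / s * (X t (vshift z i s) j - X t z j))).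
    by move=> u; field.
  apply: derivable_pt_lim_scal; apply: derivable_pt_lim_minus; apply: dX => //; lra.
- move=> z j Kz T nu nu0.
  have [s0 [s00 Ks]] := K_vshift openK i Kz.
  have [s1 [s10 H1]] := small_rho T Rlt_0_1 Kz.
  set E := exp (M T z + 1 * T); have E0 : 0 < E := exp_pos _.
  have s20 : 0 < nu / (4 * Lip * E ^ 2).
    by apply: Rdiv_lt_0_compat => //; have := pow_lt E 2 E0; nra.
  have mp := Rmin_pos _ _ s00 (Rmin_pos _ _ s10 s20).
  exists (Rmin s0 (Rmin s1 (nu / (4 * Lip * E ^ 2)))); split=> // s t [sp sm] tT.
  have sa := Rlt_le_trans _ _ _ sm (Rmin_l _ _).
  have sm' := Rlt_le_trans _ _ _ sm (Rmin_r _ _).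
  have sb := Rlt_le_trans _ _ _ sm' (Rmin_l _ _).
  have sc := Rlt_le_trans _ _ _ sm' (Rmin_r _ _).
  have sn : s <> 0 by move=> s0'; rewrite s0' Rabs_R0 in sp; lra.
  have zs : vnorm (vsub (vshift z i s) z) <= Rabs s by rewrite vnorm_vshift; lra.
  have h1 := near_orbit Rlt_0_1 Kz (Ks s sa) sp zs (H1 s sb) tT.
  have h2 := dm_taylor dom (UX Kz (proj1 tT)) (UX (Ks s sa) (proj1 tT)).
  have h3 : exp (M t z + 1 * t) <= E by apply: exp_le; have := M_mono Kz tT; lra.
  rewrite Rminus_0_r Rabs_div //; apply/Rle_div_l => //.
  apply: Rle_trans (vnorm_comp (Rm z s t) j) _; apply: Rle_trans h2 _.
  have D2 : vnorm (vsub (X t (vshift z i s)) (X t z)) <= 2 * Rabs s * E by nra.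
  have := pow_incr _ _ 2 (conj (vnorm_ge0 _) D2) => D3.
  apply: Rle_trans (Rmult_le_compat_l _ _ _ (Rlt_le _ _ Lip0) D3) _.
  have -> : Lip * (2 * Rabs s * E) ^ 2 = (Rabs s * (4 * Lip * E ^ 2)) * Rabs s by ring.
  apply: Rmult_le_compat_r; first lra.
  have P0 : 0 < 4 * Lip * E ^ 2 by have := pow_lt E 2 E0; nra.
  have := Rmult_lt_compat_r _ _ _ P0 sc.
  have -> : nu / (4 * Lip * E ^ 2) * (4 * Lip * E ^ 2) = nu by field; lra.
  by lra.
- move=> e e0; exists 2; split; first lra; move=> z T Kz.
  have [s0 [s00 Ks]] := K_vshift openK i Kz.
  have [s1 [s10 H1]] := small_rho T e0 Kz.
  exists (Rmin s0 s1); split; first exact: Rmin_pos.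
  move=> s t [sp sm] tT.
  have sa := Rlt_le_trans _ _ _ sm (Rmin_l _ _).
  have sb := Rlt_le_trans _ _ _ sm (Rmin_r _ _).
  have sn : s <> 0 by move=> s0'; rewrite s0' Rabs_R0 in sp; lra.
  have zs : vnorm (vsub (vshift z i s) z) <= Rabs s by rewrite vnorm_vshift; lra.
  have h1 := near_orbit e0 Kz (Ks s sa) sp zs (H1 s sb) tT.
  rewrite (eq_vnorm (v := fun j => / s * vsub (X t (vshift z i s)) (X t z) j)); last first.
    by move=> k; rewrite /vsub; field.
  rewrite vnormZ Rabs_inv -[INR 1]/1 Rmult_1_l.
  have := Rmult_le_compat_l _ _ _ (Rlt_le _ _ (Rinv_0_lt_compat _ sp)) h1.
  have -> : / Rabs s * (2 * Rabs s * exp (M t z + e * t)) = 2 * exp (M t z + e * t).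
    by field; lra.
  by [].
- by move=> j; exact: tame_const0.
Qed.

(* Up to time [Ts] the growth weights along nearby orbits are comparable, and at
   [Ts] the factor [1 / |s|] of a difference quotient is of the order of the
   weight [exp (M Ts z)], so that the quotient grows at most one order faster. *)
Lemma separation_time e z T : 0 < e -> K z -> exists s1, 0 < s1 /\ forall s, 0 < Rabs s < s1 ->
  exists Ts, T <= Ts /\ 0 <= Ts /\ 4 * Rabs s * exp (M Ts z + e * Ts) = e / (2 * Lip).
Proof.
move=> e0 Kz; case: (rateX Kz) => cM M0 _ _.
have [s1 [s10 H1]] := small_rho (Rmax 0 T) e0 Kz.
have d0 : 0 < e / (2 * Lip) by apply: Rdiv_lt_0_compat; lra.
exists s1; split=> // s [sp ss].
have small := H1 s ss.
pose f t := 4 * Rabs s * exp (1 * M (Rmax 0 t) z + e * Rmax 0 t) - e / (2 * Lip).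
have cf : continuity f.
  move=> t; apply: continuity_pt_minus; last exact: continuity_pt_const.
  apply: continuity_pt_mult; first exact: continuity_pt_const.
  exact: (ctn_weight 1 e cM).
have mono u v : 0 <= u <= v -> f u <= f v.
  move=> uv; rewrite /f !Rmax_right; [|lra..].
  have : exp (1 * M u z + e * u) <= exp (1 * M v z + e * v).
    by apply: exp_le; have := M_mono Kz uv; nra.
  by nra.
have fT : f (Rmax 0 T) <= 0.
  by rewrite /f Rmax_right ?Rmult_1_l; [lra | exact: Rmax_l].
(* At y the linear lower bound of the exponential already exceeds the target, so the intermediate
   value theorem applies below y. *)
set y := Rmax 0 T + (e / (2 * Lip)) / (4 * Rabs s) / e.
have y0 : Rmax 0 T <= y.
  have : 0 < e / (2 * Lip) / (4 * Rabs s) / e.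
    by apply: Rdiv_lt_0_compat => //; apply: Rdiv_lt_0_compat; lra.
  by rewrite /y; lra.
have m0 := Rmax_l 0 T.
have fy : 0 < f y.
  rewrite /f Rmax_right; last lra.
  have h := exp_ineq1_le (1 * M y z + e * y).
  have : e * y >= e / (2 * Lip) / (4 * Rabs s).
    rewrite /y Rmult_plus_distr_l.
    have -> : e * (e / (2 * Lip) / (4 * Rabs s) / e) = e / (2 * Lip) / (4 * Rabs s).
      by field; lra.
    by nra.
  have := M_ge0 Kz (t := y) ltac:(lra) => My h2.
  have h3 : e / (2 * Lip) / (4 * Rabs s) < exp (1 * M y z + e * y) by lra.
  have := Rmult_lt_compat_l (4 * Rabs s) _ _ ltac:(lra) h3.
  have -> : 4 * Rabs s * (e / (2 * Lip) / (4 * Rabs s)) = e / (2 * Lip) by field; lra.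
  by lra.
have [u [uy fu]] : exists u, Rmax 0 T <= u <= y /\ f u = 0.
  have [u [uy fu]] := IVT_cor f (Rmax 0 T) y cf y0 ltac:(nra).
  by exists u.
exists u; split; first by have := Rmax_r 0 T; lra.
split; first lra.
by move: fu; rewrite /f Rmax_right ?Rmult_1_l; lra.
Qed.

Lemma grow_near_fam {J : finType} q (p : J -> R -> vec B -> R) e : 0 < e ->
  (forall j, tame q (p j)) -> exists C, 0 < C /\ forall j z z' T, K z -> K z' ->
  (forall t, 0 <= t <= T -> vnorm (vsub (X t z') (X t z)) <= e / (2 * Lip)) ->
  forall t, 0 <= t <= T -> Rabs (p j t z') <= C * exp (INR q * M t z + (INR q + 1) * e * t).
Proof.
move=> e0 tp; apply: (fin_max (P := fun j C => forall z z' T, K z -> K z' ->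
  (forall t, 0 <= t <= T -> vnorm (vsub (X t z') (X t z)) <= e / (2 * Lip)) ->
  forall t, 0 <= t <= T -> Rabs (p j t z') <= C * exp (INR q * M t z + (INR q + 1) * e * t))).
  move=> j C C' H CC' z z' T Kz Kz' near t tT.
  apply: Rle_trans (H z z' T Kz Kz' near t tT) _.
  by apply: Rmult_le_compat_r => //; left; exact: exp_pos.
move=> j; have [gp _ _] := tp j; have [C [_ H]] := grow_near e0 gp.
by exists C.
Qed.

Lemma ucv_quotient i q p z : smooth 1 q p -> K z ->
  ucv (fun s t => (p t (vshift z i s) - p t z) / s) (fun t => dz i p t z).
Proof.
move=> sp Kz T nu nu0.
have [d [d0 H]] := quotient_cvg (M := M) openK i T sp Kz nu0.
by exists d; split=> // s t sd tT; left; exact: H.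
Qed.

Lemma ucv_shift i q p z : tame q p -> K z ->
  ucv (fun s t => p t (vshift z i s)) (fun t => p t z).
Proof.
move=> [_ lp _] Kz T nu nu0; have [d [d0 H]] := lp z Kz T nu nu0.
have [s0 [s00 Ks]] := K_vshift openK i Kz.
exists (Rmin d s0); split; first exact: Rmin_pos.
move=> s t [_ sm] tT; left; apply: H => //.
  by apply: Ks; apply: Rlt_le_trans sm (Rmin_r _ _).
by rewrite vnorm_vshift; apply: Rlt_le_trans sm (Rmin_l _ _).
Qed.

(** The differentiated equation. The trivial bound of the quotient by (|Y(z_s)| + |Y(z)|) / |s|,
    with z_s the shifted point, is imposed at the separation time [Ts]; [growth_bound] on [0, Ts]
    turns it into growth of order q + 1, with a constant independent of s and T. *)
Lemma linsol_dz i q (Y P : R -> vec B -> vec (A + B)%type) w0 :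
  let a j k t z := pderiv (fun y => F y j) k (X t z) in
  let Y' t z j := dz i (fun t z => Y t z j) t z in
  let P' t z j := vsum (fun k => dz i (a j k) t z * Y t z k) + dz i (fun t z => P t z j) t z in
  (1 <= q < r)%N ->
  (forall j k, smooth 1 0 (a j k)) ->
  (forall j, tame q (fun t z => Y t z j)) -> (forall j, smooth 1 q (fun t z => P t z j)) ->
  (forall z T, K z -> linsol (F := F) (fun t => X t z) (fun t => Y t z) (fun t => P t z) T) ->
  (forall z j, K z -> Y 0 z (inr j) = w0 j) ->
  [/\ forall j, has_dz K i (fun t z => Y t z j),
      forall j, tame q.+1 (fun t z => Y' t z j),
      forall z T, K z -> linsol (F := F) (fun t => X t z) (fun t => Y' t z) (fun t => P' t z) T
    & forall z j, K z -> Y' 0 z (inr j) = 0].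
Proof.
move=> a Y' P' /andP[q1 qr] sa tY sP linY Y0.
have tP j : tame q (fun t z => P t z j) := smooth_tame (sP j).
have ta' j k : tame 1 (dz i (a j k)) by case: (sa j k) => _ /(_ i)[_ []].
have tP' j : tame q.+1 (dz i (fun t z => P t z j)).
  by case: (sP j) => _ /(_ i)[_ []].
(* The discrete product rule: A(z_s) Y(z_s) - A(z) Y(z) = A(z) (Y(z_s) - Y(z)) + (A(z_s) - A(z))
   Y(z_s). *)
pose Phi z s t j := vsum (fun k => (a j k t (vshift z i s) - a j k t z) / s * Y t (vshift z i s) k)
  + (P t (vshift z i s) j - P t z j) / s.
have linEta z s T : K z -> s <> 0 -> K (vshift z i s) ->
    linsol (F := F) (fun t => X t z) (fun t j => (Y t (vshift z i s) j - Y t z j) / s)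
      (Phi z s) T.
  move=> Kz sn Kzs.
  have [ce de] := linY z T Kz; have [ce' de'] := linY _ T Kzs.
  split=> [j|t tT j].
    by apply: ctn_mult; [exact: ctn_minus | exact: ctn_const].
  have E1 : vsum (fun k => (a j k t (vshift z i s) - a j k t z) / s * Y t (vshift z i s) k) =
    (jac F (X t (vshift z i s)) (Y t (vshift z i s)) j
      - jac F (X t z) (Y t (vshift z i s)) j) / s.
    by rewrite /jac -vsumB [RHS]/Rdiv -vsumZr; apply: eq_vsum => k; rewrite /a; field.
  have -> : jac F (X t z) (fun j => (Y t (vshift z i s) j - Y t z j) / s) j + Phi z s t j =
    / s * (jac F (X t (vshift z i s)) (Y t (vshift z i s)) j + P t (vshift z i s) j
      - (jac F (X t z) (Y t z) j + P t z j)).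
    rewrite (@eq_jac _ _ F _ _ (fun j => / s * (Y t (vshift z i s) j - Y t z j))); last first.
      by move=> k; field.
    by rewrite jacZ jacB /Phi E1; field.
  apply: (derivable_pt_lim_ext (u := fun t => / s * (Y t (vshift z i s) j - Y t z j))).
    by move=> u; field.
  by apply: derivable_pt_lim_scal; apply: derivable_pt_lim_minus; [exact: de' | exact: de].
apply: (dz_of_limit (Phi := Phi) (w0 := fun=> 0) (q' := q.+1)); first by rewrite ltnS.
- exact: ctnA.
- move=> z Kz; have [s0 [s00 Ks]] := K_vshift openK i Kz.
  exists s0; split=> // s T [sp ss]; have Kzs := Ks s ss.
  have sn : s <> 0 by move=> s0'; rewrite s0' Rabs_R0 in sp; lra.
  split; last by move=> j; rewrite !Y0 //; field.
  exact: linEta.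
- move=> z j Kz; apply: ucv_plus; last exact: ucv_quotient (sP j) Kz.
  apply: (ucv_vsum (u := fun k s t => (a j k t (vshift z i s) - a j k t z) / s * Y t (vshift z i s) k)
    (v := fun k t => dz i (a j k) t z * Y t z k)) => k.
  apply: ucv_mult; [exact: ucv_quotient (sa j k) Kz | exact: ucv_shift (tY k) Kz | |] => T.
    exact: tame_bounded (ta' j k) Kz.
  exact: tame_bounded (tY k) Kz.
- move=> e0 e00; set e := Rmin e0 (cr / 2).
  have ep : 0 < e by apply: Rmin_pos; lra.
  have ee0 : e <= e0 := Rmin_l _ _; have ecr : e <= cr / 2 := Rmin_r _ _.
  have q0 := pos_INR q.
  (* The product in the forcing loses 2 e1 from its first factor and (q + 1) e1 from its second, the
     largest loss below. *)
  set e1 := e / (INR q + 3).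
  have e10 : 0 < e1 by apply: Rdiv_lt_0_compat; lra.
  have e1E : (INR q + 3) * e1 = e by rewrite /e1; field; lra.
  have [Kg [Kg0 HKg]] := growth_bound dom (conj ep ecr).
  have [CY [CY0 HY]] := grow_near_fam (p := fun k t z => Y t z k) e10 tY.
  have [CA [CA0 HA]] := grow_near_fam (p := fun jk : (A + B) * (A + B) => dz i (a jk.1 jk.2))
    e10 (fun jk => ta' jk.1 jk.2).
  have [CP [CP0 HP]] := grow_near_fam (p := fun j => dz i (fun t z => P t z j)) e10 tP'.
  set N := vsum (fun _ : (A + B)%type => 1).
  have N0 : 0 <= N by apply: vsum_ge0 => _; lra.
  set C1 := N * (N * (CA * CY) + CP).
  (* At [Ts], 1 / |s| is 8 Lip / e1 times the weight, and the two values of Y contribute the factor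
     2 N CY. *)
  set C2 := 16 * Lip * N * CY / e1.
  have C10 : 0 <= C1 by rewrite /C1; have : 0 <= CA * CY by [nra]; nra.
  have C20 : 0 <= C2 by apply: Rdiv_le_0_compat => //; have : 0 <= Lip * N by [nra]; nra.
  set C := C1 + C2 + 1.
  have C0 : 0 < C by rewrite /C; lra.
  exists (Kg * C); split; first nra.
  move=> z T Kz.
  have [s0 [s00 Ks]] := K_vshift openK i Kz.
  have [s1 [s10 H1]] := separation_time T e10 Kz.
  exists (Rmin s0 s1); split; first exact: Rmin_pos.
  move=> s t [sp sm] tT.
  have sa' := Rlt_le_trans _ _ _ sm (Rmin_l _ _).
  have [Ts [TTs [Ts0 HTs]]] := H1 s (conj sp (Rlt_le_trans _ _ _ sm (Rmin_r _ _))).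
  have sn : s <> 0 by move=> s0'; rewrite s0' Rabs_R0 in sp; lra.
  have Ks' s' : Rabs s' <= Rabs s -> K (vshift z i s') by move=> ?; apply: Ks; lra.
  have near s' : Rabs s' <= Rabs s -> forall u, 0 <= u <= Ts ->
      vnorm (vsub (X u (vshift z i s')) (X u z)) <= e1 / (2 * Lip).
    move=> ss' u uT; have zs : vnorm (vsub (vshift z i s') z) <= Rabs s by rewrite vnorm_vshift.
    have := near_orbit e10 Kz (Ks' s' ss') sp zs (Req_le _ _ HTs) uT.
    have : exp (M u z + e1 * u) <= exp (M Ts z + e1 * Ts).
      by apply: exp_le; have := M_mono Kz uT; nra.
    by have := exp_pos (M u z + e1 * u); nra.
  have near0 u : 0 <= u <= Ts -> vnorm (vsub (X u z) (X u z)) <= e1 / (2 * Lip).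
    by move=> uT; have := near 0; rewrite vshift0 Rabs_R0; apply => //; lra.
  pose E u := exp (INR q.+1 * M u z + e * u).
  have PhiE u : 0 < u < Ts -> vnorm (Phi z s u) <= C * E u.
    move=> uT; have uT' : 0 <= u <= Ts by lra.
    have E0 : 0 < E u := exp_pos _.
    suff Hj j : Rabs (Phi z s u j) <= (N * (CA * CY) + CP) * E u.
      apply: Rle_trans (vnorm_le_card Hj) _; rewrite -/N -Rmult_assoc -/C1.
      by apply: Rmult_le_compat_r; [lra | rewrite /C; lra].
    apply: Rle_trans (Rabs_triang _ _) _; rewrite Rmult_plus_distr_r.
    apply: Rplus_le_compat.
      apply: Rle_trans (vsum_Rabs _) _; rewrite /N Rmult_assoc -vsumZr.
      apply: vsum_le => k; rewrite Rmult_1_l.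
      have da : has_dz K i (a j k) by case: (sa j k) => _ /(_ i)[].
      have [s' [ss' ->]] := mvt_dz da (proj1 uT') Ks'.
      have -> : s * dz i (a j k) u (vshift z i s') / s = dz i (a j k) u (vshift z i s') by field.
      have hA := HA (j, k) z _ Ts Kz (Ks' s' ss') (near s' ss') u uT'.
      have hY := HY k z _ Ts Kz (Ks' s (Rle_refl _)) (near s (Rle_refl _)) u uT'.
      rewrite Rabs_mult.
      apply: Rle_trans (Rmult_le_compat _ _ _ _ (Rabs_pos _) (Rabs_pos _) hA hY) _.
      have -> : forall x y, CA * x * (CY * y) = CA * CY * (x * y) by move=> *; ring.
      apply: Rmult_le_compat_l; first nra.
      by rewrite -exp_plus; apply: exp_le; rewrite (S_INR q) -e1E -[INR 1]/1; lra.
    have dP : has_dz K i (fun t z => P t z j) by case: (sP j) => _ /(_ i)[].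
    have [s' [ss' ->]] := mvt_dz dP (proj1 uT') Ks'.
    have -> : s * dz i (fun t z => P t z j) u (vshift z i s') / s =
      dz i (fun t z => P t z j) u (vshift z i s') by field.
    apply: Rle_trans (HP j z _ Ts Kz (Ks' s' ss') (near s' ss') u uT') _.
    apply: Rmult_le_compat_l; first lra.
    apply: exp_le; rewrite (S_INR q) -e1E; have : 0 <= e1 * u by [nra]; nra.
  pose eta t j := (Y t (vshift z i s) j - Y t z j) / s.
  have etaT : vnorm (PiA (eta Ts)) <= C * E Ts.
    have TsT : 0 <= Ts <= Ts by lra.
    set G := exp (INR q * M Ts z + (INR q + 1) * e1 * Ts).
    have b1 : vnorm (Y Ts (vshift z i s)) <= N * (CY * G).
      apply: vnorm_le_card => k.
      exact: (HY k z _ Ts Kz (Ks' s (Rle_refl _)) (near s (Rle_refl _)) Ts TsT).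
    have b2 : vnorm (Y Ts z) <= N * (CY * G).
      apply: vnorm_le_card => k; exact: (HY k z _ Ts Kz Kz near0 Ts TsT).
    apply: Rle_trans (vnorm_PiA _) _.
    rewrite (eq_vnorm (v := fun j => / s * (Y Ts (vshift z i s) j - Y Ts z j))); last first.
      by move=> k; rewrite /eta; field.
    rewrite vnormZ Rabs_inv.
    set D := exp (M Ts z + e1 * Ts) in HTs.
    have sD : / Rabs s = 8 * Lip * D / e1.
      have : e1 = 8 * Lip * D * Rabs s.
        have := f_equal (Rmult (2 * Lip)) HTs.
        have -> : 2 * Lip * (e1 / (2 * Lip)) = e1 by field; lra.
        by move=> <-; ring.
      have D0 : 0 < D := exp_pos _.
      by move=> e1s; rewrite e1s; field; lra.
    have b3 := vnorm_triangB (Y Ts (vshift z i s)) (Y Ts z).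
    have i0 : 0 <= / Rabs s by left; exact: Rinv_0_lt_compat.
    have b4 : vnorm (fun j => Y Ts (vshift z i s) j - Y Ts z j) <= 2 * N * CY * G by lra.
    apply: Rle_trans (Rmult_le_compat_l _ _ _ i0 b4) _.
    rewrite sD.
    have -> : 8 * Lip * D / e1 * (2 * N * CY * G) = C2 * (D * G) by rewrite /C2; field; lra.
    have DG : D * G <= E Ts.
      rewrite /D /G /E -exp_plus; apply: exp_le; rewrite (S_INR q) -e1E.
      by have : 0 <= e1 * Ts by [nra]; nra.
    have DG0 : 0 < D * G by apply: Rmult_lt_0_compat; exact: exp_pos.
    by rewrite /C; nra.
  have w0C : vnorm (PiB (eta 0)) <= C.
    rewrite (eq_vnorm (v := vzero)) ?vnorm0; first lra.
    by move=> j; rewrite /PiB /eta !Y0 //; [rewrite /vzero; field | exact: (Ks s sa')].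
  have lin := linEta z s Ts Kz sn (Ks s sa').
  have qr' : (1 <= q.+1 <= r)%N by [].
  have := HKg q.+1 _ _ eta (Phi z s) Ts C qr' (rateX Kz) C0 Ts0 lin PhiE w0C etaT t.
  move=> /(_ ltac:(lra)) H; apply: Rle_trans H _.
  by apply: Rmult_le_compat_l; [nra | apply: exp_le; nra].
move=> j; apply: tame_plus => //.
apply: (smooth_tame (j := 0)); apply: (smooth_vsum (M := M) openK) => k.
by have := tame_mult M_mono (ta' j k) (tY k); split.
Qed.

Lemma tame_comp j l : (0 < size l <= r)%N ->
  tame 0 (fun t z => iter_pderiv (fun y => F y j) l (X t z)).
Proof.
move=> /andP[l0 lr]; split.
- move=> e e0; have [C HC] := FB j l0 lr.
  exists (Rabs C + 1); split; first by have := Rabs_pos C; lra.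
  move=> z t Kz t0; apply: Rle_trans (HC _ (UX Kz t0)) _.
  have : 1 <= exp (INR 0 * M t z + e * t) by apply: exp_ge1; rewrite /=; nra.
  by have := Rle_abs C; have := Rabs_pos C; nra.
- move=> z Kz T e e0.
  have [d [d0 H]] := unif_cont_along T (proj2 (FC j) l lr) (fun t => UX Kz (t := t))
    (fun k => ctnX k Kz) e0.
  have [d' [d'0 H']] := luc_X_vec T Kz (e := d / 2) ltac:(lra).
  exists d'; split=> // z' t Kz' zd tT; apply: H => //; first by apply: UX => //; lra.
  by have := H' z' t Kz' zd tT; lra.
- by move=> z Kz; exact: ctn_deriv.
Qed.

Lemma derivable_comp j l i t z : (size l < r)%N -> 0 <= t -> K z ->
  (forall k, has_dz K i (fun t z => X t z k)) ->
  derivable_pt_lim (fun s => iter_pderiv (fun y => F y j) l (X t (vshift z i s))) 0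
    (vsum (fun k => iter_pderiv (fun y => F y j) (k :: l) (X t z) * dz i (fun t z => X t z k) t z)).
Proof.
move=> lr t0 Kz dXi.
have GC : C1 U (iter_pderiv (fun y => F y j) l).
  split; first by move=> k x Ux; exact: (proj1 (FC j)).
  by move=> k; exact: (proj2 (FC j) (k :: l)).
apply: (frechet_chain (x := fun s => X t (vshift z i s))
  (D := fun k => pderiv (iter_pderiv (fun y => F y j) l) k (X t z))).
  by rewrite vshift0; apply: frechet_C1 (dm_open dom) GC _; exact: UX.
by move=> k; exact: (has_dzP (p := fun t z => X t z k)).
Qed.

(** By the chain rule each derivative yields a further derivative of F, of order 0, times a first
    derivative of X, of order 1. Thus DF along X is as smooth as X itself, which is what
    [smooth_gain] requires of the coefficients. *)
Lemma smooth_comp d j l : (0 < size l)%N -> (size l + d <= r)%N ->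
  (forall i k, has_dz K i (fun t z => X t z k) /\ smooth d.-1 1 (dz i (fun t z => X t z k))) ->
  smooth d 0 (fun t z => iter_pderiv (fun y => F y j) l (X t z)).
Proof.
elim: d j l => [|d IH] j l l0 ldr sX.
  by split=> //; apply: tame_comp; rewrite l0 -(addn0 (size l)).
have lr : (size l < r)%N by apply: leq_trans ldr; rewrite addnS ltnS leq_addr.
split; first by apply: tame_comp; rewrite l0 ltnW.
move=> i; have dXi k : has_dz K i (fun t z => X t z k) by case: (sX i k).
split.
  move=> t z t0 Kz; exists (vsum (fun k => iter_pderiv (fun y => F y j) (k :: l) (X t z)
    * dz i (fun t z => X t z k) t z)); exact: derivable_comp.
apply: (eq_smooth openK (p := fun t z => vsum (fun k =>
  iter_pderiv (fun y => F y j) (k :: l) (X t z) * dz i (fun t z => X t z k) t z))).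
  by move=> t z t0 Kz; symmetry; apply: pderiv_eq; exact: derivable_comp.
apply: (smooth_vsum openK) => k.
apply: (smooth_mult openK M_mono (q := 0) (q' := 1)); last by case: (sX i k).
apply: IH => //; first by rewrite addSnnS.
move=> i' k'; case: (sX i' k') => h1 h2; split=> //; apply: smooth_le h2; exact: leq_pred.
Qed.

(** The z-derivative of Y solves the same equation with forcing dA Y + dP, and the levels already
    known for Y suffice for this forcing. The induction lowers d and raises q, keeping d + q
    fixed. *)
Lemma smooth_gain d q (Y P : R -> vec B -> vec (A + B)%type) w0 : (0 < q)%N -> (d + q < r)%N ->
  (forall j k, smooth (d + q) 0 (fun t z => pderiv (fun y => F y j) k (X t z))) ->
  (forall j, smooth d q (fun t z => Y t z j)) -> (forall j, smooth d.+1 q (fun t z => P t z j)) ->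
  (forall z T, K z -> linsol (F := F) (fun t => X t z) (fun t => Y t z) (fun t => P t z) T) ->
  (forall z j, K z -> Y 0 z (inr j) = w0 j) ->
  forall j, smooth d.+1 q (fun t z => Y t z j).
Proof.
move=> q0 dqr sA.
have sA1 j k : smooth 1 0 (fun t z => pderiv (fun y => F y j) k (X t z)).
  by apply: smooth_le (sA j k); rewrite addn_gt0 q0 orbT.
elim: d q Y P w0 q0 dqr sA => [|d IH] q Y P w0 q0 dqr sA sY sP linY Y0 j.
  split=> [|i]; first exact: smooth_tame (sY j).
  have q1r : (1 <= q < r)%N by rewrite q0.
  have [dY tY' _ _] := linsol_dz i q1r sA1 (fun k => smooth_tame (sY k)) sP linY Y0.
  by split.
have qr : (q < r)%N by apply: leq_ltn_trans dqr; exact: leq_addl.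
split=> [|i]; first exact: smooth_tame (sY j).
have q1r : (1 <= q < r)%N by rewrite q0.
have sP1 k : smooth 1 q (fun t z => P t z k) by exact: smooth_le (sP k).
have [dY tY' linY' Y'0] := linsol_dz i q1r sA1 (fun k => smooth_tame (sY k)) sP1 linY Y0.
split=> //.
apply: (IH q.+1 _ _ _ _ _ _ _ _ linY' Y'0) => //.
- by rewrite addnS -addSn.
- by move=> k l; rewrite addnS -addSn.
- by move=> k; case: (sY k) => _ /(_ i)[].
move=> k; apply: (smooth_plus openK); last by case: (sP k) => _ /(_ i)[].
apply: (smooth_vsum openK) => l.
apply: (smooth_mult openK M_mono (q := 1) (q' := q)); last exact: sY.
have := sA k l; rewrite addSn => -[_ /(_ i)[_]]; apply: smooth_le.
by rewrite -[d.+1]addn1 leq_add2l.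
Qed.

(** A bootstrap: derivatives of X up to order d + 1 make the coefficients smooth enough for
    [smooth_gain] to produce the next order. *)
Lemma orbit_smooth d i k : (d < r)%N ->
  has_dz K i (fun t z => X t z k) /\ smooth d 1 (dz i (fun t z => X t z k)).
Proof.
elim: d i k => [|d IH] i k dr; have [dX' tX' linX' X'0] := orbit_dz i.
  by split=> //; split.
have IHd i' k' := IH i' k' (ltnW dr).
split=> //.
apply: (smooth_gain (Y := fun t z k => dz i (fun t z => X t z k) t z)
  (P := fun _ _ _ => 0) (w0 := delta i)) => //.
- by rewrite addn1.
- move=> j l; apply: (@smooth_comp _ j [:: l]) => //=.
    by rewrite addn1 add1n.
  by rewrite addn1.
- by move=> l; case: (IHd i l).
- by move=> l; exact: smooth0.
Qed.

End Orbits.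

(** * Invariant cones *)

Section Cone.
Context {A B : finType} {r : nat} {U : vec (A + B)%type -> Prop}.
Context {F : vec (A + B)%type -> vec (A + B)%type}.
Context {al ell b c : vec (A + B)%type -> R} {c1 cr Lip : R}.
Hypothesis dom : dominated r U F al ell b c c1 cr Lip.
Hypothesis FC1 : forall j, C1 U (fun y => F y j).
Let c10 := dm_c1 dom.
Let Lip0 := dm_Lip dom.

(** Half the derivative of |a|^2 - k^2 |z|^2 in the cone |a| >= k |z|. At k = 1 the first gap
    condition leaves c1; for k < 1 the coupling b |a| |z| can reach b |a|^2 / k, and its excess over
    b |a|^2 is the loss (/ k - 1) Lip. *)
Lemma cone_rate k x y : U x -> U y -> 0 < k <= 1 ->
  k * vnorm (PiB (vsub y x)) <= vnorm (PiA (vsub y x)) ->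
  vnorm (PiA (vsub y x)) ^ 2 * (c1 - (/ k - 1) * Lip) <=
  inner (PiA (vsub y x)) (PiA (vsub (F y) (F x)))
  - k ^ 2 * inner (PiB (vsub y x)) (PiB (vsub (F y) (F x))).
Proof.
move=> Ux Uy [k0 k1] kza; set D := vsub y x in kza *.
pose seg t s := (1 - t) * x s + t * y s.
(* The gap hypotheses are pointwise: one scalar function along the segment gives one
   intermediate point for all four blocks of the Jacobian. *)
pose G t := inner (PiA D) (PiA (F (seg t))) - k ^ 2 * inner (PiB D) (PiB (F (seg t))).
pose dG w := inner (PiA D) (PiA (jac F w D)) - k ^ 2 * inner (PiB D) (PiB (jac F w D)).
have dF t j : 0 <= t <= 1 -> derivable_pt_lim (fun t => F (seg t) j) t (jac F (seg t) D j).
  move=> t01; exact: (derivable_segment (dm_open dom) (dm_conv dom) (FC1 j) Ux Uy t01).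
have dGP t : 0 <= t <= 1 -> derivable_pt_lim G t (dG (seg t)).
  move=> t01; apply: derivable_pt_lim_minus.
    have := derivable_pt_lim_inner (u := fun=> PiA D) (v := fun t => PiA (F (seg t)))
      (u' := fun=> 0) (fun i => derivable_pt_lim_const _ _) (fun i => dF t (inl i) t01).
    have -> : inner (fun=> 0) (PiA (F (seg t))) = 0.
      by rewrite /inner (eq_vsum (v := fun=> 0)) ?vsum0 // => i; ring.
    by rewrite Rplus_0_l.
  apply: derivable_pt_lim_scal.
  have := derivable_pt_lim_inner (u := fun=> PiB D) (v := fun t => PiB (F (seg t)))
    (u' := fun=> 0) (fun i => derivable_pt_lim_const _ _) (fun i => dF t (inr i) t01).
  have -> : inner (fun=> 0) (PiB (F (seg t))) = 0.
    by rewrite /inner (eq_vsum (v := fun=> 0)) ?vsum0 // => i; ring.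
  by rewrite Rplus_0_l.
have [w [Uw [_ E]]] := segment_mvt (dG := dG) (dm_conv dom) Ux Uy dGP.
have s1 : seg 1 = y by apply: functional_extensionality => s; rewrite /seg; ring.
have s0 : seg 0 = x by apply: functional_extensionality => s; rewrite /seg; ring.
have -> : inner (PiA D) (PiA (vsub (F y) (F x))) = inner (PiA D) (PiA (F y))
    - inner (PiA D) (PiA (F x)) by rewrite -innerBr.
have -> : inner (PiB D) (PiB (vsub (F y) (F x))) = inner (PiB D) (PiB (F y))
    - inner (PiB D) (PiB (F x)) by rewrite -innerBr.
move: E; rewrite /G s1 s0 => E.
suff : vnorm (PiA D) ^ 2 * (c1 - (/ k - 1) * Lip) <= dG w by lra.
have hA := dm_A dom D Uw; have hB := dm_B dom D Uw; have g1 := dm_gap1 dom Uw.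
have e0 := dm_ell dom Uw; have [b0 b1] := dm_b dom Uw; have c0 := dm_c dom Uw.
set a := vnorm (PiA D) in kza hA hB *; set z := vnorm (PiB D) in kza hA hB *.
have a0 : 0 <= a := vnorm_ge0 _; have z0 : 0 <= z := vnorm_ge0 _.
set m := k * z in kza.
have m0 : 0 <= m by apply: Rmult_le_pos; lra.
have zE : z = / k * m by rewrite /m; field; lra.
have ik : 1 <= / k by rewrite -Rinv_1; apply: Rinv_le_contravar.
have h1 : b w * a * z <= b w * (/ k) * (a * a).
  rewrite zE; have -> : b w * a * (/ k * m) = b w * / k * (a * m) by ring.
  by apply: Rmult_le_compat_l; [apply: Rmult_le_pos; lra | apply: Rmult_le_compat_l; lra].
have h2 : k ^ 2 * (ell w * z ^ 2) <= ell w * (a * a).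
  have -> : k ^ 2 * (ell w * z ^ 2) = ell w * (m * m) by rewrite /m; ring.
  by apply: Rmult_le_compat_l => //; apply: Rmult_le_compat.
have h3 : k ^ 2 * (c w * a * z) <= c w * (a * a).
  have -> : k ^ 2 * (c w * a * z) = c w * (k * (a * m)) by rewrite /m; ring.
  apply: Rmult_le_compat_l => //; rewrite -[a * a]Rmult_1_l.
  by apply: Rmult_le_compat => //; [lra | apply: Rmult_le_pos | apply: Rmult_le_compat_l].
have h4 : k ^ 2 * inner (PiB D) (PiB (jac F w D)) <= k ^ 2 * (ell w * z ^ 2 + c w * a * z).
  by apply: Rmult_le_compat_l => //; nra.
have h5 : (/ k - 1) * b w <= (/ k - 1) * Lip by apply: Rmult_le_compat_l; lra.
have aa : 0 <= a * a by nra.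
have h6 : (a * a) * (c1 - (/ k - 1) * Lip) <= (a * a) * (al w - b w * / k - ell w - c w).
  by apply: Rmult_le_compat_l => //; lra.
by rewrite /dG; lra.
Qed.

Definition forward (phi : R -> vec (A + B)%type) := forall t, 0 <= t -> U (phi t) /\
  forall s, derivable_pt_lim (fun u => phi u s) t (F (phi t) s).

Lemma forward_ctn phi j : forward phi -> ctn (fun t => phi t j).
Proof.
move=> fphi; apply/ctnP => t t0 e e0; have [_ dphi] := fphi t t0.
have cp : continuity_pt (fun u => phi u j) t.
  by apply: derivable_continuous_pt; exists (F (phi t) j); exact: dphi.
have [d [d0 H]] := cp e e0; exists d; split=> // s s0 st.
case: (Req_dec t s) => [<-|ts]; first by rewrite Rminus_diag Rabs_R0.
by apply: (H s).
Qed.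

Definition Vcone (k : R -> R) (phi psi : R -> vec (A + B)%type) (t : R) :=
  inner (PiA (vsub (psi t) (phi t))) (PiA (vsub (psi t) (phi t)))
  - k t ^ 2 * inner (PiB (vsub (psi t) (phi t))) (PiB (vsub (psi t) (phi t))).

Lemma VconeE k phi psi t : Vcone k phi psi t =
  vnorm (PiA (vsub (psi t) (phi t))) ^ 2 - k t ^ 2 * vnorm (PiB (vsub (psi t) (phi t))) ^ 2.
Proof. by rewrite !vnorm2. Qed.

Lemma Vcone_ctn k phi psi : ctn k -> forward phi -> forward psi -> ctn (Vcone k phi psi).
Proof.
move=> ck fphi fpsi.
have cD j : ctn (fun t => vsub (psi t) (phi t) j).
  by apply: ctn_minus; exact: forward_ctn.
apply: ctn_minus.
  by apply: (ctn_inner (u := fun t => PiA (vsub (psi t) (phi t)))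
    (v := fun t => PiA (vsub (psi t) (phi t)))) => j; exact: cD.
apply: ctn_mult.
  by apply: (ctn_mult ck); apply: (ctn_mult ck); exact: ctn_const.
by apply: (ctn_inner (u := fun t => PiB (vsub (psi t) (phi t)))
  (v := fun t => PiB (vsub (psi t) (phi t)))) => j; exact: cD.
Qed.

(** The additional loss k' / k comes from differentiating k^2, with k |z| <= |a| in the cone. *)
Lemma Vcone_rate (k : R -> R) k' phi psi t : forward phi -> forward psi -> 0 <= t ->
  derivable_pt_lim k t k' -> 0 < k t <= 1 -> 0 <= k' -> 0 <= Vcone k phi psi t ->
  exists l, derivable_pt_lim (Vcone k phi psi) t l /\
    2 * (vnorm (PiA (vsub (psi t) (phi t))) ^ 2 * (c1 - (/ k t - 1) * Lip - k' / k t)) <= l.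
Proof.
move=> fphi fpsi t0 dk k01 k'0 V0.
have [Up dp] := fphi t t0; have [Uq dq] := fpsi t t0.
set D := fun t => vsub (psi t) (phi t).
have dD j : derivable_pt_lim (fun t => D t j) t (vsub (F (psi t)) (F (phi t)) j).
  by apply: derivable_pt_lim_minus; [exact: dq | exact: dp].
have dsq (J : finType) (v : R -> vec J) v' : (forall j, derivable_pt_lim (fun t => v t j) t (v' j)) ->
    derivable_pt_lim (fun t => inner (v t) (v t)) t (2 * inner (v t) v').
  move=> dv; have := derivable_pt_lim_inner dv dv; rewrite (innerC v').
  by have -> : inner (v t) v' + inner (v t) v' = 2 * inner (v t) v' by ring.
have dA := dsq _ (fun t => PiA (D t)) _ (fun i => dD (inl i)).
have dB := dsq _ (fun t => PiB (D t)) _ (fun i => dD (inr i)).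
have dk2 : derivable_pt_lim (fun t => k t ^ 2) t (2 * k t * k').
  have := derivable_pt_lim_mult _ _ _ _ _ dk dk.
  have -> : k' * k t + k t * k' = 2 * k t * k' by ring.
  by apply: derivable_pt_lim_ext => s; rewrite /mult_fct; ring.
have dV := derivable_pt_lim_minus _ _ _ _ _ dA (derivable_pt_lim_mult _ _ _ _ _ dk2 dB).
eexists; split; first exact: dV.
set a := vnorm (PiA (vsub (psi t) (phi t))); set z := vnorm (PiB (vsub (psi t) (phi t))).
have a0 : 0 <= a := vnorm_ge0 _; have z0 : 0 <= z := vnorm_ge0 _.
have kza : k t * z <= a.
  move: V0; rewrite VconeE -/a -/z => V0.
  have : 0 <= k t * z by nra.
  by nra.
have R0 := cone_rate Up Uq k01 kza; rewrite -/a in R0.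
rewrite -(vnorm2 (PiB (D t))) -/z.
have h : k t * k' * z ^ 2 <= a ^ 2 * (k' / k t).
  have -> : k t * k' * z ^ 2 = (k t * z) ^ 2 * (k' / k t) by field; lra.
  apply: Rmult_le_compat_r; first by apply: Rdiv_le_0_compat; lra.
  by apply: pow_incr; nra.
by move: R0; rewrite /D /PiA /PiB; lra.
Qed.

Lemma cone_trivial phi psi d : forward phi -> forward psi ->
  (forall x x', U x -> cone x x' -> U x' -> boxB d x x') ->
  vnorm (PiB (vsub (psi 0) (phi 0))) <= vnorm (PiA (vsub (psi 0) (phi 0))) ->
  psi 0 = phi 0.
Proof.
move=> fphi fpsi box za.
suff a0 : vnorm (PiA (vsub (psi 0) (phi 0))) = 0.
  have z0 : vnorm (PiB (vsub (psi 0) (phi 0))) = 0.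
    by have := vnorm_ge0 (PiB (vsub (psi 0) (phi 0))); lra.
  have D0 : vnorm (vsub (psi 0) (phi 0)) = 0.
    have := vnorm_le_AB (vsub (psi 0) (phi 0)); have := vnorm_ge0 (vsub (psi 0) (phi 0)); lra.
  by apply: functional_extensionality => j; have := vnorm_eq0 D0 j; rewrite /vsub; lra.
apply: NNPP => an0.
have ap : 0 < vnorm (PiA (vsub (psi 0) (phi 0))).
  by have := vnorm_ge0 (PiA (vsub (psi 0) (phi 0))); lra.
pose V := Vcone (fun=> 1) phi psi.
have VE t : V t = vnorm (PiA (vsub (psi t) (phi t))) ^ 2 - vnorm (PiB (vsub (psi t) (phi t))) ^ 2.
  by rewrite /V VconeE; ring.
have cV : ctn V by apply: Vcone_ctn => //; exact: ctn_const.
have dV t : 0 <= t -> 0 <= V t -> exists l, derivable_pt_lim V t l /\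
    2 * (vnorm (PiA (vsub (psi t) (phi t))) ^ 2 * c1) <= l.
  move=> t0 Vt.
  have [l [dl hl]] := Vcone_rate (k := fun=> 1) (k' := 0) fphi fpsi t0
    (derivable_pt_lim_const 1 t) (conj Rlt_0_1 (Rle_refl 1)) (Rle_refl 0) Vt.
  by exists l; split=> //; move: hl; rewrite Rinv_1 /Rdiv Rmult_0_l; lra.
have V00 : 0 <= V 0.
  by rewrite VE; have := vnorm_ge0 (PiB (vsub (psi 0) (phi 0))); nra.
have [l [dl hl]] := dV 0 ltac:(lra) V00.
have l0 : 0 < l.
  apply: Rlt_le_trans hl; have := pow_lt _ 2 ap; nra.
(* V 0 may vanish; its strictly positive derivative makes V positive shortly afterwards. *)
have [t0 [t00 Vt0]] : exists t0, 0 < t0 /\ 0 < V t0.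
  have [e He] := dl l l0; have e0 := cond_pos e; exists (e / 2); split; first lra.
  have := He (e / 2) ltac:(lra) ltac:(rewrite Rabs_pos_eq; lra).
  move=> /Rabs_def2[_]; rewrite Rplus_0_l => h.
  have : 0 < (V (e / 2) - V 0) / (e / 2) by lra.
  move=> /(Rmult_lt_compat_r (e / 2) _ _ ltac:(lra)).
  have -> : (V (e / 2) - V 0) / (e / 2) * (e / 2) = V (e / 2) - V 0 by field; lra.
  by lra.
have VV0 t : t0 <= t -> V t0 <= V t.
  move=> t0t; suff : V t0 - V t <= 0 by lra.
  apply: (barrier (u := fun t => V t0 - V t) (a := t0) (T := t) (nu := V t0) (K := 0)); try lra.
    by apply: ctn_minus => //; exact: ctn_const.
  move=> s st us; have [l' [dl' hl']] := dV s ltac:(lra) ltac:(lra).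
  exists (0 - l'); split.
    apply: (derivable_pt_lim_minus (fun=> V t0)) => //; exact: derivable_pt_lim_const.
  by have := pow2_ge_0 (vnorm (PiA (vsub (psi s) (phi s)))); nra.
have bound t : 0 <= t -> 0 <= V t -> V t <= d ^ 2.
  move=> t0' Vt; have [Up _] := fphi t t0'; have [Uq _] := fpsi t t0'.
  have : boxB d (psi t) (phi t).
    apply: box => //; rewrite /cone /Lfun.
    have -> : vnorm (vsub (PiA (psi t)) (PiA (phi t))) = vnorm (PiA (vsub (psi t) (phi t))) by [].
    have -> : vnorm (vsub (PiB (psi t)) (PiB (phi t))) = vnorm (PiB (vsub (psi t) (phi t))) by [].
    by rewrite -VE; lra.
  move=> [ha _]; rewrite VE.
  have ha' : vnorm (PiA (vsub (psi t) (phi t))) <= d.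
    by rewrite (_ : PiA (vsub (psi t) (phi t)) = vsub (PiA (psi t)) (PiA (phi t))) // vnorm_subC.
  have := pow_incr _ _ 2 (conj (vnorm_ge0 _) ha').
  by have := pow2_ge_0 (vnorm (PiB (vsub (psi t) (phi t)))); lra.
(* After t0 the derivative of V is at least 2 c1 V t0, so by T the gain is d^2 + 1, more than the
   box allows. *)
set T := t0 + (d ^ 2 + 1) / (2 * c1 * V t0).
have pos : 0 < 2 * c1 * V t0 by nra.
have TT : t0 < T.
  have : 0 < (d ^ 2 + 1) / (2 * c1 * V t0).
    by apply: Rdiv_lt_0_compat => //; have := pow2_ge_0 d; lra.
  by rewrite /T; lra.
have [s [l' [st [dl' E]]]] : exists s l', t0 < s < T /\ derivable_pt_lim V s l' /\
    V T - V t0 = l' * (T - t0).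
  apply: mvt_ctn => //; first lra.
  move=> s st; have := VV0 s ltac:(lra) => Vs.
  by have [l' [dl' _]] := dV s ltac:(lra) ltac:(lra); exists l'.
have Vs := VV0 s ltac:(lra).
have [l'' [dl'' hl'']] := dV s ltac:(lra) ltac:(lra).
have ll := uniqueness_limite _ _ _ _ dl' dl''.
have VT := VV0 T ltac:(lra).
have := bound T ltac:(lra) ltac:(lra).
have Va : V s <= vnorm (PiA (vsub (psi s) (phi s))) ^ 2.
  by rewrite VE; have := pow2_ge_0 (vnorm (PiB (vsub (psi s) (phi s)))); lra.
have lge : 2 * c1 * V t0 <= l' by rewrite ll; nra.
have : (2 * c1 * V t0) * (T - t0) <= l' * (T - t0) by apply: Rmult_le_compat_r; lra.
have -> : (2 * c1 * V t0) * (T - t0) = d ^ 2 + 1 by rewrite /T; field; lra.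
by lra.
Qed.

(* The cone |a| >= kappa |z| is widened to |a| >= |z| within unit time. *)
Lemma cone_contract : exists kappa, 0 < kappa < 1 /\ forall phi psi,
  forward phi -> forward psi ->
  (forall t, 0 <= t ->
    vnorm (PiA (vsub (psi t) (phi t))) <= vnorm (PiB (vsub (psi t) (phi t)))) ->
  vnorm (PiA (vsub (psi 0) (phi 0))) <= kappa * vnorm (PiB (vsub (psi 0) (phi 0))).
Proof.
(* While k rises linearly from k0 to 1, the losses (/ k - 1) Lip and k' / k are at most theta Lip
   and theta; together they use only c1 / 4. *)
set theta := c1 / (4 * (1 + Lip)).
have theta0 : 0 < theta by apply: Rdiv_lt_0_compat; lra.
have thetaE : theta * (1 + Lip) = c1 / 4 by rewrite /theta; field; lra.
set k0 := / (1 + theta).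
have k00 : 0 < k0 by apply: Rinv_0_lt_compat; lra.
have k01 : k0 < 1 by rewrite /k0 -Rinv_1; apply: Rinv_lt_contravar; lra.
have ik0 : / k0 = 1 + theta by rewrite /k0 Rinv_inv.
exists k0; split=> // phi psi fphi fpsi az.
apply: Rnot_lt_le => lt.
pose k t := k0 + (1 - k0) * t.
pose V := Vcone k phi psi.
have dk t : derivable_pt_lim k t (1 - k0).
  by apply/is_derive_Reals; rewrite /k; auto_derive => //; ring.
have ck : ctn k.
  apply: ctn_plus; first exact: ctn_const.
  by apply: ctn_mult; [exact: ctn_const | exact: ctn_id].
have cV : ctn V by exact: Vcone_ctn.
have V0 : 0 < V 0.
  rewrite /V VconeE /k Rmult_0_r Rplus_0_r.
  have z0 : 0 <= k0 * vnorm (PiB (vsub (psi 0) (phi 0))).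
    by apply: Rmult_le_pos; [lra | exact: vnorm_ge0].
  by nra.
have : V 0 - V 1 <= 0.
  apply: (barrier (u := fun t => V 0 - V t) (a := 0) (T := 1) (nu := V 0) (K := 0)); try lra.
    by apply: ctn_minus => //; exact: ctn_const.
  move=> t t01 ut.
  have kt : k0 <= k t <= 1 by rewrite /k; split; nra.
  have [l [dl hl]] := Vcone_rate (k := k) fphi fpsi (t := t) ltac:(lra) (dk t)
    ltac:(lra) ltac:(lra) ltac:(rewrite -/V; lra).
  exists (0 - l); split.
    apply: (derivable_pt_lim_minus (fun=> V 0)) => //; exact: derivable_pt_lim_const.
  have ik : / k t <= 1 + theta by rewrite -ik0; apply: Rinv_le_contravar; lra.
  have ik1 : 1 <= / k t by rewrite -Rinv_1; apply: Rinv_le_contravar; lra.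
  have h1 : (/ k t - 1) * Lip <= theta * Lip by apply: Rmult_le_compat_r; lra.
  have h2 : (1 - k0) / k t <= theta.
    have : (1 - k0) / k0 = theta by rewrite /Rdiv ik0 /k0; field; lra.
    move=> <-; apply: Rmult_le_compat_l; first lra.
    by apply: Rinv_le_contravar; lra.
  have : 0 <= vnorm (PiA (vsub (psi t) (phi t))) ^ 2 *
      (c1 - (/ k t - 1) * Lip - (1 - k0) / k t).
    by apply: Rmult_le_pos; [exact: pow2_ge_0 | nra].
  by lra.
have k1 : k 1 = 1 by rewrite /k; ring.
have := az 1 ltac:(lra); rewrite {2}/V VconeE k1.
have := vnorm_ge0 (PiA (vsub (psi 1) (phi 1))).
by nra.
Qed.

End Cone.

(** M is the integral of [mu] along the orbit; the Lipschitz bound for [mu] makes the integrand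
    continuous, and clamping time at 0 extends it to the whole line. *)
Lemma rate_exists {A B : finType} r (U : vec (A + B)%type -> Prop) F al ell b c c1 cr Lip
  (x : R -> vec (A + B)%type) :
  dominated r U F al ell b c c1 cr Lip -> (forall t, 0 <= t -> U (x t)) ->
  (forall j, ctn (fun t => x t j)) ->
  rate (F := F) (U := U) x (fun t => RInt (fun s => mu (F := F) (x (Rmax 0 s))) 0 t).
Proof.
move=> dom Ux cx; have Lip0 := dm_Lip dom.
have cmu : cont_on U (mu (F := F)).
  move=> y Uy e e0; exists (e / (2 * Lip)); split; first by apply: Rdiv_lt_0_compat; lra.
  move=> w Uw wy; have h1 := mu_lip dom Uy Uw; have h2 := mu_lip dom Uw Uy.
  rewrite vnorm_subC in h2.
  have := Rmult_lt_compat_l (2 * Lip) _ _ ltac:(lra) wy.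
  have -> : 2 * Lip * (e / (2 * Lip)) = e by field; lra.
  by move=> h3; apply: Rabs_def1; lra.
have cg := ctn_cont_on cmu Ux cx.
have cg' t : continuous (fun s => mu (F := F) (x (Rmax 0 s))) t.
  exact/continuity_pt_filterlim/cg.
have dI t : is_derive (RInt (fun s => mu (F := F) (x (Rmax 0 s))) 0) t (mu (F := F) (x (Rmax 0 t))).
  apply: is_derive_RInt (cg' t); exists (mkposreal 1 Rlt_0_1) => s _.
  by apply: RInt_correct; apply: ex_RInt_continuous => u _; exact: cg'.
split=> //.
- apply: (ctn_comp (f := RInt (fun s => mu (F := F) (x (Rmax 0 s))) 0) ctn_id) => t.
  apply: derivable_continuous_pt; exists (mu (F := F) (x (Rmax 0 (Rmax 0 t)))).
  exact/is_derive_Reals.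
- by rewrite RInt_point.
- move=> t t0; apply/is_derive_Reals.
  by have := dI t; rewrite (Rmax_right 0 t) //; lra.
Qed.

(** * From the hypotheses on f and g to [dominated] *)

Section Intro.
Context {A B : finType}.
Implicit Types (U : vec (A + B)%type -> Prop).

(** Bounded second derivatives on a convex set, hence r >= 2, give a Lipschitz Jacobian and a
    quadratic Taylor remainder. *)
Lemma dominated_intro r U (f : vec (A + B)%type -> vec A) (g : vec (A + B)%type -> vec B)
    alpha ell c1 cr :
  let F x := pairv (f x) (g x) in
  (2 <= r)%N -> open_vset U -> convex_vset U -> CrV r U F -> bounded_derivs 1 r U F ->
  c1 > 0 -> cr > 0 -> (forall x, U x -> ell x >= 0) ->
  (forall x, U x ->
    (forall a', inner a' (Da f x a') >= alpha x * vnorm a' ^ 2) /\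
    (forall z', inner z' (Dz g x z') <= ell x * vnorm z' ^ 2) /\
    alpha x >= ell x + opnorm (Dz f x) + opnorm (Da g x) + c1 /\
    alpha x >= INR r * ell x + (INR r + 1) * opnorm (Da g x) + cr) ->
  exists Lip, dominated r U F alpha ell (fun x => opnorm (Dz f x)) (fun x => opnorm (Da g x))
    c1 cr Lip.
Proof.
move=> F r2 oU cU FC FB c10 cr0 ell0 H.
have FC1 j : C1 U (fun y => F y j).
  have [dF cF] := FC j; split; first by move=> i x; exact: (dF [::] (ltnW r2) i x).
  by move=> i; exact: (cF [:: i] (ltnW r2)).
have FC2 j i : C1 U (pderiv (fun y => F y j) i).
  have [dF cF] := FC j; split; first by move=> k x; exact: (dF [:: i] r2 k x).
  by move=> k; exact: (cF [:: k; i] r2).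
have [M1 [M10 HM1]] := fin_max (P := fun ji (M : R) => forall x, U x ->
    Rabs (pderiv (fun y => F y ji.1) ji.2 x) <= M)
  (fun ji M M' HM MM' x Ux => Rle_trans _ _ _ (HM x Ux) MM')
  (fun ji : (A + B) * (A + B) => FB ji.1 [:: ji.2] isT (ltnW r2)).
have [M2 [M20 HM2]] := fin_max (P := fun jik (M : R) => forall x, U x ->
    Rabs (pderiv (pderiv (fun y => F y jik.1.1) jik.1.2) jik.2 x) <= M)
  (fun jik M M' HM MM' x Ux => Rle_trans _ _ _ (HM x Ux) MM')
  (fun jik : (A + B) * (A + B) * (A + B) => FB jik.1.1 [:: jik.2; jik.1.2] isT r2).
(* N counts the coordinates: each passage from bounds on entries to a bound on a norm costs one
   factor N. *)
set N := vsum (fun _ : (A + B)%type => 1).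
have N0 : 0 <= N by apply: vsum_ge0 => _; lra.
set L1 := N * (N * M1); set L2 := N * (N * (N * M2)).
have L10 : 0 <= L1 by do 2 (apply: Rmult_le_pos => //); lra.
have L20 : 0 <= L2 by do 3 (apply: Rmult_le_pos => //); lra.
have jacL x v : U x -> vnorm (jac F x v) <= L1 * vnorm v.
  move=> Ux; have -> : L1 * vnorm v = N * (N * M1 * vnorm v) by rewrite /L1; ring.
  apply: vnorm_le_card => j; apply: Rle_trans (cauchy_schwarz (fun i => pderiv _ i x) v) _.
  apply: Rmult_le_compat_r; first exact: vnorm_ge0.
  by apply: vnorm_le_card => i; exact: (HM1 (j, i)).
have gradL x y j i : U x -> U y -> Rabs (pderiv (fun w => F w j) i y
    - pderiv (fun w => F w j) i x) <= N * M2 * vnorm (vsub y x).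
  move=> Ux Uy; apply: (lipschitz_C1 oU cU (FC2 j i)) => // k w.
  exact: (HM2 (j, i, k)).
have jacZA x cst v j : Da g x (fun i => cst * v i) j = cst * Da g x v j.
  by rewrite /Da -vsumZ; apply: eq_vsum => i; ring.
have jacZB x cst v j : Dz f x (fun i => cst * v i) j = cst * Dz f x v j.
  by rewrite /Dz -vsumZ; apply: eq_vsum => i; ring.
have jacA x v k : jac F x v (inl k) = Da f x (PiA v) k + Dz f x (PiB v) k.
  by rewrite /jac vsum_sumType.
have jacB x v k : jac F x v (inr k) = Da g x (PiA v) k + Dz g x (PiB v) k.
  by rewrite /jac vsum_sumType.
have bA x v : U x -> vnorm (Da g x v) <= L1 * vnorm v.
  (* Padding with zeros makes a block of the Jacobian inherit the bound of the whole. *)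
  move=> Ux; pose v' := pairv v (@vzero B).
  have -> : vnorm v = vnorm v'.
    have := vnorm_prod v'; rewrite -[PiB v']/(@vzero B) vnorm0 -[PiA v']/v.
    by have := vnorm_ge0 v; have := vnorm_ge0 v'; nra.
  apply: Rle_trans (jacL x v' Ux); apply: Rle_trans (vnorm_PiB _); right.
  apply: eq_vnorm => k; rewrite /PiB jacB /Dz (eq_vsum (v := fun=> 0)) ?vsum0 ?Rplus_0_r //.
  by move=> i; rewrite /v' /PiB /vzero /= Rmult_0_r.
have bB x v : U x -> vnorm (Dz f x v) <= L1 * vnorm v.
  move=> Ux; pose v' := pairv (@vzero A) v.
  have -> : vnorm v = vnorm v'.
    have := vnorm_prod v'; rewrite -[PiA v']/(@vzero A) vnorm0 -[PiB v']/v.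
    by have := vnorm_ge0 v; have := vnorm_ge0 v'; nra.
  apply: Rle_trans (jacL x v' Ux); apply: Rle_trans (vnorm_PiA _); right.
  apply: eq_vnorm => k; rewrite /PiA jacA /Da (eq_vsum (v := fun=> 0)) ?vsum0 ?Rplus_0_l //.
  by move=> i; rewrite /v' /PiA /vzero /= Rmult_0_r.
set Lip := L1 + L2 + 1; exists Lip; split=> //; try by rewrite /Lip; lra.
- move=> x v Ux; have [hA _] := H x Ux.
  have -> : inner (PiA v) (PiA (jac F x v)) =
      inner (PiA v) (Da f x (PiA v)) + inner (PiA v) (Dz f x (PiB v)).
    by rewrite -innerDr; apply: eq_vsum => k; rewrite {2}/PiA jacA.
  have := hA (PiA v); have := inner_ge (PiA v) (Dz f x (PiB v)).
  have := opnormP (jacZB x) (fun w => bB x w Ux) (PiB v).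
  by have := vnorm_ge0 (PiA v); nra.
- move=> x v Ux; have [_ [hB _]] := H x Ux.
  have -> : inner (PiB v) (PiB (jac F x v)) =
      inner (PiB v) (Da g x (PiA v)) + inner (PiB v) (Dz g x (PiB v)).
    by rewrite -innerDr; apply: eq_vsum => k; rewrite {2}/PiB jacB.
  have := hB (PiB v); have := inner_le (PiB v) (Da g x (PiA v)).
  have := opnormP (jacZA x) (fun w => bA x w Ux) (PiA v).
  by have := vnorm_ge0 (PiB v); nra.
- by move=> x Ux; have := ell0 x Ux; lra.
- move=> x Ux; split; first exact: (opnorm_ge0 (fun w => bB x w Ux)).
  have := opnorm_le L10 (fun w => bB x w Ux); rewrite /Lip; lra.
- by move=> x Ux; exact: (opnorm_ge0 (fun w => bA x w Ux)).
- by move=> x Ux; have [_ [_ []]] := H x Ux; lra.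
- by move=> x Ux; have [_ [_ []]] := H x Ux; lra.
- move=> x v Ux; apply: Rle_trans (jacL x v Ux) _.
  by apply: Rmult_le_compat_r; [exact: vnorm_ge0 | rewrite /Lip; lra].
- move=> x y v Ux Uy.
  apply: (Rle_trans _ (L2 * vnorm (vsub y x) * vnorm v)); last first.
    apply: Rmult_le_compat_r; first exact: vnorm_ge0.
    by apply: Rmult_le_compat_r; [exact: vnorm_ge0 | rewrite /Lip; lra].
  have -> : L2 * vnorm (vsub y x) * vnorm v =
    N * (N * (N * M2 * vnorm (vsub y x)) * vnorm v) by rewrite /L2; ring.
  apply: vnorm_le_card => j; rewrite /jac -vsumB.
  rewrite (eq_vsum (v := fun i => (pderiv (fun w => F w j) i y - pderiv (fun w => F w j) i x) * v i)).
    apply: Rle_trans (cauchy_schwarz _ v) _.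
    apply: Rmult_le_compat_r; first exact: vnorm_ge0.
    by apply: vnorm_le_card => i; exact: gradL.
  by move=> i; ring.
- move=> x y Ux Uy.
  apply: (Rle_trans _ (L2 * vnorm (vsub y x) ^ 2)); last first.
    by apply: Rmult_le_compat_r; [exact: pow2_ge_0 | rewrite /Lip; lra].
  have -> : L2 * vnorm (vsub y x) ^ 2 = N * (N * (N * M2) * vnorm (vsub y x) ^ 2).
    by rewrite /L2; ring.
  apply: vnorm_le_card => j; apply: (taylor_C1 oU cU (FC1 j)) => //.
    by move=> i w w' Uw Uw'; exact: gradL.
  by apply: Rmult_le_pos; lra.
Qed.

End Intro.

(** The difference quotients along z + s v obey the Lipschitz bound, and they tend to the Jacobian
    applied to v. *)
Lemma jac_lipschitz {I J : finType} (K : vec I -> Prop) (h : vec I -> vec J) kappa z v :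
  open_vset K -> (forall j, C1 K (fun y => h y j)) ->
  (forall z1 z2, K z1 -> K z2 -> vnorm (vsub (h z2) (h z1)) <= kappa * vnorm (vsub z2 z1)) ->
  K z -> vnorm (jac h z v) <= kappa * vnorm v.
Proof.
move=> oK hC hL Kz.
pose y s : vec I := fun i => z i + s * v i.
have y0 : y 0 = z by apply: functional_extensionality => i; rewrite /y; ring.
have dh j : derivable_pt_lim (fun s => h (y s) j) 0 (jac h z v j).
  apply: (frechet_chain (F := fun w => h w j) (x := y) (D := fun i => pderiv (fun w => h w j) i z)).
    by rewrite y0; apply: frechet_C1 (hC j) Kz.
  by move=> i; apply/is_derive_Reals; rewrite /y; auto_derive => //; ring.
set N := vsum (fun _ : J => 1).
have N0 : 0 <= N by apply: vsum_ge0 => _; lra.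
apply: le_epsilon => e e0.
have e1 : 0 < e / (N + 1) by apply: Rdiv_lt_0_compat; lra.
have [d [d0 H]] : exists d, 0 < d /\ forall j s, s <> 0 -> Rabs s < d ->
    Rabs ((h (y (0 + s)) j - h (y 0) j) / s - jac h z v j) < e / (N + 1).
  apply: (fin_min (P := fun j d => forall s, s <> 0 -> Rabs s < d ->
    Rabs ((h (y (0 + s)) j - h (y 0) j) / s - jac h z v j) < e / (N + 1))).
    by move=> j d d' H [_ d'd] s s0 sd; apply: H => //; lra.
  by move=> j; have [d Hd] := dh j _ e1; exists d; split=> //; exact: cond_pos.
have [d' [d'0 Kd']] := oK z Kz.
have v1 : 0 < vnorm v + 1 by have := vnorm_ge0 v; lra.
set s := Rmin d (d' / (vnorm v + 1)) / 2.
have mp : 0 < Rmin d (d' / (vnorm v + 1)).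
  by apply: Rmin_pos => //; exact: Rdiv_lt_0_compat.
have s0 : 0 < s by rewrite /s; lra.
have sd : s < d by rewrite /s; have := Rmin_l d (d' / (vnorm v + 1)); lra.
have sd' : s * (vnorm v + 1) < d'.
  have : s < d' / (vnorm v + 1) by rewrite /s; have := Rmin_r d (d' / (vnorm v + 1)); lra.
  move=> /(Rmult_lt_compat_r _ _ _ v1).
  by have -> : d' / (vnorm v + 1) * (vnorm v + 1) = d' by field; lra.
have ys : vnorm (vsub (y s) z) = s * vnorm v.
  rewrite (eq_vnorm (v := fun i => s * v i)) => [|i]; last by rewrite /vsub /y; ring.
  by rewrite vnormZ Rabs_pos_eq; lra.
have Kys : K (y s) by apply: Kd'; rewrite ys; lra.
have := hL z (y s) Kz Kys; rewrite ys => hs.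
pose q j := (h (y s) j - h z j) / s.
have nq : vnorm q <= kappa * vnorm v.
  rewrite (eq_vnorm (v := fun j => / s * vsub (h (y s)) (h z) j)); last first.
    by move=> j; rewrite /q /vsub; field; lra.
  rewrite vnormZ Rabs_pos_eq; last by left; exact: Rinv_0_lt_compat.
  have := Rmult_le_compat_l _ _ _ (Rlt_le _ _ (Rinv_0_lt_compat _ s0)) hs.
  by have -> : / s * (kappa * (s * vnorm v)) = kappa * vnorm v by field; lra.
have nd : vnorm (fun j => q j - jac h z v j) <= e.
  have Hj j : Rabs (q j - jac h z v j) <= e / (N + 1).
    have := H j s ltac:(lra) ltac:(rewrite Rabs_pos_eq; lra).
    by rewrite Rplus_0_l y0 /q; lra.
  apply: Rle_trans (vnorm_le_card Hj) _; rewrite -/N.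
  have -> : N * (e / (N + 1)) = e * (N / (N + 1)) by field; lra.
  have : N / (N + 1) <= 1 by apply/Rle_div_l; lra.
  by nra.
have := vnorm_triangB q (fun j => q j - jac h z v j).
rewrite (eq_vnorm (v := jac h z v)) => [|j]; last by ring.
by lra.
Qed.

(** * The invariant graph *)

Section Manifold.
Context {A B : finType} {r : nat} {U Gamma : vec (A + B)%type -> Prop}.
Context {F : vec (A + B)%type -> vec (A + B)%type}.
Context {al ell b c : vec (A + B)%type -> R} {c1 cr Lip d : R}.
Hypothesis r2 : (2 <= r)%N.
Hypothesis dom : dominated r U F al ell b c c1 cr Lip.
Hypothesis FC : CrV r U F.
Hypothesis FB : bounded_derivs 1 r U F.
Hypothesis box : forall x x', U x -> cone x x' -> U x' -> boxB d x x'.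
Hypothesis invG : pos_inv U F Gamma.
Let K (z : vec B) := exists a, U (pairv a z).
Hypothesis projG : forall z, (exists a, Gamma (pairv a z)) <-> K z.

Let FC1 j : C1 U (fun y => F y j).
Proof.
have [dF cF] := FC j; split; first by move=> i x; exact: (dF [::] (ltnW r2) i x).
by move=> i; exact: (cF [:: i] (ltnW r2)).
Qed.

Let r1 : (1 <= r)%N := ltnW r2.

(** With S = Gamma this makes [Gamma] a graph; with a general S it makes [Gamma] maximal. *)
Lemma invariant_unique (S : vec (A + B)%type -> Prop) x y : pos_inv U F S -> S x -> Gamma y ->
  vnorm (PiB (vsub y x)) <= vnorm (PiA (vsub y x)) -> y = x.
Proof.
move=> [_ iS] Sx Gy za; have [phi [[phi0 fphi] _]] := iS x Sx.
have [psi [[psi0 fpsi] _]] := proj2 invG y Gy.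
rewrite -phi0 -psi0; apply: (cone_trivial dom FC1 (d := d) fphi fpsi box).
by rewrite phi0 psi0.
Qed.

Lemma K_of_U x : U x -> K (PiB x).
Proof. by move=> Ux; exists (PiA x); rewrite pairv_Pi. Qed.

Lemma invariant_sub (S : vec (A + B)%type -> Prop) x : pos_inv U F S -> S x -> Gamma x.
Proof.
move=> iS Sx; have [a Ga] := proj2 (projG _) (K_of_U (proj1 iS x Sx)).
rewrite -(invariant_unique iS Sx Ga) //.
rewrite (eq_vnorm (u := PiB _) (v := @vzero B)) ?vnorm0; first exact: vnorm_ge0.
by move=> j; rewrite /PiB /vsub /= /vzero; ring.
Qed.

Definition is_orbit (z : vec B) (phi : R -> vec (A + B)%type) :=
  [/\ forward (U := U) (F := F) phi, forall t, 0 <= t -> Gamma (phi t)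
    & forall j, phi 0 (inr j) = z j].

(** One orbit in [Gamma] is selected over each z. Its value at time 0 is independent of the choice,
    because points of [Gamma] over the same z coincide. *)
Definition orbit (z : vec B) : R -> vec (A + B)%type :=
  epsilon (inhabits (fun _ _ => 0)) (is_orbit z).

Lemma orbitP z : K z -> is_orbit z (orbit z).
Proof.
move=> Kz; apply: (epsilon_spec (inhabits (fun _ _ => 0)) (is_orbit z)).
have [a Ga] := proj2 (projG _) Kz; have [phi [[phi0 fphi] Gphi]] := proj2 invG _ Ga.
by exists phi; split=> // j; rewrite phi0.
Qed.

Let X t z := orbit z t.

(** Orbits stay in [Gamma], so at each time the two points are again subject to
    [invariant_unique]. *)
Lemma orbit_cone z z' t : K z -> K z' -> 0 <= t ->
  vnorm (PiA (vsub (X t z') (X t z))) <= vnorm (PiB (vsub (X t z') (X t z))).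
Proof.
move=> Kz Kz' t0; case: (orbitP Kz) => _ G _; case: (orbitP Kz') => _ G' _.
apply: Rnot_lt_le => lt.
have E := invariant_unique invG (G t t0) (G' t t0) (Rlt_le _ _ lt).
move: lt; rewrite /X E (eq_vnorm (u := PiA _) (v := @vzero A)) ?vnorm0.
  by have := vnorm_ge0 (PiB (vsub (orbit z t) (orbit z t))); lra.
by move=> j; rewrite /PiA /vsub /vzero; ring.
Qed.

Let M t z := RInt (fun s => mu (F := F) (X (Rmax 0 s) z)) 0 t.

Lemma open_K : open_vset K.
Proof.
move=> z [a Ua]; have [e [e0 H]] := dm_open dom Ua; exists e; split=> // z' zz'.
exists a; apply: H; apply: Rle_lt_trans zz'; apply: Rle_trans (vnorm_le_AB _) _.
rewrite (eq_vnorm (u := PiA _) (v := @vzero A)) ?vnorm0; first by rewrite Rplus_0_l; exact: Rle_refl.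
by move=> j; rewrite /PiA /vsub /= /vzero; ring.
Qed.

Lemma orbit_ctn z j : K z -> ctn (fun t => X t z j).
Proof. by move=> Kz; case: (orbitP Kz) => fX _ _; exact: (forward_ctn _ fX). Qed.

Lemma orbit_rate z : K z -> rate (F := F) (U := U) (fun t => X t z) (fun t => M t z).
Proof.
move=> Kz; have UX t : 0 <= t -> U (X t z) by case: (orbitP Kz) => fX _ _ /fX[].
exact: (rate_exists (x := fun t => X t z) dom UX (fun j => orbit_ctn j Kz)).
Qed.

Lemma orbit_smooth_K k i q : (q < r)%N -> has_dz K i (fun t z => X t z k) /\
  smooth K M q 1 (dz i (fun t z => X t z k)).
Proof.
apply: (orbit_smooth dom open_K orbit_rate) => //.
- by move=> z j Kz; exact: orbit_ctn.
- by move=> z t j Kz t0; case: (orbitP Kz) => fX _ _; exact: (proj2 (fX t (Rlt_le _ _ t0)) j).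
- by move=> z j Kz; case: (orbitP Kz) => _ _ Hz; exact: Hz.
- exact: orbit_cone.
Qed.

Definition section (z : vec B) : vec A := PiA (orbit z 0).

Lemma orbit0 z : K z -> orbit z 0 = pairv (section z) z.
Proof.
move=> Kz; case: (orbitP Kz) => _ _ Hz.
by apply: functional_extensionality => -[k|k] //=; exact: Hz.
Qed.

Lemma section_graph x : Gamma x <-> exists z, K z /\ x = pairv (section z) z.
Proof.
split=> [Gx|[z [Kz ->]]]; last first.
  by rewrite -orbit0 //; case: (orbitP Kz) => _ G _; apply: G; lra.
have Kx := K_of_U (proj1 invG x Gx); exists (PiB x); split=> //.
rewrite -orbit0 //; case: (orbitP Kx) => _ G Hx.
apply: (invariant_unique invG (G 0 (Rle_refl 0)) Gx).
rewrite (eq_vnorm (u := PiB _) (v := @vzero B)) ?vnorm0; first exact: vnorm_ge0.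
by move=> j; rewrite /PiB /vsub Hx /PiB /vzero; ring.
Qed.

Lemma section_strict z1 z2 : K z1 -> K z2 -> z1 <> z2 ->
  vnorm (vsub (section z2) (section z1)) < vnorm (vsub z2 z1).
Proof.
move=> K1 K2 ne; apply: Rnot_le_lt => le; apply: ne.
have G1 : Gamma (pairv (section z1) z1) by apply/section_graph; exists z1.
have G2 : Gamma (pairv (section z2) z2) by apply/section_graph; exists z2.
have := invariant_unique invG G1 G2 le => E.
by have := f_equal (fun x => PiB x) E.
Qed.

(** [section_strict] alone would only bound the derivative by 1; a uniform factor makes the bound
    strict. *)
Lemma section_contract : exists kappa, 0 < kappa < 1 /\ forall z1 z2, K z1 -> K z2 ->
  vnorm (vsub (section z2) (section z1)) <= kappa * vnorm (vsub z2 z1).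
Proof.
have [kappa [k01 H]] := cone_contract dom FC1; exists kappa; split=> // z1 z2 K1 K2.
case: (orbitP K1) => f1 _ _; case: (orbitP K2) => f2 _ _.
have := H _ _ f1 f2 (fun t => orbit_cone K1 K2 (t := t)).
by rewrite !orbit0.
Qed.

(* The innermost derivative of a nonempty multi-index is taken on the orbits. *)
Lemma section_iter l i k z :
  iter_pderiv (fun z => section z k) (rcons l i) z =
  iter_pderiv (dz i (fun t z => X t z (inl k)) 0) l z.
Proof. by rewrite /iter_pderiv foldr_rcons. Qed.

Lemma section_iter_smooth l i k : (size l < r)%N -> tame K M (1 + size l)
  (fun t z => iter_pderiv (dz i (fun t z => X t z (inl k)) t) l z).
Proof.
move=> lr; have [_ sX] := orbit_smooth_K (inl k) i (q := r.-1) ltac:(by rewrite prednK).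
have lr' : (size l <= r.-1)%N by rewrite -ltnS prednK.
exact: smooth_tame (smooth_iter sX lr').
Qed.

Lemma section_Cr : CrV r K section.
Proof.
move=> k; split=> l lr.
  move=> i z Kz; case/lastP: l lr => [|l i'] lr.
    by have [dX _] := orbit_smooth_K (inl k) i (q := 0) r1; exact: (dX 0 z (Rle_refl 0) Kz).
  rewrite size_rcons in lr.
  have [_ sX] := orbit_smooth_K (inl k) i' (q := r.-1) ltac:(by rewrite prednK).
  have lr' : (size l < r.-1)%N by rewrite -ltnS prednK.
  have [e de] := smooth_iter_dz i sX lr' (Rle_refl 0) Kz; exists e.
  by apply: derivable_pt_lim_ext de => s; rewrite section_iter.
move=> z Kz e e0; case/lastP: l lr => [|l i] lr.
  have [e1 [e10 H]] := luc_X dom orbit_rate (fun z j Kz => orbit_ctn j Kz)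
    (fun z t j Kz t0 => let: And3 fX _ _ := orbitP Kz in proj2 (fX t (Rlt_le _ _ t0)) j)
    (fun z j Kz => let: And3 _ _ Hz := orbitP Kz in Hz j) orbit_cone (inl k) Kz 0 e0.
  by exists e1; split=> // z' Kz' zz'; apply: (H z' 0) => //; lra.
rewrite size_rcons in lr; have [_ luX _] := section_iter_smooth i k lr.
have [e1 [e10 H]] := luX z Kz 0 e e0.
exists e1; split=> // z' Kz' zz'; rewrite !section_iter.
by apply: (H z' 0) => //; lra.
Qed.

(** As M vanishes at time 0, the growth weight is 1 there, and growth bounds become bounds uniform
    over [K]. *)
Lemma section_bounded : bounded_derivs 1 r K section.
Proof.
move=> k l; case/lastP: l => [|l i] //= _; rewrite size_rcons => lr.
have [gX _ _] := section_iter_smooth i k lr.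
have [C [C0 H]] := gX 1 Rlt_0_1; exists C => z Kz; rewrite section_iter.
have := H z 0 Kz (Rle_refl 0).
have -> : M 0 z = 0 by case: (orbit_rate Kz).
by rewrite !Rmult_0_r Rplus_0_r exp_0 Rmult_1_r.
Qed.

Lemma section_opnorm z : K z -> opnorm (jac section z) < 1.
Proof.
move=> Kz; have [kappa [[k0 k1] H]] := section_contract.
apply: Rle_lt_trans k1; apply: opnorm_le; first lra.
move=> v; apply: (jac_lipschitz _ open_K) => // j.
have [dh ch] := section_Cr j; split; first by move=> i x; exact: (dh [::] r1 i x).
by move=> i; exact: (ch [:: i] r1).
Qed.

End Manifold.

Theorem theorem1p3 (n m r : nat)
  (U Gamma : vec ('I_n + 'I_m)%type -> Prop)
  (f : vec ('I_n + 'I_m)%type -> vec 'I_n)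
  (g : vec ('I_n + 'I_m)%type -> vec 'I_m) :
  (2 <= r)%N ->
  (* Hypothesis 1 *)
  open_vset U -> convex_vset U ->
  (exists d, d > 0 /\ forall x x', U x -> cone x x' -> U x' -> boxB d x x') ->
  (* Hypothesis 2* *)
  CrV r U f -> CrV r U g ->
  bounded_derivs 1 r U f -> bounded_derivs 1 r U g ->
  (exists (alpha ell : vec ('I_n + 'I_m)%type -> R) (c1 cr : R),
     cont_on U alpha /\ (forall x, U x -> alpha x > 0) /\
     cont_on U ell /\ (forall x, U x -> ell x >= 0) /\
     c1 > 0 /\ cr > 0 /\
     forall x, U x ->
       (forall a' : vec 'I_n, inner a' (Da f x a') >= alpha x * vnorm a' ^ 2) /\
       (forall z' : vec 'I_m, inner z' (Dz g x z') <= ell x * vnorm z' ^ 2) /\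
       alpha x >= ell x + opnorm (Dz f x) + opnorm (Da g x) + c1 /\
       alpha x >= INR r * ell x + (INR r + 1) * opnorm (Da g x) + cr) ->
  (* Hypothesis 3 *)
  pos_inv U (fun x => pairv (f x) (g x)) Gamma ->
  (forall z : vec 'I_m, (exists a, Gamma (pairv a z)) <-> (exists a, U (pairv a z))) ->
  (* Conclusion, with K := Pi_perp(U) *)
  (forall S, pos_inv U (fun x => pairv (f x) (g x)) S -> forall x, S x -> Gamma x) /\
  exists h : vec 'I_m -> vec 'I_n,
    let K := fun z : vec 'I_m => exists a, U (pairv a z) in
    CrV r K h /\
    (forall x, Gamma x <-> exists z, K z /\ x = pairv (h z) z) /\
    (forall z1 z2, K z1 -> K z2 -> z1 <> z2 ->
       vnorm (vsub (h z2) (h z1)) < vnorm (vsub z2 z1)) /\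
    (forall z, K z -> opnorm (jac h z) < 1) /\
    bounded_derivs 2 r K h.
Proof.
move=> r2 oU cU [d [_ box]] fC gC fB gB [al [ell [c1 [cr [_ [_ [_ [ell0 [c10 [cr0 H]]]]]]]]]]
  invG projG.
pose F x := pairv (f x) (g x).
have FC : CrV r U F by case=> j; [exact: fC | exact: gC].
have FB : bounded_derivs 1 r U F by case=> j; [exact: fB | exact: gB].
have [Lip dom] := dominated_intro r2 oU cU FC FB c10 cr0 ell0 H.
split; first by move=> S iS x; exact: (invariant_sub r2 dom FC box invG projG iS).
exists (section (U := U) (Gamma := Gamma) (F := F)); split.
  exact: (section_Cr r2 dom FC FB box invG projG).
split; first exact: (section_graph r2 dom FC box invG projG).
split; first exact: (section_strict r2 dom FC box invG projG).
split; first exact: (section_opnorm r2 dom FC FB box invG projG).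
move=> j l l2 lr; apply: (section_bounded r2 dom FC FB box invG projG) => //.
exact: ltnW.
Qed.
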